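(* Let $1\le k<n$ be integers, let $PV_{n,k}$ be the real projective Stiefel manifold, and let $N=\min\{\, j \mid n-k<j\le n \text{ and } \binom{n}{j}\text{ is odd}\,\}$. Then $$N(PV_{n,k})\ \ge\ 2\dim(PV_{n,k})+2m+1,$$ where $m=\max\{\, j \mid \binom{nk+j-1}{nk-1}\not\equiv 0 \pmod 2 \text{ and } 0\le j\le N-1\,\}$, and $N(M)$ denotes the skew embedding dimension of a manifold $M$.
   Context: $V_{n,k}$ is the real Stiefel manifold of orthonormal $k$-tuples of vectors in $\mathbb{R}^n$, $V_{n,k}\cong O(n)/O(n-k)$. The real projective Stiefel manifold is the quotient $PV_{n,k}=V_{n,k}/C_2$, where the cyclic group $C_2$ of order $2$ acts by $\pm1$ (multiplying all vectors of the tuple simultaneously). An embedding of a smooth manifold $M$ in $\mathbb{R}^d$ is called totally skew (or a skew embedding) if for any two distinct points of $M$ the affine tangent subspaces of $\mathbb{R}^d$ at these points are skew, i.e. they do not intersect and contain no parallel lines. For a smooth manifold $M$, $N(M)=\min\{\, d \mid M \text{ admits a skew embedding in } \mathbb{R}^d\,\}$. (The integer $N$ and the invariant $N(M)$ are different objects.) *)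

(* Defs.v *)
From HB Require Import structures.
From mathcomp Require Import all_boot all_order all_algebra.
From mathcomp Require Import all_classical all_reals topology normedtype derive.

Set Implicit Arguments.
Unset Strict Implicit.
Unset Printing Implicit Defensive.

Import Order.TTheory GRing.Theory Num.Theory.
Import numFieldNormedType.Exports.

Local Open Scope classical_set_scope.
Local Open Scope ring_scope.

Section Smooth.
Context {R : realType}.

(* C^r and C^oo real functions on an open set of a finite-dimensional space;
   meant for open U only, so that [f] matters only through its values on U. *)
Fixpoint cont_diff {V : normedModType R} (r : nat) (U : set V) (f : V -> R)
    : Prop :=
  if r is r'.+1 then
    (forall x, U x -> differentiable f x) /\
    (forall v, cont_diff r' U ('D_v f))
  else forall x, U x -> {for x, continuous f}.

Definition smooth_fun {V : normedModType R} (U : set V) (f : V -> R) : Prop :=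
  forall r, cont_diff r U f.

(* A smooth structure is encoded, as in Bredon's "Topology and Geometry"
   (functional structures), by the smooth real functions on each open set.
   [smooth_on U f] is meant for open U, and should depend only on the
   restriction of [f] to U.  No manifold axiom is part of the record: the charts
   are in [locally_euclidean]. *)
Record smooth_space := SmoothSpace {
  carrier :> topologicalType;
  smooth_on : set carrier -> (carrier -> R) -> Prop }.

(* Subspace of a normed space: smooth functions are those which extend, near
   each point, to a smooth function of the ambient space. *)
Definition submanifold {V : normedModType R} (S : set V) : smooth_space :=
  @SmoothSpace (set_type S) (fun U f =>
    forall x : S, U x -> exists (W : set V) (F : V -> R),
      [/\ open W, W (set_val x), smooth_fun W F &
          forall y : S, U y -> W (set_val y) -> f y = F (set_val y)]).

Definition quotient_space (M : smooth_space) (Q : quotType M) : smooth_space :=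
  @SmoothSpace (quotient_topology Q) (fun U f =>
    let pr := (\pi_(quotient_topology Q) : M -> quotient_topology Q)%qT in
    smooth_on (pr @^-1` U) (f \o pr)).

Implicit Types M : smooth_space.

(* A chart: an isomorphism of smooth spaces [phi], with inverse [psi], from the
   open set U onto an open set of R^q. *)
Definition is_chart M (q : nat) (U : set M)
    (phi : M -> 'rV[R]_q) (psi : 'rV[R]_q -> M) : Prop :=
  [/\ open U /\ open (phi @` U),
      forall x, U x -> psi (phi x) = x,
      forall x, U x -> {for x, continuous phi} /\ {for phi x, continuous psi} &
      forall (W : set 'rV[R]_q) (g : 'rV[R]_q -> R),
        open W -> W `<=` phi @` U ->
        smooth_fun W g <-> smooth_on (U `&` phi @^-1` W) (g \o phi)].

Definition locally_euclidean M (q : nat) : Prop :=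
  forall p : M, exists U phi psi, U p /\ @is_chart M q U phi psi.

(* The dimension of a nonempty manifold; 0 if M is not locally Euclidean. *)
Definition manifold_dim M : nat := xget 0%N [set q | locally_euclidean M q].

(* Tangent vectors at p are the derivations at p of the algebra of globally
   smooth functions; only the values of [D] on smooth functions matter. *)
Definition derivation_at M (p : M) (D : (M -> R) -> R) : Prop :=
  (forall a f g, smooth_on setT f -> smooth_on setT g ->
     D (fun x => a * f x + g x) = a * D f + D g) /\
  (forall f g, smooth_on setT f -> smooth_on setT g ->
     D (fun x => f x * g x) = D f * g p + f p * D g).

Section Maps.
Variables (M : smooth_space) (d : nat) (f : M -> 'rV[R]_d).

Definition coordinate (j : 'I_d) : M -> R := fun x => f x ord0 j.

Definition smooth_map : Prop := forall j, smooth_on setT (coordinate j).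

Definition differential (D : (M -> R) -> R) : 'rV[R]_d :=
  \row_j D (coordinate j).

Definition immersion : Prop :=
  smooth_map /\
  forall p D, derivation_at p D -> differential D = 0 ->
    forall g, smooth_on setT g -> D g = 0.

Definition embedding : Prop :=
  [/\ immersion, injective f &
      forall U : set M,
        open U <-> exists2 W : set 'rV[R]_d, open W & U = f @^-1` W].

Definition affine_tangent (p : M) : set 'rV[R]_d :=
  [set f p + differential D | D in [set D | derivation_at p D]].

End Maps.

Definition line d (x u : 'rV[R]_d) : set 'rV[R]_d :=
  [set x + t *: u | t in [set: R]].

Definition skew d (A B : set 'rV[R]_d) : Prop :=
  A `&` B = set0 /\
  ~ (exists x y u, [/\ u != 0, line x u `<=` A & line y u `<=` B]).

Definition skew_embedding M d (f : M -> 'rV[R]_d) : Prop :=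
  embedding f /\
  forall p q, p <> q -> skew (affine_tangent f p) (affine_tangent f q).

Definition admits_skew_embedding M (d : nat) : Prop :=
  exists f : M -> 'rV[R]_d, skew_embedding f.

(* The invariant written N(M); 0 if M has no skew embedding, so that a positive lower
   bound on [skew_dim M] includes the existence of a skew embedding. *)
Definition skew_dim M : nat :=
  xget 0%N [set d | admits_skew_embedding M d /\
                    forall d', admits_skew_embedding M d' -> (d <= d')%N].

End Smooth.

Arguments smooth_space : clear implicits.

Section ProjectiveStiefel.
Variables (R : realType) (n k : nat).

(* The k-tuple of vectors of R^n is the tuple of columns. *)
Definition stiefel_set : set 'M[R]_(n, k) := [set A | A^T *m A = 1%:M].

Definition stiefel : smooth_space R := submanifold stiefel_set.

(* The orbit relation of the action of C_2 by sign. *)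
Definition sign_rel : rel stiefel_set := fun A B =>
  (set_val B == set_val A) || (set_val B == - set_val A).

Lemma sign_rel_refl : reflexive sign_rel.
Proof. by move=> A; rewrite /sign_rel eqxx. Qed.

Lemma sign_rel_sym : symmetric sign_rel.
Proof.
by move=> A B; rewrite /sign_rel [set_val A == - _]eq_sym eqr_oppLR eq_sym.
Qed.

Lemma sign_rel_trans : transitive sign_rel.
Proof.
move=> B A C; rewrite /sign_rel.
by move=> /orP[]/eqP-> /orP[]/eqP->; rewrite ?opprK eqxx ?orbT.
Qed.

Definition sign_equiv : equiv_rel stiefel_set :=
  EquivRel sign_rel sign_rel_refl sign_rel_sym sign_rel_trans.

Definition projective_stiefel : smooth_space R :=
  @quotient_space R stiefel {eq_quot sign_equiv}%qT.

End ProjectiveStiefel.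

(* The minimum of { j | n - k < j <= n, 'C(n, j) odd }, which contains n as soon
   as 0 < k <= n. *)
Definition stiefel_N (n k : nat) : nat :=
  [arg min_(j < (ord_max : 'I_n.+1) | (n - k < j)%N && odd 'C(n, j)) (j : nat)].

(* The maximum over a set which contains 0. *)
Definition stiefel_m (n k : nat) : nat :=
  \max_(j < stiefel_N n k | 'C(n * k + j - 1, n * k - 1) != 0 %[mod 2]) j.

(* Main.v *)
(* Write PV = PV_{n,k}, K = nk, and call frame a matrix A with A^T A = 1.  A skew embedding f
   turns frames A, B, tangent vectors X at A, Y at B and a scalar t into the vector
   df_A X - df_B Y + t (f A - f B), which vanishes only if A = +- B or X = Y = t = 0.
   Adding the equations A^T X + X^T A = 0 and B^T Y + Y^T B = 0 frees X and Y from being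
   tangent, so these data live on a family (A, B) times a sphere of triples (X, Y, t).

   The families of pairs are parametrized by cosines and sines placed at the nodes of binary
   trees, on which a group (Z/2)^e acts by signs.  A Borsuk-Ulam theorem for such
   parametrizations, proved by counting paths in a cubical grid (as in Tucker's lemma), gives
   a common zero of equations of prescribed sign behaviours as soon as the product of these
   behaviours, read in the cohomology of an iterated projective bundle, is the top class.  Here
   this is the parity of 'C(K + m - 1, m), a coefficient of (1 - z)^-K.  A and B come from one
   family of frames, which exists because 'C(n, j) is even for
   n - k < j <= m; interchanging two columns in B ensures A <> +- B.  For k = 1 one
   imposes <A, B> = 0 instead.

   The bound also requires some skew embedding to exist: the products u, u v and u^3 of the
   functions u, v of the form A_a A_b give one, where immersivity for derivations follows
   from Hadamard's lemma and bump functions.  Finally a chart of PV lifts to a differentiable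
   family of frames, so that dim PV <= nk - k(k+1)/2. *)
Require Import Defs.
From HB Require Import structures.
From mathcomp Require Import all_boot all_order all_algebra perm zify ring lra.
From mathcomp Require Import all_classical all_reals all_analysis.

Set Implicit Arguments.
Unset Strict Implicit.
Unset Printing Implicit Defensive.

Import Order.TTheory GRing.Theory Num.Theory.
Import numFieldNormedType.Exports.

Local Open Scope classical_set_scope.
Local Open Scope ring_scope.

(** * Paths in the cube *)

(** No cohomology ring is built. The cube with opposite facets glued by sign changes is a tower of
    circles; a degree one class of it is a vector of bits, and a product of [e] classes is known
    only through its value, a parity of paths. A ring relation is therefore stated as the vanishing
    of all words that contain it. The trees write a sphere as an iterated join, so that angles at
    the nodes parametrize it, and the sign actions of the nodes combine into the antipodal sign. The
    numbers: two spheres of dimension m carry A and B, with classes x and y, and the sphere of (X,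
    Y, t) has dimension 2K and class z, so there are 2K + 2m angles. The relations x^(m+1) = y^(m+1)
    = 0 and z (z+x)^K (z+y)^K = 0 make z^(2K+2m) the coefficient of x^m y^m in (1+x)^-K (1+y)^-K,
    which is the square of 'C(K + m - 1, m). All d + k(k+1) equations have class z. If this number
    were at most 2K + 2m, a common zero would contradict skewness; hence d > 2 (K - k(k+1)/2) + 2m,
    and the bound on dim PV concludes. *)

Lemma addFF (x : 'F_2) : x + x = 0.
Proof. by rewrite -mulr2n -mulr_natr pchar_Fp_0 // mulr0. Qed.

Lemma F2_eq01 (x : 'F_2) : x = 0 \/ x = 1.
Proof. by case: x => [[|[|?]] ?] //; [left|right]; apply: ord_inj. Qed.

Lemma F2_add_eq0 (x y : 'F_2) : x + y = 0 -> x = y.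
Proof. by move=> h; rewrite -[x]addr0 -(addFF y) addrA h add0r. Qed.

Lemma sum_involution (T : finType) (f : T -> 'F_2) (phi : T -> T) :
  involutive phi -> (forall x, phi x != x) -> (forall x, f (phi x) = f x) ->
  \sum_x f x = 0.
Proof.
move=> phiK phiN fphi; pose r := @enum_rank T.
rewrite (bigID (fun x => r x < r (phi x))%N) /=.
rewrite [X in _ + X](reindex_inj (inv_inj phiK)) /=.
rewrite [X in _ + X](eq_big (fun x => r x < r (phi x))%N f) ?addFF //.
move=> x; rewrite phiK -leqNgt leq_eqVlt.
case: eqP => //= /val_inj /enum_rank_inj /eqP; by rewrite eq_sym (negPf (phiN x)).
Qed.

Lemma prod_ord_split e (D : nat -> 'F_2) (g : nat) : (g < e)%N ->
  \prod_(j < e) D j = \prod_(0 <= j < g) D j * D g * \prod_(g.+1 <= j < e) D j.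
Proof.
move=> ge; rewrite -(big_mkord xpredT) (big_cat_nat (n := g)) //=; last exact: ltnW.
by rewrite [X in _ * X]big_ltn // mulrA.
Qed.

Section Paths.
Variables (e M : nat).

Definition class := {ffun 'I_e -> 'F_2}.
Definition vertex := {ffun 'I_e -> nat}.
Definition gpath := ({ffun 'I_e -> 'I_M} * {ffun 'I_e -> bool} * {perm 'I_e})%type.
Implicit Types (p : gpath) (v : vertex) (s : vertex -> 'F_2).

(* Along a path, coordinate [i] jumps at time [p.2 i] from an even value to an
   adjacent odd one, so a path is a flag of the barycentric subdivision. *)
Definition vtx p (j : nat) : vertex :=
  [ffun i => if (p.2 i < j)%N then (p.1.1 i).*2.+1 else (p.1.1 i + p.1.2 i).*2].

Definition dif s (V : nat -> vertex) (j : nat) := s (V j) + s (V j.+1).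

(** The cup product of the coboundaries of [s 0], ..., [s e.-1] on the sum of all top simplices: the
    parity of the number of paths such that, for every [j], the sign [s j] changes at the [j]-th
    step. *)
Definition pathsum (s : nat -> vertex -> 'F_2) :=
  \sum_(p : gpath) \prod_(j < e) dif (s j) (vtx p) j.

Definition swap_time (l : nat) (e0 : (l.+1 < e)%N) p : gpath :=
  (p.1, (p.2 * tperm (Ordinal (ltnW e0)) (Ordinal e0))%g).

Lemma vtx_swap_time l e0 p j : j != l.+1 -> vtx (@swap_time l e0 p) j = vtx p j.
Proof.
move=> jl; apply/ffunP => i; rewrite !ffunE permM /=.
case: tpermP => [->|->|] //=.
  by rewrite ltn_neqAle eq_sym jl.
by rewrite [in RHS]ltn_neqAle [l.+1 == j]eq_sym jl.
Qed.

(** Exchanging two consecutive jumps alters only the vertex between them, so a face opposite to an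
    intermediate vertex lies in exactly two simplices. *)
Lemma sum_swap_time l (l1e : (l.+1 < e)%N) (R : (nat -> vertex) -> 'F_2) :
  (forall V V', (forall j, j != l.+1 -> V j = V' j) -> R V = R V') ->
  \sum_(p : gpath) R (vtx p) = 0.
Proof.
move=> RV; apply: (sum_involution (phi := swap_time l1e)).
- by move=> [p t]; rewrite /swap_time /= -mulgA tperm2 mulg1.
- move=> [p t]; apply/eqP => -[].
  move=> /(congr1 (fun r : {perm 'I_e} => r (t^-1%g (Ordinal l1e)))).
  by rewrite permM permKV tpermR => /(congr1 val) /= /n_Sn.
- by move=> p; apply: RV => j; exact: vtx_swap_time.
Qed.

Definition flip_first (e0 : (0 < e)%N) p : gpath :=
  (p.1.1, [ffun i => p.1.2 i (+) (p.2 i == Ordinal e0)], p.2).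

(** The coordinate that jumps first reaches its odd value from either of the two even neighbours, so
    the faces opposite to the first vertex cancel in pairs. *)
Lemma sum_flip_first (e0 : (0 < e)%N) (R : (nat -> vertex) -> 'F_2) :
  (forall V V', (forall j, j != 0%N -> V j = V' j) -> R V = R V') ->
  \sum_(p : gpath) R (vtx p) = 0.
Proof.
move=> RV; apply: (sum_involution (phi := flip_first e0)).
- move=> [[a d] t]; congr (_, _, _); apply/ffunP => i; rewrite !ffunE /=.
  by rewrite -addbA addbb addbF.
- move=> [[a d] t]; apply/eqP => -[] /ffunP /(_ (t^-1%g (Ordinal e0))).
  by rewrite ffunE permKV eqxx; case: (d _).
- move=> [[a d] t]; apply: RV => -[//|j] _; apply/ffunP => i; rewrite !ffunE /=.
  case: ifPn => // tij; case: eqP => [ti0|]; rewrite ?addbF //.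
  by rewrite ti0 in tij.
Qed.

Lemma pathsum_gap_left (s : nat -> vertex -> 'F_2) g (R : (nat -> vertex) -> 'F_2) :
  (g < e)%N ->
  (forall V V', (forall j, (g < j)%N -> V j = V' j) -> R V = R V') ->
  \sum_(p : gpath) (\prod_(0 <= j < g) dif (s j) (vtx p) j) * R (vtx p) = 0.
Proof.
elim: g R => [|g IH] R ge RV.
  rewrite (eq_bigr (fun p => R (vtx p))); last by move=> p _; rewrite big_nil mul1r.
  by apply: sum_flip_first => // V V' VV; apply: RV => j j0; apply: VV; case: j j0.
under eq_bigr do rewrite big_nat_recr //= mulrDr mulrDl.
rewrite big_split /= [X in _ + X](_ : _ = 0) ?addr0; last first.
  under eq_bigr do rewrite -mulrA.
  apply: (IH (fun V => s g (V g.+1) * R V)) => [|V V' VV]; first exact: ltnW.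
  by rewrite VV // (RV V V') // => j gj; apply: VV; exact: ltnW.
pose Q V := \prod_(0 <= j < g) dif (s j) V j * s g (V g) * R V.
apply: (@sum_swap_time _ ge Q) => V V' VV; rewrite /Q; congr (_ * _ * _).
- rewrite big_seq [RHS]big_seq; apply: eq_bigr => j.
  rewrite mem_index_iota /dif => jg; rewrite !VV //; lia.
- by rewrite VV //; lia.
- by apply: RV => j gj; apply: VV; lia.
Qed.

Variable S : 'I_e -> class.
Hypothesis S_diag : forall i, S i i = 1.
Hypothesis S_tri : forall i k : 'I_e, (i < k)%N -> S i k = 0.

(** The gluing of facet [i] to the opposite facet. Column [i] of [S] tells which coordinates are
    reversed; as [S] is triangular these are [i] itself and some higher ones, so the glued cube is a
    tower of circles over circles. *)
Definition refl (i : 'I_e) v : vertex :=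
  [ffun k => if S k i == 0 then v k else (M.*2 - v k)%N].

(** The coboundary of such an [s] descends to the glued cube, and its cohomology class is [w]; [s]
    itself descends only if [w = 0]. *)
Definition of_class s (w : class) :=
  forall v i, (forall k, v k <= M.*2)%N -> (v i == 0%N) || (v i == M.*2) ->
    s (refl i v) = s v + w i.

Lemma vtx_le p j k : (vtx p j k <= M.*2)%N.
Proof.
rewrite ffunE; case: ifP => _; have := ltn_ord (p.1.1 k); case: (p.1.2 k); lia.
Qed.

Section Last.
Hypothesis e_gt0 : (0 < e)%N.
Fact pred_e_lt : (e.-1 < e)%N. Proof. by rewrite prednK. Qed.

Definition last_coord p : 'I_e := (p.2^-1)%g (Ordinal pred_e_lt).

Definition at_facet p :=
  ((p.1.1 (last_coord p) == 0 :> nat) && ~~ p.1.2 (last_coord p)) ||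
  ((p.1.1 (last_coord p) == M.-1 :> nat) && p.1.2 (last_coord p)).

Definition shift_ord (x : 'I_M) (b : bool) : 'I_M :=
  insubd x (if b then x.+1 else x.-1).

(* Keeps all vertices but the last one, except that a path whose first vertices
   lie in the facet of its last coordinate is moved by the gluing. *)
Definition flip_last p : gpath :=
  let i := last_coord p in
  if at_facet p then
    ([ffun k => if S k i == 0 then p.1.1 k else rev_ord (p.1.1 k)],
     [ffun k => p.1.2 k (+) (S k i != 0)], p.2)
  else ([ffun k => if k == i then shift_ord (p.1.1 k) (p.1.2 k) else p.1.1 k],
        [ffun k => p.1.2 k (+) (k == i)], p.2).

Lemma last_coord_flip p : last_coord (flip_last p) = last_coord p.
Proof. by rewrite /last_coord /flip_last; case: ifP. Qed.

Lemma val_shift_ord p : ~~ at_facet p ->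
  val (shift_ord (p.1.1 (last_coord p)) (p.1.2 (last_coord p))) =
  if p.1.2 (last_coord p) then (p.1.1 (last_coord p)).+1
  else (p.1.1 (last_coord p)).-1.
Proof.
move=> nf; rewrite /shift_ord val_insubd; case: ifP => // /negP[].
move: nf; rewrite /at_facet; have := ltn_ord (p.1.1 (last_coord p)).
by case: (p.1.2 _); rewrite /= ?andbT ?andbF ?orbF; lia.
Qed.

Lemma at_facet_flip p : at_facet (flip_last p) = at_facet p.
Proof.
rewrite {1}/at_facet last_coord_flip; set i := last_coord p.
have ai := ltn_ord (p.1.1 i).
case fp : (at_facet p); rewrite /flip_last fp /= !ffunE -/i.
  rewrite S_diag oner_eq0 /=; move: fp; rewrite /at_facet -/i.
  by case: (p.1.2 i); rewrite /= ?andbT ?andbF ?orbF; lia.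
rewrite eqxx val_shift_ord ?fp // -/i; move: fp; rewrite /at_facet -/i.
by case: (p.1.2 i); rewrite /= ?andbT ?andbF ?orbF /=; lia.
Qed.

Lemma flip_lastK : involutive flip_last.
Proof.
move=> p; rewrite {1}/flip_last at_facet_flip last_coord_flip /flip_last.
case fp : (at_facet p); case: p fp => [[a d] t] /= fp; congr (_, _, _);
  apply/ffunP => k; rewrite !ffunE.
- by case: (S k _ == 0); rewrite ?rev_ordK.
- by rewrite -addbA addbb addbF.
- case: eqP => // ->; apply/val_inj; set i := last_coord _ in fp *.
  have := @val_shift_ord (a, d, t); rewrite /= -/i fp => /(_ isT) E.
  rewrite {1}/shift_ord val_insubd E.
  have ai := ltn_ord (a i); move: fp; rewrite /at_facet -/i /=.
  by case: (d i) => /=; rewrite ?andbT ?andbF ?orbF => fp; case: ifP; lia.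
- by rewrite -addbA addbb addbF.
Qed.

Lemma flip_last_neq p : flip_last p != p.
Proof.
apply/negP => /eqP /(congr1 (fun q : gpath => q.1.2 (last_coord p))).
by rewrite /flip_last; case: ifP => _ /=; rewrite ffunE ?S_diag ?oner_eq0 ?eqxx;
  case: (p.1.2 _).
Qed.

Lemma last_coord_time p k j : (j < e)%N -> (p.2 k < j)%N -> k != last_coord p.
Proof.
move=> je kj; apply/negP => /eqP kE; move: kj.
by rewrite kE /last_coord permKV /=; lia.
Qed.

Lemma vtx_flip_last p j : (j < e)%N ->
  vtx (flip_last p) j = if at_facet p then refl (last_coord p) (vtx p j) else vtx p j.
Proof.
move=> je; apply/ffunP => k; rewrite /flip_last.
have ak := ltn_ord (p.1.1 k).
case fp : (at_facet p); rewrite !ffunE /=.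
  case: eqP => _ /=; first by rewrite addbF.
  by case: ifP => _; case: (p.1.2 k); lia.
case: ifP => [kj|_]; first by rewrite (negPf (last_coord_time je kj)).
case: eqP => [->|_]; last by rewrite addbF.
rewrite val_shift_ord ?fp //; move: fp; rewrite /at_facet.
by case: (p.1.2 _) => /=; rewrite ?andbT ?andbF ?orbF; lia.
Qed.

(** A face opposite to the last vertex either separates two adjacent cells or lies in the boundary
    of the cube. In the second case it is paired with its image under the gluing, hence the
    invariance required of [R]. *)
Lemma sum_flip_last (R : (nat -> vertex) -> 'F_2) :
  (forall V V', (forall j, (j < e)%N -> V j = V' j) -> R V = R V') ->
  (forall (V : nat -> vertex) i, (forall j k, V j k <= M.*2)%N ->
     (forall j, (j < e)%N -> (V j i == 0%N) || (V j i == M.*2)) ->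
     R (fun j => refl i (V j)) = R V) ->
  \sum_(p : gpath) R (vtx p) = 0.
Proof.
move=> RV Rinv; apply: (sum_involution (phi := flip_last)).
- exact: flip_lastK.
- exact: flip_last_neq.
- move=> p; rewrite (RV _ (fun j => if at_facet p then refl (last_coord p) (vtx p j) else vtx p j));
    last by move=> j; exact: vtx_flip_last.
  case fp : (at_facet p) => //; apply: Rinv => [j k|j je]; first exact: vtx_le.
  rewrite ffunE; case: ifP => [/(last_coord_time je)|_]; first by rewrite eqxx.
  have := ltn_ord (p.1.1 (last_coord p)).
  move: fp; rewrite /at_facet; case: (p.1.2 _) => /=;
    rewrite ?andbT ?andbF ?orbF; lia.
Qed.

End Last.

Lemma pathsum_gap_right (s : nat -> vertex -> 'F_2) (w : nat -> class) g
    (R : (nat -> vertex) -> 'F_2) :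
  (0 < g <= e)%N -> (forall j, (g <= j < e)%N -> of_class (s j) (w j)) ->
  (forall V V', (forall j, (j < g)%N -> V j = V' j) -> R V = R V') ->
  (forall (V : nat -> vertex) i, (forall j k, V j k <= M.*2)%N ->
     (forall j, (j < g)%N -> (V j i == 0%N) || (V j i == M.*2)) ->
     R (fun j => refl i (V j)) = R V) ->
  \sum_(p : gpath) R (vtx p) * \prod_(g <= j < e) dif (s j) (vtx p) j = 0.
Proof.
move=> /andP[g0 ge]; have [n En] : exists n, (e - g)%N = n by exists (e - g)%N.
elim: n g R g0 ge En => [|n IH] g R g0 ge En sw RV Rinv.
  have Eg : g = e by lia.
  rewrite Eg in g0 RV Rinv *.
  under eq_bigr do rewrite big_geq // mulr1.
  exact: (sum_flip_last g0 RV Rinv).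
have ltge : (g < e)%N by lia.
(* [s g (V g)] is not invariant under the gluings, but its sum with [s g (V g.-1)] is, because both
   change by the same bit of [w g]. The remainder [Q'] avoids [V g] and cancels by exchanging two
   jumps. *)
pose Q (V : nat -> vertex) := R V * (s g (V g) + s g (V g.-1)).
pose Q' (V : nat -> vertex) := R V * (s g (V g.-1) + s g (V g.+1)) *
  \prod_(g.+1 <= j < e) dif (s j) V j.
rewrite (eq_bigr (fun p => Q (vtx p) * (\prod_(g.+1 <= j < e) dif (s j) (vtx p) j)
   + Q' (vtx p))); last first.
  move=> p _; rewrite big_ltn // /Q /Q' mulrA -mulrDl -mulrDr; congr (_ * _ * _).
  by rewrite addrA -[s g _ + _ + _]addrA addFF addr0.
rewrite big_split /= IH ?add0r //; try lia.
- move: ltge; rewrite -{1}(prednK g0) => ltge.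
  apply: (@sum_swap_time _ ltge Q') => V V' VV.
  rewrite /Q'; congr (_ * _ * _).
  + by apply: RV => j jg; apply: VV; lia.
  + by rewrite !VV //; lia.
  + rewrite big_seq [RHS]big_seq; apply: eq_bigr => j.
    rewrite mem_index_iota /dif => jg; rewrite !VV //; lia.
- by move=> j jg; apply: sw; lia.
- move=> V V' VV; rewrite /Q (RV V V') ?VV //; try lia.
  by move=> j jg; apply: VV; lia.
- move=> V i Vle Vi; rewrite /Q Rinv //; last by move=> j jg; apply: Vi; lia.
  rewrite !(sw g) ?leqnn //; try by apply: Vi; lia.
  by rewrite addrACA addFF addr0.
Qed.

(** A sign function of class 0 lives on the glued cube, so its coboundary is trivial there. Opening
    the difference at [g] gives one term for each of the two gap lemmas. *)
Lemma pathsum_class0 (s : nat -> vertex -> 'F_2) (w : nat -> class) g :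
  (g < e)%N -> (forall j, (j < e)%N -> of_class (s j) (w j)) -> w g = 0 ->
  pathsum s = 0.
Proof.
move=> ge sw wg0; rewrite /pathsum.
under eq_bigr => p _ do rewrite (prod_ord_split (fun j => dif (s j) (vtx p) j) ge) /= {2}/dif.
under eq_bigr do rewrite mulrDr mulrDl.
rewrite big_split /= -[RHS]addr0; congr (_ + _); last first.
  under eq_bigr do rewrite -mulrA.
  apply: (@pathsum_gap_left s g (fun V => s g (V g.+1) * \prod_(g.+1 <= j < e) dif (s j) V j)) => //.
  move=> V V' VV; congr (_ * _); first by rewrite VV.
  by rewrite big_seq [RHS]big_seq; apply: eq_bigr => j;
    rewrite mem_index_iota /dif => jg; rewrite !VV //; lia.
apply: (@pathsum_gap_right s w g.+1 (fun V => (\prod_(0 <= j < g) dif (s j) V j) * s g (V g))) => //.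
- by move=> j jg; apply: sw; lia.
- move=> V V' VV; congr (_ * _); last by rewrite VV.
  by rewrite big_seq [RHS]big_seq; apply: eq_bigr => j;
    rewrite mem_index_iota /dif => jg; rewrite !VV //; lia.
- move=> V i Vle Vi; congr (_ * _).
    rewrite big_seq [RHS]big_seq; apply: eq_bigr => j.
    rewrite mem_index_iota /dif => jg.
    rewrite !(sw j) //; try (apply: Vi; lia); try lia.
    by rewrite addrACA addFF addr0.
  rewrite (sw g) //; last by apply: Vi; lia.
  by rewrite wg0 ffunE addr0.
Qed.

Lemma of_class_add s s' w w' : of_class s w -> of_class s' w' ->
  of_class (fun v => s v + s' v) (w + w').
Proof. by move=> sw sw' v i vl vi; rewrite sw // sw' // ffunE addrACA. Qed.

Lemma pathsum_add1 (s s1 s2 : nat -> vertex -> 'F_2) g :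
  (g < e)%N -> (forall j v, j != g -> s1 j v = s j v) ->
  (forall j v, j != g -> s2 j v = s j v) ->
  (forall v, s g v = s1 g v + s2 g v) ->
  pathsum s = pathsum s1 + pathsum s2.
Proof.
move=> ge h1 h2 hg; rewrite /pathsum -big_split; apply: eq_bigr => p _ /=.
have E (t : nat -> vertex -> 'F_2) : (forall j v, j != g -> t j v = s j v) ->
    \prod_(j < e) dif (t j) (vtx p) j =
    \prod_(0 <= j < g) dif (s j) (vtx p) j * dif (t g) (vtx p) g *
    \prod_(g.+1 <= j < e) dif (s j) (vtx p) j.
  move=> ht; rewrite (prod_ord_split (fun j => dif (t j) (vtx p) j) ge) /=; congr (_ * _ * _);
    rewrite big_seq [RHS]big_seq; apply: eq_bigr => j; rewrite mem_index_iota => jg;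
    rewrite /dif !ht //; lia.
rewrite !E // -mulrDl -mulrDr; congr (_ * _ * _).
by rewrite /dif !hg addrACA.
Qed.

(** Factors are exchanged one at a time: [s g] and [t g] have the same class, so their sum has class
    0 and contributes nothing. *)
Lemma pathsum_class (s t : nat -> vertex -> 'F_2) (w : nat -> class) :
  (forall j, (j < e)%N -> of_class (s j) (w j)) ->
  (forall j, (j < e)%N -> of_class (t j) (w j)) -> pathsum s = pathsum t.
Proof.
move=> sw tw; pose u g j := if (j < g)%N then t j else s j.
have uw g j : (j < e)%N -> of_class (u g j) (w j).
  by move=> je; rewrite /u; case: ifP => _; [exact: tw|exact: sw].
have E g : (g <= e)%N -> pathsum (u g) = pathsum s.
  elim: g => [//|g IH] ge; rewrite -IH ?(ltnW ge) //; apply: F2_add_eq0.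
  pose d j v := if j == g then t j v + s j v else u g j v.
  rewrite -(@pathsum_add1 d _ _ g) //.
  - apply: (@pathsum_class0 d (fun j => if j == g then 0 else w j) g) => //; last by rewrite eqxx.
    move=> j je; rewrite /d; case: eqP => [->|_]; last exact: uw.
    have -> : 0 = w g + w g by apply/ffunP => i; rewrite !ffunE addFF.
    by apply: of_class_add; [exact: tw|exact: sw].
  - by move=> j v jg; rewrite /d /u (negPf jg) ltnS leq_eqVlt (negPf jg).
  - by move=> j v jg; rewrite /d (negPf jg).
  - by move=> v; rewrite /d /u eqxx ltnSn ltnn.
rewrite -(E e) //; apply: eq_bigr => p _; apply: eq_bigr => j _.
by rewrite /u ltn_ord.
Qed.

(** * Reference sign functions and the value of a word *)

Hypothesis M_gt1 : (1 < M)%N.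

Definition delta (i : 'I_e) : class := [ffun k => (k == i)%:R].

Fixpoint facet_bit_rec n (i : 'I_e) v : 'F_2 :=
  if n is n'.+1 then
    if (v i == 0%N) || (v i == M.*2) then
      (v i == 0%N)%:R + \sum_(k < e | (k < i)%N) S i k * facet_bit_rec n' k v
    else 0
  else 0.

(* The sign of the function [cos] of coordinate [i], which is positive inside the
   cube; on the facets, where it vanishes, the sign is that of an equivariant
   perturbation. *)
Definition facet_bit := facet_bit_rec e.

Lemma facet_bit_stable n n' (i : 'I_e) v : (i < n)%N -> (i < n')%N ->
  facet_bit_rec n i v = facet_bit_rec n' i v.
Proof.
elim: n n' i => [//|n IH] [//|n'] i /= ilt ilt'; case: ifP => // _; congr (_ + _).
apply: eq_bigr => k ki; congr (_ * _); apply: IH; lia.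
Qed.

Lemma facet_bitE i v : facet_bit i v = if (v i == 0%N) || (v i == M.*2) then
  (v i == 0%N)%:R + \sum_(k < e | (k < i)%N) S i k * facet_bit k v else 0.
Proof.
rewrite {1}/facet_bit (facet_bit_stable (n' := e.+1) v (ltn_ord i)) //.
exact: (ltn_trans (ltn_ord i)).
Qed.

Lemma natF2_neg (b : bool) : (~~ b)%:R = b%:R + 1 :> 'F_2.
Proof. by case: b => /=; rewrite ?add0r // addFF. Qed.

Lemma sum_tri_delta (i k : 'I_e) :
  \sum_(j < e | (j < i)%N) S i j * delta j k = if (k < i)%N then S i k else 0.
Proof.
case: ifP => ki.
  rewrite (bigD1 k) //= ffunE eqxx mulr1 big1 ?addr0 // => j /andP[_ jk].
  by rewrite ffunE eq_sym (negPf jk) mulr0.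
rewrite big1 // => j ji; rewrite ffunE; case: eqP => [kj|_]; rewrite ?mulr0 //.
by rewrite kj ji in ki.
Qed.

Lemma facet_bit_class i : of_class (facet_bit i) (delta i).
Proof.
have [n] := ubnP (i : nat); elim: n i => [//|n IH] i in_ v k vle vk.
rewrite [in LHS]facet_bitE [in RHS]facet_bitE.
have Ev : (refl k v i == 0%N) || (refl k v i == M.*2) = (v i == 0%N) || (v i == M.*2).
  by rewrite ffunE; case: ifP => // _; have := vle i; lia.
rewrite Ev; case: ifP => vi; last first.
  rewrite ffunE; case: eqP => [ki|_]; last by rewrite addr0.
  by rewrite ki vi in vk.
have -> : \sum_(k0 < e | (k0 < i)%N) S i k0 * facet_bit k0 (refl k v) =
    \sum_(k0 < e | (k0 < i)%N) S i k0 * facet_bit k0 v + if (k < i)%N then S i k else 0.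
  rewrite -sum_tri_delta -big_split; apply: eq_bigr => j ji /=.
  by rewrite (IH j _ v k vle vk) ?mulrDr //; lia.
have -> : (refl k v i == 0%N)%:R = (v i == 0%N)%:R + S i k.
  rewrite ffunE; case: (F2_eq01 (S i k)) => -> /=; first by rewrite addr0.
  rewrite -natF2_neg; congr (_%:R); congr nat_of_bool; have := vle i; lia.
rewrite [delta _ _]ffunE addrACA; congr (_ + _).
case: (ltngtP k i) => [ki|ki|/val_inj ->].
- by rewrite addFF; case: eqP ki => // ->; rewrite ltnn.
- by rewrite S_tri // addr0; case: eqP ki => // ->; rewrite ltnn.
- by rewrite S_diag eqxx addr0.
Qed.

Definition ref (w : class) v := \sum_(i < e) w i * facet_bit i v.

Lemma ref_class w : of_class (ref w) w.
Proof.
move=> v k vle vk; rewrite /ref.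
under eq_bigr => i _ do rewrite (@facet_bit_class _ v k vle vk) mulrDr.
rewrite big_split /=; congr (_ + _).
rewrite (bigD1 k) //= ffunE eqxx mulr1 big1 ?addr0 // => j jk.
by rewrite ffunE eq_sym (negPf jk) mulr0.
Qed.

Lemma ref_delta i v : ref (delta i) v = facet_bit i v.
Proof.
rewrite /ref (bigD1 i) //= ffunE eqxx mul1r big1 ?addr0 // => j jk.
by rewrite ffunE (negPf jk) mul0r.
Qed.

Lemma ref_add w w' v : ref (w + w') v = ref w v + ref w' v.
Proof. by rewrite -big_split; apply: eq_bigr => i _; rewrite ffunE mulrDl. Qed.

(* The sign of the function [sin] of coordinate [i]. *)
Definition half_bit i v : 'F_2 :=
  if v i == M then \sum_(k < e | (k < i)%N) S i k * facet_bit k v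
  else (v i < M)%:R.

Lemma half_bit_class i : of_class (half_bit i) (S i).
Proof.
move=> v k vle vk; rewrite /half_bit.
have -> : (refl k v i == M) = (v i == M).
  by rewrite ffunE; case: ifP => // _; have := vle i; lia.
case: ifP => vi.
  have ki : k != i by apply: contraTneq vk => ->; lia.
  under eq_bigr => j _ do rewrite (@facet_bit_class _ v k vle vk) mulrDr.
  rewrite big_split /= sum_tri_delta; congr (_ + _).
  case: ltngtP => // [ik|/val_inj E]; first by rewrite S_tri.
  by rewrite E eqxx in ki.
rewrite ffunE; case: (F2_eq01 (S i k)) => -> /=; first by rewrite addr0.
by rewrite -natF2_neg; congr (_%:R); congr nat_of_bool; have := vle i; lia.
Qed.

(** Along a path, coordinate [i] takes only an even value and one adjacent odd value. [facet_bit i]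
    can change only if the even value is on a facet, [half_bit i] only near the middle value [M];
    [1 < M] keeps these places apart. *)
Lemma facet_half_disjoint p i a b :
  dif (facet_bit i) (vtx p) a * dif (half_bit i) (vtx p) b = 0.
Proof.
have odd_int j : vtx p j i = (p.1.1 i).*2.+1 -> facet_bit i (vtx p j) = 0.
  by move=> E; rewrite facet_bitE E; case: ifP => //; lia.
have vE j : vtx p j i = (p.1.1 i).*2.+1 \/ vtx p j i = (p.1.1 i + p.1.2 i).*2.
  by rewrite ffunE; case: ifP; [left|right].
case B : (((p.1.1 i + p.1.2 i).*2 == 0%N) || ((p.1.1 i + p.1.2 i).*2 == M.*2)).
  suff h j : half_bit i (vtx p j) = (p.1.1 i == 0%N :> nat)%:R.
    by rewrite /dif !h addFF mulr0.
  have ai := ltn_ord (p.1.1 i); rewrite /half_bit.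
  case: (vE j) => ->; case: ifP => E; move: B E; case: (p.1.2 i) => /=; try lia;
    move=> *; congr (_%:R); congr nat_of_bool; lia.
suff h j : facet_bit i (vtx p j) = 0 by rewrite /dif !h addr0 mul0r.
by case: (vE j) => E; [exact: odd_int|rewrite facet_bitE E B].
Qed.

(** The intersection number of the classes in [l]. The functions [ref] are one choice among all sign
    functions of these classes; by [J_class] every choice gives the same number. *)
Definition J (l : seq class) := pathsum (fun j => ref (nth 0 l j)).

Lemma J_add l1 l2 x y : (size l1 < e)%N ->
  J (l1 ++ (x + y) :: l2) = J (l1 ++ x :: l2) + J (l1 ++ y :: l2).
Proof.
move=> l1e; apply: (pathsum_add1 l1e).
- by move=> j v jl; rewrite !nth_cat; case: ltngtP jl => // lj _;
    rewrite -(subnSK lj).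
- by move=> j v jl; rewrite !nth_cat; case: ltngtP jl => // lj _;
    rewrite -(subnSK lj).
- by move=> v; rewrite !nth_cat ltnn subnn /= ref_add.
Qed.

Lemma J_class (s : nat -> vertex -> 'F_2) l :
  (forall j, (j < e)%N -> of_class (s j) (nth 0 l j)) -> pathsum s = J l.
Proof. by move=> h; apply: pathsum_class h _ => j _; exact: ref_class. Qed.

(** The cosine and the sine of one angle have no common zero, so their classes [delta i] and [S i]
    multiply to zero. Representing [S i] by [half_bit i] makes every single path contribute zero. *)
Lemma J_facet_half l (a b : 'I_e) i :
  a != b -> nth 0 l a = delta i -> nth 0 l b = S i -> J l = 0.
Proof.
move=> ab la lb.
rewrite -(@J_class (fun j => if j == b :> nat then half_bit i else ref (nth 0 l j))).
  apply: big1 => p _; rewrite (bigD1 a) //= (bigD1 b) /=; last by rewrite eq_sym.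
  rewrite eqxx (negPf (ab : a != b :> nat)) la mulrA.
  rewrite (_ : dif (ref _) (vtx p) a = dif (facet_bit i) (vtx p) a) /dif ?ref_delta //.
  by rewrite facet_half_disjoint mul0r.
move=> j je; case: eqP => [->|_]; first by rewrite lb; exact: half_bit_class.
exact: ref_class.
Qed.

Lemma facet_bit_ext (i : 'I_e) v v' :
  (forall k : 'I_e, (k <= i)%N -> v k = v' k \/
     ~~ ((v k == 0%N) || (v k == M.*2)) /\ ~~ ((v' k == 0%N) || (v' k == M.*2))) ->
  facet_bit i v = facet_bit i v'.
Proof.
have [n] := ubnP (i : nat); elim: n i => [//|n IH] i in_ vv.
rewrite !facet_bitE; case: (vv i (leqnn _)) => [->|[/negPf-> /negPf->] //].
case: ifP => // _; congr (_ + _); apply: eq_bigr => k ki; congr (_ * _).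
by apply: IH => [|j jk]; [lia|apply: vv; lia].
Qed.

Definition flip_coord (i : 'I_e) p : gpath :=
  ([ffun k => if k == i then rev_ord (p.1.1 k) else p.1.1 k],
   [ffun k => p.1.2 k (+) (k == i)], p.2).

Lemma sum_flip_coord i (f : gpath -> 'F_2) :
  (forall p, f (flip_coord i p) = f p) -> \sum_p f p = 0.
Proof.
move=> fi; apply: sum_involution fi => [[[a d] t]|[[a d] t]]; last first.
  apply/eqP => -[_ /ffunP /(_ i)]; rewrite ffunE eqxx /=; by case: (d i).
congr (_, _, _); apply/ffunP => k; rewrite !ffunE /=.
  by case: (k == i); rewrite ?rev_ordK.
by rewrite -addbA addbb addbF.
Qed.

Lemma vtx_flip_coord i p j (k : 'I_e) :
  vtx (flip_coord i p) j k =
  if k == i then (if (p.2 i < j)%N then (rev_ord (p.1.1 i)).*2.+1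
                  else M.*2 - vtx p j i)%N else vtx p j k.
Proof.
rewrite !ffunE /=; case: eqP => [->|_]; last by rewrite addbF.
by case: ifP => // _; rewrite addbT /=; have := ltn_ord (p.1.1 i); case: (p.1.2 i); lia.
Qed.

Lemma perm_ge_id n (t : {perm 'I_n}) : (forall j : 'I_n, (j <= t j)%N) -> t = 1%g.
Proof.
move=> tj; have [_] := leqif_sum (fun j (_ : true) => leqif_eq (tj j)).
have -> : (\sum_(j < n) t j = \sum_(j < n) j)%N.
  rewrite (reindex_inj (@perm_inj _ t^-1%g)) /=.
  by apply: eq_bigr => j _; rewrite permKV.
rewrite eqxx => /esym/forallP h; apply/permP => j; rewrite perm1.
by apply/val_inj; have /= := h j; rewrite eq_sym => /eqP.
Qed.

(** [facet_bit] vanishes at odd values, so a path counts only if coordinate [t j] has not jumped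
    before time [j], for all [j]. This forces the jump times to be [t^-1]. Removing the corrections
    contained in [facet_bit] leaves the single path that starts at the corner 0. *)
Lemma J_perm (t : {perm 'I_e}) l : (forall j : 'I_e, nth 0 l j = delta (t j)) -> J l = 1.
Proof.
move=> lt.
pose h1 p (j : 'I_e) : 'F_2 := (vtx p j (t j) == 0%N)%:R.
pose h2 p (j : 'I_e) := facet_bit (t j) (vtx p j).
pose tot g := \sum_(p : gpath) (p.2 == t^-1)%g%:R *
  \prod_(j < e) (if (j < g)%N then h1 p j else h2 p j).
have odd_val p j : (p.2 (t j) < j)%N -> facet_bit (t j) (vtx p j) = 0.
  by move=> tj; rewrite facet_bitE ffunE tj; case: ifP => //; lia.
have odd_val1 p (j : 'I_e) : (p.2 (t j) <= j)%N -> facet_bit (t j) (vtx p j.+1) = 0.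
  by move=> tj; rewrite facet_bitE ffunE ltnS tj; case: ifP => //; lia.
have -> : J l = tot 0%N.
  apply: eq_bigr => p _; case: eqP => [pt|pt] /=.
    rewrite mul1r; apply: eq_bigr => j _; rewrite /dif lt !ref_delta.
    by rewrite odd_val1 ?addr0 // pt permK.
  rewrite mul0r; apply/eqP; apply: contra_notT pt => /prodf_neq0 nz.
  suff /(congr1 (fun r => t^-1 * r)%g) : (t * p.2)%g = 1%g by rewrite mulKg mulg1.
  apply: perm_ge_id => j; rewrite permM leqNgt; apply/negP => ptj.
  have := nz j isT; rewrite /dif lt !ref_delta odd_val // odd_val1 ?addr0 ?eqxx //.
  exact: ltnW.
(* The two totals differ by the correction [f], which involves coordinates below [t g] only.
   Reflecting coordinate [t g] preserves each term of the difference: factors of index below [g]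
   test other coordinates, and at times after [g] the coordinate [t g] is odd, hence off the
   facets. *)
have tot_step (g : 'I_e) : tot g = tot g.+1.
  apply: F2_add_eq0; rewrite /tot -big_split /=.
  pose f p := \sum_(k < e | (k < t g)%N) S (t g) k * facet_bit k (vtx p g).
  pose bd p : 'F_2 := ((vtx p g (t g) == 0%N) || (vtx p g (t g) == M.*2))%:R.
  rewrite (eq_bigr (fun p => (p.2 == t^-1)%g%:R * (bd p * f p *
     \prod_(j < e | j != g) (if (j < g)%N then h1 p j else h2 p j)))); last first.
    move=> p _; rewrite -mulrDr; congr (_ * _).
    rewrite (bigD1 g) //= [X in _ + X](bigD1 g) //= ltnn leqnn.
    rewrite [X in _ + _ * X](eq_bigr (fun j : 'I_e => if (j < g)%N then h1 p j else h2 p j)).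
      rewrite -mulrDl; congr (_ * _); rewrite /h1 /h2 facet_bitE /bd /f.
      case: eqP => [_|] /=; first by rewrite addrC mul1r addrA addFF add0r.
      by case: ifP => _ _; rewrite ?mul1r ?mul0r ?addr0 ?add0r.
    by move=> j jg; rewrite ltnS leq_eqVlt (negPf (jg : j != g :> nat)).
  apply: (@sum_flip_coord (t g)) => p; case: (eqVneq p.2 t^-1%g) => [pt|pt]; last first.
    by rewrite /= !mul0r.
  have ptg (j : 'I_e) : p.2 (t j) = j by rewrite pt permK.
  rewrite /=; congr (_ * (_ * _ * _)).
  - rewrite /bd vtx_flip_coord eqxx ptg ltnn; congr (_%:R); congr nat_of_bool.
    have := vtx_le p g (t g); lia.
  - apply: eq_bigr => k ki; congr (_ * _); apply: facet_bit_ext => k' kk'; left.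
    rewrite vtx_flip_coord; case: eqP => // E; move: kk' ki; rewrite E; lia.
  - apply: eq_bigr => j jg; case: ifP => jg'.
      by rewrite /h1 vtx_flip_coord (inj_eq perm_inj) (negPf jg).
    apply: facet_bit_ext => k _; rewrite vtx_flip_coord.
    case: eqP => [->|_]; last by left.
    have gj : (g < j)%N by rewrite ltn_neqAle leqNgt jg' eq_sym andbT.
    rewrite ptg gj; right; rewrite ffunE ptg gj; lia.
have totE g : (g <= e)%N -> tot 0%N = tot g.
  by elim: g => [//|g IH] ge; rewrite IH ?(ltnW ge) // (tot_step (Ordinal ge)).
rewrite (totE e) // /tot.
have M0 : (0 < M)%N by lia.
pose p0 : gpath := ([ffun=> Ordinal M0], [ffun=> false], t^-1%g).
rewrite (bigD1 p0) //= eqxx mul1r big1 ?big1 ?addr0 //.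
  move=> p pp0; case: eqP => [pt|_]; last by rewrite mul0r.
  rewrite mul1r; apply/eqP; apply: contraNT pp0 => /prodf_neq0 nz.
  case: p pt nz => [[a d] t'] /= -> nz.
  have ad i : a i = Ordinal M0 /\ d i = false.
    have := nz (t^-1%g i) isT; rewrite ltn_ord /h1 ffunE /= permKV ltnn.
    case: (_ =P 0%N) => [h _|_]; last by rewrite eqxx.
    by move: h; case: (d i) => h; split=> //; try apply/val_inj; move: h => /=; lia.
  apply/eqP; congr (_, _, _); apply/ffunP => i; rewrite ffunE.
    by case: (ad i).
  by case: (ad i).
by move=> j _; rewrite ltn_ord /h1 !ffunE /= permK ltnn.
Qed.

End Paths.

(** * Words of classes *)

Ltac perm_tac := apply/seq.permP => ?;
  rewrite /= ?count_cat /= ?count_cat /= ?count_cat /=;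
  repeat match goal with
  | |- context [count ?a ?l] => let n := fresh "n" in move: (count a l) => n
  | |- context [nat_of_bool ?b] => let n := fresh "n" in move: (nat_of_bool b) => n
  end; lia.

Section Words.
Variables (e M : nat) (S : nat -> class e).
Hypothesis M_gt1 : (1 < M)%N.
Hypothesis S_diag : forall i : 'I_e, S i i = 1.
Hypothesis S_tri : forall i k : 'I_e, (i < k)%N -> S i k = 0.
Implicit Types (x y w : class e) (l R : seq (class e)).

Let JS := @J e M (fun i => S i).

Definition cosc (i : nat) : class e := [ffun k : 'I_e => (k == i :> nat)%:R].

(* All arrangements of the word [l] have value [b]; void unless [size l = e]. *)
Definition ev l (b : 'F_2) := size l = e -> forall l', perm_eq l l' -> JS l' = b.

Lemma ev_perm l l' b : perm_eq l l' -> ev l b -> ev l' b.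
Proof.
move=> ll evl sl' l'' l'l''; apply: evl; first by rewrite (perm_size ll).
exact: perm_trans ll l'l''.
Qed.

Lemma ev_add x y l b b' : ev (x :: l) b -> ev (y :: l) b' -> ev (x + y :: l) (b + b').
Proof.
move=> ex ey sl l' pl.
have xy : x + y \in l' by rewrite -(perm_mem pl) mem_head.
case/splitPr: xy pl => l1 l2 pl.
have {}pl : perm_eq l (l1 ++ l2).
  by rewrite -(perm_cons (x + y)) (perm_trans pl) // perm_catC /= perm_cons perm_catC.
have p1 z : perm_eq (z :: l) (l1 ++ z :: l2).
  by rewrite perm_sym perm_catC /= perm_cons perm_catC perm_sym.
have s1 : (size l1 < e)%N.
  by apply: leq_trans (eq_leq sl); rewrite /= ltnS (perm_size pl) size_cat leq_addr.
by rewrite /JS J_add //; congr (_ + _); [apply: ex|apply: ey].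
Qed.

Lemma ev_add0 x y l b : ev (x :: l) b -> ev (y :: l) 0 -> ev (x + y :: l) b.
Proof. by move=> ex ey; rewrite -[b]addr0; exact: ev_add. Qed.

Lemma ev_zero l : ev (0 :: l) 0.
Proof.
move=> sl l' pl; have l0 : 0 \in l' by rewrite -(perm_mem pl) mem_head.
case/splitPr: l0 pl => l1 l2 pl.
rewrite -[X in l1 ++ X :: _](addr0 (0 : class e)) /JS J_add ?addFF //.
by apply: leq_trans (eq_leq sl); rewrite (perm_size pl) size_cat /= addnS ltnS leq_addr.
Qed.

Lemma ev_cos_sin i l : (i < e)%N -> ev (cosc i :: S i :: l) 0.
Proof.
move=> ie sl l' pl; pose k : 'I_e := Ordinal ie.
have sl' : size l' = e by rewrite -(perm_size pl).
have dk : cosc i = delta k by apply/ffunP => j; rewrite !ffunE.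
have : cosc i \in l' by rewrite -(perm_mem pl) mem_head.
move=> /(nthP 0)[a]; rewrite sl' => ae na.
have [b be [ab nb]] : exists2 b, (b < e)%N & b != a /\ nth 0 l' b = S i.
  (* If the two classes coincide, a second occurrence of the same letter has to be found, before or
     after position [a]. *)
  case: (eqVneq (S i) (cosc i)) => [SC|SC].
    have : (1 < count_mem (cosc i) l')%N.
      by rewrite -(seq.permP pl) /= eqxx SC eqxx.
    rewrite -{1}(cat_take_drop a l') count_cat (drop_nth 0) ?sl' // na /= eqxx.
    rewrite addnCA ltnS addn_gt0 -!has_count => /orP[] /(has_nthP 0)[b].
      rewrite size_take sl' ae => ba; rewrite nth_take // => /eqP nb.
      by exists b; rewrite ?SC ?(ltn_trans ba ae) //; split=> //; rewrite neq_ltn ba.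
    rewrite size_drop sl' nth_drop => bb /eqP nb.
    exists (a.+1 + b)%N; last by rewrite SC; split=> //; lia.
    by lia.
  have /(nthP 0)[b] : S i \in l' by rewrite -(perm_mem pl) !inE eqxx orbT.
  rewrite sl' => be nb; exists b => //; split=> //.
  by apply: contraNneq SC => ba; rewrite -nb ba na.
apply: (@J_facet_half e M _ S_diag S_tri M_gt1 l' (Ordinal ae) (Ordinal be) k).
- by rewrite eq_sym.
- by rewrite /= na dk.
- by rewrite /= nb.
Qed.

Lemma ev_cosc : ev [seq cosc i | i <- iota 0 e] 1.
Proof.
move=> _ l' pl; have sl' : size l' = e by rewrite -(perm_size pl) size_map size_iota.
have iE : [seq cosc i | i <- iota 0 e] = [seq delta i | i <- enum 'I_e].
  rewrite -val_enum_ord -map_comp; apply: eq_map => k /=.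
  by apply/ffunP => j; rewrite !ffunE.
have /eqP st : size l' == e by rewrite sl'.
pose t : e.-tuple (class e) := [tuple delta i | i < e].
have : perm_eq l' t by rewrite perm_sym; apply: perm_trans pl; rewrite iE.
move=> /tuple_permP[p l'E].
apply: (@J_perm e M _ M_gt1 p) => j.
by rewrite l'E -tnth_nth !tnth_mktuple.
Qed.

(** Every term containing [c] in the expanded product vanishes. The letters are converted one by
    one, [ws1] holding those that do not yet contain [c]. *)
Lemma ev_add_nseq c Y (ws R : seq (class e)) :
  (forall l', ev (c :: l' ++ R) 0) ->
  (forall l', ev ([seq Y + w | w <- ws] ++ l' ++ R) 0) ->
  forall l', ev ([seq c + Y + w | w <- ws] ++ l' ++ R) 0.
Proof.
move=> cR YR l'.
suff H ws1 ws2 : (forall l', ev ([seq Y + w | w <- ws1 ++ ws2] ++ l' ++ R) 0) ->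
    forall l', ev ([seq Y + w | w <- ws1] ++ [seq c + Y + w | w <- ws2] ++ l' ++ R) 0.
  exact: (H [::] ws).
elim: ws2 ws1 => [|w ws2 IH] ws1 {}YR {}l'.
  by have := YR l'; rewrite cats0.
have p x : perm_eq (x :: [seq Y + w | w <- ws1] ++ [seq c + Y + w | w <- ws2] ++ l' ++ R)
   ([seq Y + w | w <- ws1] ++ x :: [seq c + Y + w | w <- ws2] ++ l' ++ R).
  by perm_tac.
apply: ev_perm (p _) _; rewrite -addrA; apply: ev_add0.
  have := cR ([seq Y + i | i <- ws1] ++ [seq c + Y + i | i <- ws2] ++ l').
  by rewrite -!catA.
apply: ev_perm (IH (rcons ws1 w) _ l') => [|l'']; last by rewrite cat_rcons; exact: YR.
by rewrite map_rcons cat_rcons; perm_tac.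
Qed.

End Words.

(** * Binary trees of angles and their classes *)

Inductive btree (A : Type) := Leaf of A | Node of btree A & btree A.

Section Trees.
Variable e : nat.
Local Notation tree := (btree (class e)).

Fixpoint nodes A (t : btree A) : nat :=
  if t is Node l r then (nodes l + nodes r).+1 else 0.

Fixpoint leaf_all A (P : A -> Prop) (t : btree A) : Prop :=
  match t with Leaf w => P w | Node l r => leaf_all P l /\ leaf_all P r end.

Lemma leaf_all_impl A (P Q : A -> Prop) t :
  (forall w, P w -> Q w) -> leaf_all P t -> leaf_all Q t.
Proof. by move=> PQ; elim: t => [w /PQ//|l IHl r IHr /= [/IHl ? /IHr]]. Qed.

Fixpoint leaves A (t : btree A) : seq A :=
  match t with Leaf w => [:: w] | Node l r => leaves l ++ leaves r end.

(* The nodes of [t] are numbered from [o] on, children first.  [tree_class t o]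
   is the class of the vector of the leaf coordinates of [t], and
   [sin_class t o i] that of the function [sin] at node [i]. *)
Fixpoint tree_class (t : tree) (o : nat) : class e :=
  match t with
  | Leaf w => w
  | Node l r => cosc e (o + nodes l + nodes r) + tree_class l o
  end.

Fixpoint sin_class (t : tree) (o i : nat) : class e :=
  match t with
  | Leaf _ => 0
  | Node l r =>
    if i == (o + nodes l + nodes r)%N
    then cosc e i + tree_class l o + tree_class r (o + nodes l)
    else if (i < o + nodes l)%N then sin_class l o i
    else sin_class r (o + nodes l) i
  end.

Definition supported_lt (w : class e) o := forall k : 'I_e, (o <= k)%N -> w k = 0.

Lemma tree_class_supported t o o' : leaf_all (supported_lt^~ o) t ->
  (o + nodes t <= o')%N -> supported_lt (tree_class t o) o'.
Proof.
elim: t o o' => [w|l IHl r _] o o' /= h oo' k ok.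
  by apply: h; lia.
rewrite !ffunE (IHl o o') //; try lia; last by case: h.
by rewrite addr0; case: eqP => // kE; lia.
Qed.

(** Children are numbered before their parent, so the own cosine of a node is the highest coordinate
    in the class of its sine. This is the triangularity that the path count asks of [S]. *)
Lemma sin_class_diag t o (i : 'I_e) : leaf_all (supported_lt^~ o) t ->
  (o <= i < o + nodes t)%N ->
  sin_class t o i i = 1 /\ forall k : 'I_e, (i < k)%N -> sin_class t o i k = 0.
Proof.
elim: t o => [w|l IHl r IHr] o /=; first by lia.
move=> [hl hr].
have hr' : leaf_all (supported_lt^~ (o + nodes l)) r.
  by apply: leaf_all_impl hr => w wo k ok; apply: wo; lia.
move=> io; case: eqP => [iE|iN].
  have E (k : 'I_e) : (i <= k)%N ->
      (cosc e i + tree_class l o + tree_class r (o + nodes l)) k = (k == i :> nat)%:R.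
    move=> ik; rewrite !ffunE (@tree_class_supported l o i) //; last by lia.
    by rewrite (@tree_class_supported r (o + nodes l) i) ?addr0 //; lia.
  split=> [|k ik]; rewrite E ?eqxx //; last exact: ltnW.
  by case: eqP => // ?; lia.
by case: ifP => il; [apply: IHl|apply: IHr] => //; lia.
Qed.

End Trees.

Section TreeWords.
Variables (e M : nat) (S : nat -> class e).
Hypothesis M_gt1 : (1 < M)%N.
Hypothesis S_diag : forall i : 'I_e, S i i = 1.
Hypothesis S_tri : forall i k : 'I_e, (i < k)%N -> S i k = 0.
Local Notation tree := (btree (class e)).
Local Notation ev := (@ev e M S).

Definition tree_in (t : tree) o := (o + nodes t <= e)%N /\
  forall i, (o <= i < o + nodes t)%N -> S i = sin_class t o i.

Lemma tree_in_node l r o : tree_in (Node l r) o ->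
  [/\ tree_in l o, tree_in r (o + nodes l), (o + nodes l + nodes r < e)%N &
   S (o + nodes l + nodes r) = cosc e (o + nodes l + nodes r) + tree_class l o +
     tree_class r (o + nodes l)].
Proof.
case=> /= le Se; split; [split=> [|i io]|split=> [|i io]| |]; try lia.
- rewrite Se; last by lia.
  by case: eqP => [|_]; [lia|case: ifP => //; lia].
- rewrite Se; last by lia.
  by case: eqP => [|_]; [lia|case: ifP => //; lia].
- by rewrite Se ?eqxx //; lia.
Qed.

(* The projective bundle relation: the leaf coordinates have no common zero. *)
Lemma ev_leaves t o l : tree_in t o ->
  ev ([seq tree_class t o + w | w <- leaves t] ++ l) 0.
Proof.
elim: t o l => [w|tl IHl tr IHr] o l tin /=.
  by rewrite (_ : w + w = 0); [exact: ev_zero|apply/ffunP => i; rewrite !ffunE addFF].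
have [inl inr re Sr] := tree_in_node tin.
set i := (o + _ + _)%N in re Sr *; set X := cosc e i + tree_class tl o.
(* [X] is the cosine class plus the class of the left subtree, and also the sine class plus the
   class of the right one. Modulo the relations of the subtrees, the left leaves yield a multiple of
   [cosc e i] and the right leaves a multiple of [S i], and these two multiply to zero. *)
have XE : X = S i + tree_class tr (o + nodes tl).
  rewrite Sr -addrA (_ : tree_class tr _ + _ = 0) ?addr0 //.
  by apply/ffunP => k; rewrite !ffunE addFF.
apply: (@ev_perm e M S ([seq X + w | w <- leaves tl] ++ [::] ++
    [seq X + w | w <- leaves tr] ++ l)); first by rewrite map_cat; perm_tac.
apply: (@ev_add_nseq e M S M_gt1 (cosc e i) (tree_class tl o) (leaves tl)) => l'; last exact: IHl.
rewrite XE; apply: (@ev_perm e M S ([seq S i + tree_class tr (o + nodes tl) + w |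
    w <- leaves tr] ++ [::] ++ cosc e i :: l' ++ l)); first by perm_tac.
apply: (@ev_add_nseq e M S M_gt1 (S i) (tree_class tr (o + nodes tl)) (leaves tr)) => l''; last exact: IHr.
apply: (@ev_perm e M S (cosc e i :: S i :: (l'' ++ l' ++ l))); first by perm_tac.
exact: ev_cos_sin.
Qed.

Definition killed R w := forall l', ev (w :: l' ++ R) 0.

Lemma killed_cat R0 R w : killed R w -> killed (R0 ++ R) w.
Proof. by move=> kR l'; rewrite catA; exact: kR. Qed.

Lemma size_leaves A (t : btree A) : size (leaves t) = (nodes t).+1.
Proof. by elim: t => //= l IHl r IHr; rewrite size_cat IHl IHr addSn addnS. Qed.

Lemma ev_unshift t X R b l' : leaf_all (killed R) t ->
  ev ([seq X + w | w <- leaves t] ++ l' ++ R) b ->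
  ev (nseq (size (leaves t)) X ++ l' ++ R) b.
Proof.
elim: t l' => [w|l IHl r IHr] l' /=.
  move=> kw ew; have -> : X = X + w + w.
    by rewrite -addrA (_ : w + w = 0) ?addr0 //; apply/ffunP => i; rewrite !ffunE addFF.
  exact: ev_add0.
move=> [kl kr]; rewrite map_cat size_cat nseqD => h.
apply: (@ev_perm e M S (nseq (size (leaves l)) X ++
  (nseq (size (leaves r)) X ++ l') ++ R)); first by perm_tac.
apply: IHl => //; apply: (@ev_perm e M S (nseq (size (leaves r)) X ++
  ([seq X + w | w <- leaves l] ++ l') ++ R)); first by perm_tac.
by apply: IHr => //; apply: ev_perm h; perm_tac.
Qed.

Lemma ev_nilpotent t o R l' : tree_in t o -> leaf_all (killed R) t ->
  ev (nseq (nodes t).+1 (tree_class t o) ++ l' ++ R) 0.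
Proof.
move=> tin kR; rewrite -size_leaves; apply: ev_unshift => //; exact: ev_leaves.
Qed.

Lemma addff (w : class e) : w + w = 0.
Proof. by apply/ffunP => i; rewrite !ffunE addFF. Qed.

(** The parametrization by angles covers projective space with odd degree: when [R] kills the leaf
    classes, the top power of the tautological class can be traded for the product of all cosine
    classes of the tree. *)
Lemma ev_power t o R b : tree_in t o -> leaf_all (killed R) t ->
  ev ([seq cosc e i | i <- iota o (nodes t)] ++ R) b ->
  ev (nseq (nodes t) (tree_class t o) ++ R) b.
Proof.
elim: t o R => [w|l IHl r IHr] o R tin //= [kl kr] hb.
have [inl inr re Sr] := tree_in_node tin.
set i := (o + _ + _)%N in re Sr *.
set Xl := tree_class l o in Sr *; set Xr := tree_class r _ in Sr.
set X := cosc e i + Xl in Sr *.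
have CE : cosc e i = X + Xl by rewrite /X -addrA addff addr0.
have XE : X = S i + Xr by rewrite Sr -addrA addff addr0.
have killed_sub R0 t : leaf_all (killed R) t -> leaf_all (killed (R0 ++ R)) t.
  by apply: leaf_all_impl => w; exact: killed_cat.
have nl l' : ev (nseq (nodes l).+1 Xl ++ l' ++ R) 0 by apply: ev_nilpotent.
have nr l' : ev (nseq (nodes r).+1 Xr ++ l' ++ R) 0 by apply: ev_nilpotent.
have h0 : ev (cosc e i :: nseq (nodes l) Xl ++ nseq (nodes r) Xr ++ R) b.
  apply: (@ev_perm e M S (nseq (nodes l) Xl ++ (cosc e i :: nseq (nodes r) Xr) ++ R)).
    by perm_tac.
  apply: IHl => //; first exact: killed_sub.
  apply: (@ev_perm e M S (nseq (nodes r) Xr ++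
    (cosc e i :: [seq cosc e i | i <- iota o (nodes l)]) ++ R)); first by perm_tac.
  apply: IHr => //; first exact: killed_sub.
  apply: ev_perm hb.
  rewrite -[cosc e o :: _]/([seq cosc e j | j <- iota o (nodes l + nodes r).+1] ++ R).
  have -> : iota o (nodes l + nodes r).+1 = iota o (nodes l) ++ iota (o + nodes l) (nodes r) ++ [:: i].
    by rewrite -addn1 -addnA !iotaD.
  by rewrite !map_cat; perm_tac.
(* All monomials X^(n+1) Xl^p Xr^q of this degree within the bounds have the same value. The
   relation [cosc e i] times [S i] equal to zero reads (X + Xl)(X + Xr) = 0 and replaces X X by X Xl
   + X Xr + Xl Xr. Either one or three of these terms stay within the bounds, so the parity is kept;
   the others vanish by nilpotency. *)
have main n p q : (p <= nodes l)%N -> (q <= nodes r)%N ->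
    (p + q + n)%N = (nodes l + nodes r)%N ->
    ev (nseq n.+1 X ++ nseq p Xl ++ nseq q Xr ++ R) b.
  have [N] := ubnP n; elim: N n p q => [//|N IH] [|n] p q nN pl qr pqn.
    have -> : p = nodes l by lia.
    have -> : q = nodes r by lia.
    apply: ev_add0 => //; apply: ev_perm (nl (nseq (nodes r) Xr)); by perm_tac.
  pose rest := nseq n X ++ nseq p Xl ++ nseq q Xr ++ R.
  pose b1 := if (q < nodes r)%N then b else 0.
  pose b2 := if (p < nodes l)%N then b else 0.
  pose b3 := if (p < nodes l)%N && (q < nodes r)%N then b else 0.
  have e1 : ev (X :: Xr :: rest) b1.
    rewrite /b1 /rest; case: ifP => qq.
      by apply: ev_perm (IH n p q.+1 _ _ _ _); try lia; perm_tac.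
    rewrite (_ : q = nodes r); last by lia.
    by apply: ev_perm (nr (nseq n.+1 X ++ nseq p Xl)); perm_tac.
  have e2 : ev (X :: Xl :: rest) b2.
    rewrite /b2 /rest; case: ifP => pp.
      by apply: ev_perm (IH n p.+1 q _ _ _ _); try lia; perm_tac.
    rewrite (_ : p = nodes l); last by lia.
    by apply: ev_perm (nl (nseq n.+1 X ++ nseq q Xr)); perm_tac.
  have e3 : ev (Xl :: Xr :: rest) b3.
    rewrite /b3 /rest; case: ifP => [/andP[pp qq]|pq].
      have -> : n = n.-1.+1 by lia.
      by apply: ev_perm (IH n.-1 p.+1 q.+1 _ _ _ _); try lia; perm_tac.
    case pp : (p < nodes l)%N pq => /= qq; last first.
      rewrite (_ : p = nodes l); last by lia.
      by apply: ev_perm (nl (nseq n X ++ nseq q.+1 Xr)); perm_tac.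
    rewrite (_ : q = nodes r); last by lia.
    by apply: ev_perm (nr (nseq n X ++ nseq p.+1 Xl)); perm_tac.
  have swap w w' c : ev (w :: w' :: rest) c -> ev (w' :: w :: rest) c.
    by apply: ev_perm; perm_tac.
  have SE : S i = X + Xr by rewrite {1}XE -addrA addff addr0.
  have e4 : ev (Xl :: S i :: rest) (b2 + b3).
    apply: (swap); rewrite SE; apply: ev_add => //; exact: (swap).
  have e5 : ev (X :: S i :: rest) (0 + (b2 + b3)).
    apply: ev_add => //; exact: ev_cos_sin.
  have e6 : ev (X :: X :: rest) (0 + (b2 + b3) + b1).
    rewrite {1}XE; apply: ev_add; apply: (swap); [exact: e5|exact: e1].
  suff <- : 0 + (b2 + b3) + b1 = b by [].
  rewrite /b1 /b2 /b3 add0r; case pp : (p < nodes l)%N; case qq : (q < nodes r)%N => /=.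
  - by rewrite addFF add0r.
  - by rewrite !addr0.
  - by rewrite !add0r.
  - lia.
apply: ev_perm (main (nodes l + nodes r)%N 0%N 0%N _ _ _) => //.
Qed.

End TreeWords.

(** * The sphere bundle over a product of two projective spaces *)

Section Forest.
Variables (e K : nat) (tA tB : btree (class e)).
Hypothesis leaves_A : leaf_all (fun w => w = 0) tA.
Hypothesis leaves_B : leaf_all (fun w => w = 0) tB.
Local Notation a := (nodes tA).
Local Notation b := (nodes tB).
Hypothesis dim_e : (a + b + K.*2)%N = e.

Definition class_x := tree_class tA 0.
Definition class_y := tree_class tB a.

Definition comb (ws : seq (class e)) (w : class e) :=
  foldr (fun v t => Node (Leaf v) t) (Leaf w) ws.

(** The leaves are the entries of X, the entries of Y and the scalar t. X carries the sign of A, and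
    Y that of B, so that replacing (A, X) by (-A, -X) leaves the equations unchanged. *)
Definition tree_Z := comb (nseq K class_x ++ nseq K class_y) 0.
Definition class_z := tree_class tree_Z (a + b).

Lemma nodes_comb ws w : nodes (comb ws w) = size ws.
Proof. by elim: ws => //= v ws ->. Qed.

Lemma leaves_comb ws w : leaves (comb ws w) = rcons ws w.
Proof. by elim: ws => //= v ws ->. Qed.

Lemma leaf_all_comb P ws w : (forall v, v \in ws -> P v) -> P w ->
  leaf_all P (comb ws w).
Proof.
elim: ws => //= v ws IH h Pw; split; first by apply: h; rewrite mem_head.
by apply: IH => // u uws; apply: h; rewrite inE uws orbT.
Qed.

Lemma nodes_Z : nodes tree_Z = K.*2.
Proof. by rewrite nodes_comb size_cat !size_nseq addnn. Qed.

Definition forest_sin (i : nat) : class e :=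
  if (i < a)%N then sin_class tA 0 i
  else if (i < a + b)%N then sin_class tB a i else sin_class tree_Z (a + b) i.

Lemma supported0 o : supported_lt (0 : class e) o.
Proof. by move=> k _; rewrite ffunE. Qed.

Lemma leaf0_supported t o : leaf_all (fun w : class e => w = 0) t ->
  leaf_all (@supported_lt e ^~ o) t.
Proof. by apply: leaf_all_impl => w ->; exact: supported0. Qed.

Lemma leaf_Z_all (P : class e -> Prop) : P class_x -> P class_y -> P 0 ->
  leaf_all P tree_Z.
Proof.
move=> Px Py P0; apply: leaf_all_comb => // v.
by rewrite mem_cat !mem_nseq => /orP[] /andP[_ /eqP->].
Qed.

Lemma leaf_Z_supported : leaf_all (@supported_lt e ^~ (a + b)%N) tree_Z.
Proof.
apply: leaf_Z_all; last exact: supported0.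
- by apply: tree_class_supported (leaf0_supported _ leaves_A) _; lia.
- by apply: tree_class_supported (leaf0_supported _ leaves_B) _; lia.
Qed.

Lemma forest_sin_spec (i : 'I_e) :
  forest_sin i i = 1 /\ forall k : 'I_e, (i < k)%N -> forest_sin i k = 0.
Proof.
have ie := ltn_ord i; rewrite /forest_sin.
case: ifP => ia; first by apply: sin_class_diag; [exact: leaf0_supported|lia].
case: ifP => iab; first by apply: sin_class_diag; [exact: leaf0_supported|lia].
apply: sin_class_diag; first exact: leaf_Z_supported.
by rewrite nodes_Z; lia.
Qed.

Variable M : nat.
Hypothesis M_gt1 : (1 < M)%N.
Local Notation ev := (@ev e M forest_sin).
Local Notation x := class_x.
Local Notation y := class_y.
Local Notation z := class_z.

Let Sd (i : 'I_e) := (forest_sin_spec i).1.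
Let St (i k : 'I_e) := (forest_sin_spec i).2 k.

Lemma tree_in_A : tree_in forest_sin tA 0.
Proof.
split=> [|i ia]; first by lia.
by rewrite /forest_sin ifT //; lia.
Qed.

Lemma tree_in_B : tree_in forest_sin tB a.
Proof.
split=> [|i ia]; first by lia.
by rewrite /forest_sin ifF ?ifT //; lia.
Qed.

Lemma tree_in_Z : tree_in forest_sin tree_Z (a + b).
Proof.
rewrite /tree_in nodes_Z; split=> [|i ia]; first by lia.
by rewrite /forest_sin ifF ?ifF //; lia.
Qed.

Lemma killed0 R w : w = 0 -> killed M forest_sin R w.
Proof. by move=> -> l'; exact: ev_zero. Qed.

Lemma ev_xnil l : ev (nseq a.+1 x ++ l) 0.
Proof.
have := @ev_nilpotent e M forest_sin M_gt1 Sd St tA 0 [::] l tree_in_A.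
rewrite cats0; apply; apply: leaf_all_impl leaves_A => w; exact: killed0.
Qed.

Lemma ev_ynil l : ev (nseq b.+1 y ++ l) 0.
Proof.
have := @ev_nilpotent e M forest_sin M_gt1 Sd St tB a [::] l tree_in_B.
rewrite cats0; apply; apply: leaf_all_impl leaves_B => w; exact: killed0.
Qed.

Lemma ev_zrel l : ev (z :: nseq K (z + x) ++ nseq K (z + y) ++ l) 0.
Proof.
have := @ev_leaves e M forest_sin M_gt1 Sd St tree_Z (a + b) l tree_in_Z.
rewrite leaves_comb map_rcons map_cat !map_nseq addr0 => h.
by apply: ev_perm h; rewrite cat_rcons; perm_tac.
Qed.

Lemma ev_top : ev (nseq a x ++ nseq b y ++ nseq K.*2 z) 1.
Proof.
apply: (@ev_perm e M _ (nseq K.*2 z ++ nseq a x ++ nseq b y)); first by perm_tac.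
rewrite -nodes_Z; apply: ev_power => //; first exact: tree_in_Z.
  apply: leaf_Z_all => l'; last exact: ev_zero.
    by apply: ev_perm (@ev_xnil (l' ++ nseq b y)); perm_tac.
  by apply: ev_perm (@ev_ynil (l' ++ nseq a x)); perm_tac.
rewrite nodes_Z.
apply: (@ev_perm e M _ (nseq a x ++
   [seq cosc e i | i <- iota (a + b) K.*2] ++ nseq b y)); first by perm_tac.
apply: ev_power => //; first exact: tree_in_A.
  by apply: leaf_all_impl leaves_A => w; exact: killed0.
apply: (@ev_perm e M _ (nseq b y ++ [seq cosc e i | i <- iota 0 a] ++
   [seq cosc e i | i <- iota (a + b) K.*2])); first by perm_tac.
apply: ev_power => //; first exact: tree_in_B.
  by apply: leaf_all_impl leaves_B => w; exact: killed0.
apply: ev_perm (ev_cosc _ M_gt1).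
by rewrite -[X in iota 0 X]dim_e !iotaD !map_cat add0n; perm_tac.
Qed.

(* Coefficient of [t ^ r] in [(1 - t) ^ - s]. *)
Definition hcoef s r : 'F_2 := 'C(s + r - 1, r)%:R.

Lemma hcoef0 s : hcoef s 0 = 1.
Proof. by rewrite /hcoef bin0. Qed.

Lemma hcoef0S r : hcoef 0 r.+1 = 0.
Proof. by rewrite /hcoef bin_small //; lia. Qed.

Lemma hcoefSS s r : hcoef s.+1 r.+1 = hcoef s r.+1 + hcoef s.+1 r.
Proof.
rewrite /hcoef (_ : s.+1 + r.+1 - 1 = (s + r).+1)%N; last by lia.
rewrite binS natrD; congr ('C(_, _)%:R + 'C(_, _)%:R); lia.
Qed.

(** Expanding [z + x] and [z + y], only the power of [z] survives, since the word already contains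
    the highest nonzero powers of [x] and [y]. *)
Lemma ev_base u v k : (u + v + k)%N = K.*2 ->
  ev (nseq a x ++ nseq b y ++ nseq k z ++ nseq u (z + x) ++ nseq v (z + y)) 1.
Proof.
elim: u k => [|u IH] k; last first.
  move=> uvk; apply: (@ev_perm e M _ (z + x :: nseq a x ++ nseq b y ++ nseq k z ++
    nseq u (z + x) ++ nseq v (z + y))); first by perm_tac.
  apply: ev_add0.
    by apply: ev_perm (IH k.+1 _); [perm_tac|lia].
  apply: ev_perm (@ev_xnil (nseq b y ++ nseq k z ++ nseq u (z + x) ++ nseq v (z + y))).
  by perm_tac.
elim: v k => [|v IH] k uvk.
  by rewrite /= cats0 (_ : k = K.*2); [exact: ev_top|lia].
apply: (@ev_perm e M _ (z + y :: nseq a x ++ nseq b y ++ nseq k z ++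
    nseq v (z + y))); first by perm_tac.
apply: ev_add0.
  by apply: ev_perm (IH k.+1 _); [perm_tac|lia].
by apply: ev_perm (@ev_ynil (nseq a x ++ nseq k z ++ nseq v (z + y))); perm_tac.
Qed.

(* The value is the coefficient of [x ^ a * y ^ b * z ^ -1] in the expansion at
   [z = oo] of the word divided by [z * (z + x) ^ K * (z + y) ^ K]. *)
Lemma ev_word s s' r r' : (s <= K)%N -> (s' <= K)%N -> (r <= a)%N -> (r' <= b)%N ->
  ev (nseq (a - r) x ++ nseq (b - r') y ++ nseq (r + r' + s + s') z ++
      nseq (K - s) (z + x) ++ nseq (K - s') (z + y)) (hcoef s r * hcoef s' r').
Proof.
have [N] := ubnP (r + r' + s + s'); elim: N s s' r r' => // N IH s s' r r' sN sK s'K ra rb.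
(* One letter [z] is split as (z + x) + x. The first term lowers [s], the second lowers [r], which
   reproduces the Pascal rule [hcoefSS]; [yred] does the same with [y]. *)
have xred c1 c2 : (0 < s)%N ->
  ev (nseq (a - r) x ++ nseq (b - r') y ++ nseq (r + r' + s.-1 + s') z ++
      nseq (K - s.-1) (z + x) ++ nseq (K - s') (z + y)) c1 ->
  ev (x :: nseq (a - r) x ++ nseq (b - r') y ++ nseq (r + r' + s.-1 + s') z ++
      nseq (K - s) (z + x) ++ nseq (K - s') (z + y)) c2 ->
  ev (nseq (a - r) x ++ nseq (b - r') y ++ nseq (r + r' + s + s') z ++
      nseq (K - s) (z + x) ++ nseq (K - s') (z + y)) (c1 + c2).
  move=> s0 e1 e2.
  apply: (@ev_perm e M _ (z :: nseq (a - r) x ++ nseq (b - r') y ++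
    nseq (r + r' + s.-1 + s') z ++ nseq (K - s) (z + x) ++ nseq (K - s') (z + y))).
    by rewrite (_ : r + r' + s + s' = (r + r' + s.-1 + s').+1)%N; [perm_tac|lia].
  rewrite -[X in X :: _](addr0 z) -(addff x) addrA; apply: ev_add => //.
  apply: ev_perm e1; rewrite (_ : K - s.-1 = (K - s).+1)%N; [by perm_tac|lia].
have yred c1 c2 : (0 < s')%N ->
  ev (nseq (a - r) x ++ nseq (b - r') y ++ nseq (r + r' + s + s'.-1) z ++
      nseq (K - s) (z + x) ++ nseq (K - s'.-1) (z + y)) c1 ->
  ev (y :: nseq (a - r) x ++ nseq (b - r') y ++ nseq (r + r' + s + s'.-1) z ++
      nseq (K - s) (z + x) ++ nseq (K - s') (z + y)) c2 ->
  ev (nseq (a - r) x ++ nseq (b - r') y ++ nseq (r + r' + s + s') z ++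
      nseq (K - s) (z + x) ++ nseq (K - s') (z + y)) (c1 + c2).
  move=> s0 e1 e2.
  apply: (@ev_perm e M _ (z :: nseq (a - r) x ++ nseq (b - r') y ++
    nseq (r + r' + s + s'.-1) z ++ nseq (K - s) (z + x) ++ nseq (K - s') (z + y))).
    by rewrite (_ : r + r' + s + s' = (r + r' + s + s'.-1).+1)%N; [perm_tac|lia].
  rewrite -[X in X :: _](addr0 z) -(addff y) addrA; apply: ev_add => //.
  apply: ev_perm e1; rewrite (_ : K - s'.-1 = (K - s').+1)%N; [by perm_tac|lia].
case: s => [|s] in sN sK xred yred *; last first.
  case: r => [|r] in sN ra xred yred *.
    rewrite hcoef0 -(hcoef0 s) -[X in ev _ X]addr0; apply: xred => //.
      by apply: IH; lia.
    rewrite subn0.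
    by apply: ev_perm (@ev_xnil (nseq (b - r') y ++ nseq (0 + r' + s + s') z ++
      nseq (K - s.+1) (z + x) ++ nseq (K - s') (z + y))); perm_tac.
  rewrite hcoefSS mulrDl; apply: xred => //; first by apply: IH; lia.
  apply: ev_perm (IH s.+1 s' r r' _ _ _ _ _); try lia.
  have -> : (a - r = (a - r.+1).+1)%N by lia.
  have -> : (r + r' + s.+1 + s' = r.+1 + r' + s + s')%N by lia.
  by perm_tac.
case: s' => [|s'] in sN s'K xred yred *; last first.
  case: r' => [|r'] in sN rb xred yred *.
    rewrite hcoef0 -(hcoef0 s') -[X in ev _ X]addr0; apply: yred => //.
      by apply: IH; lia.
    rewrite subn0.
    by apply: ev_perm (@ev_ynil (nseq (a - r) x ++ nseq (r + 0 + 0 + s') z ++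
      nseq (K - 0) (z + x) ++ nseq (K - s'.+1) (z + y))); perm_tac.
  rewrite hcoefSS mulrDr; apply: yred => //; first by apply: IH; lia.
  apply: ev_perm (IH 0%N s'.+1 r r' _ _ _ _ _); try lia.
  have -> : (b - r' = (b - r'.+1).+1)%N by lia.
  have -> : (r + r' + 0 + s'.+1 = r + r'.+1 + 0 + s')%N by lia.
  by perm_tac.
rewrite !subn0; case: (posnP (r + r')) => [rr|rr].
  have [-> ->] : r = 0%N /\ r' = 0%N by lia.
  rewrite !hcoef0 mulr1 !subn0; apply: ev_base; lia.
(* With [s = s' = 0] and at least one letter [z] left, the word contains the relation [ev_zrel]. *)
have -> : hcoef 0 r * hcoef 0 r' = 0.
  case: r r' rr {sN ra rb xred yred} => [|r] [|r'] //= _; rewrite ?hcoef0S ?mulr0 ?mul0r //.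
apply: ev_perm (@ev_zrel (nseq (a - r) x ++ nseq (b - r') y ++ nseq (r + r').-1 z)).
rewrite (_ : r + r' + 0 + 0 = (r + r').-1.+1)%N; [by perm_tac|lia].
Qed.

Lemma ev_power_z E : E = (a + b + K.*2)%N ->
  ev (nseq E z) (hcoef K a * hcoef K b).
Proof.
move=> ->; have := @ev_word K K a b (leqnn _) (leqnn _) (leqnn _) (leqnn _).
by rewrite !subnn /= cats0 -addnA addnn.
Qed.

(** [x + y] is the class of the scalar product of A and B, the additional equation of the case k =
    1. *)
Lemma ev_power_z_xy E : E.+1 = (a + b + K.*2)%N -> (0 < b)%N ->
  ev (x + y :: nseq E z)
    ((if a is a'.+1 then hcoef K a' * hcoef K b else 0) + hcoef K a * hcoef K b.-1).
Proof.
move=> Ek b0; apply: ev_add.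
  case Ea : a => [|a'].
    by have := @ev_xnil (nseq E z); rewrite Ea.
  have := @ev_word K K a' b (leqnn _) (leqnn _) _ (leqnn _).
  rewrite Ea subSnn !subnn /= cats0 => /(_ (leqnSn _)).
  by rewrite (_ : E = a' + b + K + K)%N //; lia.
have := @ev_word K K a b.-1 (leqnn _) (leqnn _) (leqnn _) (leq_pred _).
rewrite (_ : b - b.-1 = 1)%N ?subnn /= ?cats0; last by lia.
by rewrite (_ : E = a + b.-1 + K + K)%N //; lia.
Qed.

End Forest.

(** * Families of frames *)

(** Modulo 2, the power (1 + u)^(2^b) is 1 + u^(2^b). *)
Lemma odd_bin_pow2 b n j : odd 'C(2 ^ b + n, j) =
  odd 'C(n, j) (+) ((2 ^ b <= j)%N && odd 'C(n, j - 2 ^ b)).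
Proof.
elim: b n j => [|b IH] n j.
  by case: j => [|j]; rewrite ?bin0 // add1n binS oddD subSS subn0.
rewrite expnS mul2n -addnn -addnA !IH -addbA; congr (_ (+) _).
case: (leqP (2 ^ b)%N j) => bj /=; last by rewrite leqNgt ltn_addr.
rewrite addbA addbb /=; congr (_ && _); first by lia.
by rewrite subnDA.
Qed.

Lemma odd_bin_small b t r j : (j < 2 ^ b)%N ->
  odd 'C(t * 2 ^ b + r, j) = odd 'C(r, j).
Proof.
move=> jb; elim: t => // t IH.
by rewrite mulSn -addnA odd_bin_pow2 IH leqNgt jb addbF.
Qed.

Lemma odd_bin_shift b r j : (r < 2 ^ b)%N ->
  odd 'C(2 ^ b + r, 2 ^ b + j) = odd 'C(r, j).
Proof. by move=> rb; rewrite odd_bin_pow2 leq_addr addKn bin_small //; lia. Qed.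

(** * Sign actions on the coordinates of a tree *)

Section Signs.
Variables (R : realType) (e : nat) (i : 'I_e).

Definition sgn (w : class e) : R := (-1) ^+ (w i : nat).

Lemma sgn0 : sgn 0 = 1.
Proof. by rewrite /sgn ffunE expr0. Qed.

Lemma sgn_sqr w : sgn w * sgn w = 1.
Proof. by rewrite -expr2 sqrr_sign. Qed.

Lemma sgnD w w' : sgn (w + w') = sgn w * sgn w'.
Proof.
rewrite /sgn ffunE; case: (F2_eq01 (w i)) => ->; case: (F2_eq01 (w' i)) => ->;
  by rewrite ?addFF ?addr0 ?add0r /= ?expr0 ?expr1 ?mulr1 ?mul1r // mulrNN mulr1.
Qed.

End Signs.

Section Coordinates.
Variables (R : realType) (e : nat).
Implicit Types (t : btree (class e)) (c s : nat -> R) (o : nat).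

(* The data [c' = +-c], [s' = +-s] obtained by applying the [i]-th generator of
   the group of signs to the nodes of [t]. *)
Definition sign_change (i : 'I_e) t o c s c' s' :=
  forall l, (o <= l < o + nodes t)%N ->
    c' l = sgn R i (cosc e l) * c l /\ s' l = sgn R i (sin_class t o l) * s l.

Lemma sign_change_node i (l r : btree (class e)) o c s c' s' : sign_change i (Node l r) o c s c' s' ->
  let k := (o + nodes l + nodes r)%N in
  [/\ sign_change i l o c s c' s', sign_change i r (o + nodes l) c s c' s',
      c' k = sgn R i (cosc e k) * c k &
      s' k = sgn R i (cosc e k + tree_class l o + tree_class r (o + nodes l)) * s k].
Proof.
move=> h k; split.
- move=> j jo; have [|-> ->] := h j; rewrite /=; first by lia.
  by split=> //; case: eqP => [|_]; [lia|case: ifP => //; lia].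
- move=> j jo; have [|-> ->] := h j; rewrite /=; first by lia.
  by split=> //; case: eqP => [|_]; [lia|case: ifP => //; lia].
- by have [|] := h k; rewrite /k /=; first by lia.
- by have [|_] := h k; rewrite /k /=; [lia|rewrite eqxx].
Qed.

Fixpoint coords t o c s : seq R :=
  match t with
  | Leaf _ => [:: 1]
  | Node l r => let k := (o + nodes l + nodes r)%N in
    [seq c k * x | x <- coords l o c s] ++
    [seq s k * x | x <- coords r (o + nodes l) c s]
  end.

Lemma size_coords t o c s : size (coords t o c s) = (nodes t).+1.
Proof.
by elim: t o => //= l IHl r IHr o; rewrite size_cat !size_map IHl IHr addSn addnS.
Qed.

Lemma coords_norm t o c s : (forall l, c l ^+ 2 + s l ^+ 2 = 1) ->
  \sum_(x <- coords t o c s) x ^+ 2 = 1.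
Proof.
move=> cs; elim: t o => [w|l IHl r IHr] o /=; first by rewrite big_seq1 expr1n.
rewrite big_cat !big_map /=.
under eq_bigr do rewrite exprMn.
under [X in _ + X]eq_bigr do rewrite exprMn.
by rewrite -!mulr_sumr IHl IHr !mulr1.
Qed.

(** The class given to the sine is chosen for this: [cosc] plus the classes of both subtrees makes
    the left part, scaled by the cosine, and the right part, scaled by the sine, acquire the same
    sign up to the leaf classes. *)
Lemma coords_sign i t o c s c' s' j : sign_change i t o c s c' s' ->
  (j < (nodes t).+1)%N ->
  nth 0 (coords t o c' s') j =
  sgn R i (tree_class t o + nth 0 (leaves t) j) * nth 0 (coords t o c s) j.
Proof.
elim: t o j => [w|l IHl r IHr] o j.
  by case: j => [|[]] //= _ _; rewrite addff sgn0 mul1r.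
move=> /sign_change_node[hl hr hc hs]; rewrite [nodes _]/= => jt.
rewrite [tree_class _ _]/= [leaves _]/= [coords _ _ c' s']/= [coords _ _ c s]/=.
rewrite !nth_cat !size_map !size_coords size_leaves; case: ltnP => jl.
  rewrite !(nth_map 0) ?size_coords // IHl // hc mulrACA -sgnD addrA //.
rewrite !(nth_map 0) ?size_coords; try lia.
rewrite IHr //; last by lia.
rewrite hs mulrACA -sgnD; congr (sgn R i _ * _).
set X := tree_class r _; set w := nth _ _ _.
by rewrite -addrA (addrA X X) addff add0r.
Qed.

Lemma coords_continuous (T : topologicalType) t o (c s : T -> nat -> R) j :
  (forall l, continuous (fun x => c x l)) -> (forall l, continuous (fun x => s x l)) ->
  continuous (fun x => nth 0 (coords t o (c x) (s x)) j).
Proof.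
move=> cc sc; elim: t o j => [w|l IHl r IHr] o j x /=; first exact: cst_continuous.
case: (ltnP j (nodes l).+1) => jl.
  rewrite [X in continuous_at _ X](_ : _ = fun x => c x (o + nodes l + nodes r)%N *
    nth 0 (coords l o (c x) (s x)) j); first by apply: cvgM; [exact: cc|exact: IHl].
  by apply/funext => y; rewrite nth_cat size_map size_coords jl (nth_map 0) ?size_coords.
case: (ltnP (j - (nodes l).+1) (nodes r).+1) => jr.
  rewrite [X in continuous_at _ X](_ : _ = fun x => s x (o + nodes l + nodes r)%N *
    nth 0 (coords r (o + nodes l) (c x) (s x)) (j - (nodes l).+1));
    first by apply: cvgM; [exact: sc|exact: IHr].
  apply/funext => y; rewrite nth_cat size_map size_coords ltnNge jl /=.
  by rewrite (nth_map 0) ?size_coords.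
rewrite [X in continuous_at _ X](_ : _ = cst 0); first exact: cst_continuous.
apply/funext => y; rewrite nth_default // size_cat !size_map !size_coords; lia.
Qed.

End Coordinates.

Section Frames.
Variables (R : realType) (e : nat).
Implicit Types (c s : nat -> R) (o b m : nat).

(** The power 2^b, defined by doubling so that [pw b.+1] is convertible to [pw b + pw b], the size
    of the block matrices in [rot]. *)
Fixpoint pw b : nat := if b is b'.+1 then pw b' + pw b' else 1.

Lemma pwE b : pw b = (2 ^ b)%N.
Proof. by elim: b => //= b ->; rewrite expnS mul2n addnn. Qed.

(* The balanced binary tree of depth [b], restricted to its first [m.+1] leaves. *)
Fixpoint tau b m : btree (class e) :=
  if b is b'.+1 then
    if (m < pw b')%N then tau b' m
    else Node (tau b' (pw b').-1) (tau b' (m - pw b'))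
  else Leaf 0.

Lemma nodes_tau b m : (m < pw b)%N -> nodes (tau b m) = m.
Proof.
elim: b m => [|b IH] m /= mb; first by lia.
case: ifP => mb'; first exact: IH.
by rewrite /= !IH; lia.
Qed.

Lemma leaf_all_tau b m : leaf_all (fun w : class e => w = 0) (tau b m).
Proof. by elim: b m => //= b IH m; case: ifP => _ //=; split. Qed.

(* An odd map to O(2 ^ b) whose first column is the vector of leaf coordinates.
   The lower right block makes the columns orthogonal while staying even in [B]
   and odd in [A]. *)
Fixpoint rot b m o c s : 'M[R]_(pw b) :=
  match b return 'M[R]_(pw b) with
  | 0 => 1%:M
  | b'.+1 =>
    if (m < pw b')%N then block_mx (rot b' m o c s) 0 0 (rot b' m o c s)
    else
      let l := tau b' (pw b').-1 in let r := tau b' (m - pw b') in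
      let k := (o + nodes l + nodes r)%N in
      let A := rot b' (pw b').-1 o c s in
      let B := rot b' (m - pw b') (o + nodes l) c s in
      block_mx (c k *: A) (- (s k *: B)) (s k *: B) (c k *: (B *m A^T *m B))
  end.

Lemma rotS b m o c s : rot b.+1 m o c s =
  if (m < pw b)%N then block_mx (rot b m o c s) 0 0 (rot b m o c s)
  else
    let l := tau b (pw b).-1 in let r := tau b (m - pw b) in
    let k := (o + nodes l + nodes r)%N in
    let A := rot b (pw b).-1 o c s in
    let B := rot b (m - pw b) (o + nodes l) c s in
    block_mx (c k *: A) (- (s k *: B)) (s k *: B) (c k *: (B *m A^T *m B)).
Proof. by []. Qed.

Lemma rot_orthogonal b m o c s : (forall l, c l ^+ 2 + s l ^+ 2 = 1) ->
  (rot b m o c s)^T *m rot b m o c s = 1%:M.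
Proof.
move=> cs; elim: b m o => [|b IH] m o /=; first by rewrite trmx1 mulmx1.
case: ifP => _.
  by rewrite tr_block_mx mulmx_block !trmx0 !mulmx0 !mul0mx !addr0 add0r IH -scalar_mx_block.
set A := rot b _ _ _ _; set B := rot b _ _ _ _; set k := (_ + _ + _)%N.
have AA : A^T *m A = 1%:M := IH _ _; have BB : B^T *m B = 1%:M := IH _ _.
have AA' : A *m A^T = 1%:M by apply: mulmx1C.
rewrite tr_block_mx mulmx_block !linearN /= !linearZ /= !trmx_mul trmxK.
rewrite ?mulNmx -?scalemxAl ?mulNmx ?scalerN ?opprK !scalerA.
have -> : B^T *m (B *m A^T *m B) = A^T *m B by rewrite -mulmxA mulmxA BB mul1mx.
have -> : B^T *m (A *m B^T) *m B = B^T *m A by rewrite -!mulmxA BB mulmx1.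
have -> : B^T *m (A *m B^T) *m (B *m A^T *m B) = 1%:M.
  by rewrite -!mulmxA (mulmxA B^T B) BB mul1mx (mulmxA A) AA' mul1mx BB.
rewrite AA BB -!scalerDl -!expr2 cs (addrC (s k ^+ 2)) cs (mulrC (s k)) !addNr.
by rewrite !scale1r -scalar_mx_block.
Qed.

Lemma rot_sign i b m o c s c' s' : sign_change i (tau b m) o c s c' s' ->
  rot b m o c' s' = sgn R i (tree_class (tau b m) o) *: rot b m o c s.
Proof.
elim: b m o => [|b IH] m o /=; first by rewrite sgn0 scale1r.
case: ifP => _.
  by move=> /IH ->; rewrite scale_block_mx !scaler0.
move=> /sign_change_node[hl hr hc hs]; rewrite (IH _ _ hl) (IH _ _ hr) hc hs.
set A := rot b _ _ _ _; set B := rot b _ _ _ _; set k := (_ + _ + _)%N.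
set x := tree_class _ _; set y := tree_class _ _.
rewrite scale_block_mx scalerN.
have -> : (sgn R i x *: A)^T = sgn R i x *: A^T by rewrite linearZ.
rewrite -!scalemxAl -!scalemxAr -!scalemxAl !scalerA.
have sgn3 w w' : sgn R i (w + w') * sgn R i w' = sgn R i w.
  by rewrite -sgnD -addrA addff addr0.
congr (block_mx (_ *: _) (- (_ *: _)) (_ *: _) (_ *: _)).
- by rewrite mulrAC -sgnD.
- by rewrite mulrAC sgn3.
- by rewrite mulrAC sgn3.
- rewrite sgnD.
  have := sgn_sqr R i y; set u := sgn R i y => uu.
  by rewrite mulrA -[_ * u * u]mulrA uu mulr1 mulrAC.
Qed.

Definition mx_continuous (T : topologicalType) n k (f : T -> 'M[R]_(n, k)) :=
  forall i j, continuous (fun x => f x i j).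

Lemma continuous_sum (T : topologicalType) (I : Type) (r : seq I) (P : pred I)
    (F : I -> T -> R) : (forall i, P i -> continuous (F i)) ->
  continuous (fun x => \sum_(i <- r | P i) F i x).
Proof. by apply: continuous_big; exact: add_continuous. Qed.

Lemma mx_continuousM (T : topologicalType) n k l (f : T -> 'M[R]_(n, k))
    (g : T -> 'M[R]_(k, l)) :
  mx_continuous f -> mx_continuous g -> mx_continuous (fun x => f x *m g x).
Proof.
move=> fc gc i j; rewrite (_ : (fun x => _) = fun x => \sum_h f x i h * g x h j).
  by apply: continuous_sum => h _ x; apply: cvgM; [exact: fc|exact: gc].
by apply/funext => x; rewrite mxE.
Qed.

Lemma mx_continuousZ (T : topologicalType) n k (a : T -> R) (f : T -> 'M[R]_(n, k)) :
  continuous a -> mx_continuous f -> mx_continuous (fun x => a x *: f x).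
Proof.
move=> ac fc i j; rewrite (_ : (fun x => _) = fun x => a x * f x i j).
  by move=> x; apply: cvgM; [exact: ac|exact: fc].
by apply/funext => x; rewrite mxE.
Qed.

Lemma mx_continuousN (T : topologicalType) n k (f : T -> 'M[R]_(n, k)) :
  mx_continuous f -> mx_continuous (fun x => - f x).
Proof.
move=> fc i j; rewrite (_ : (fun x => _) = fun x => - f x i j).
  by move=> x; apply: cvgN; exact: fc.
by apply/funext => x; rewrite mxE.
Qed.

Lemma mx_continuous_tr (T : topologicalType) n k (f : T -> 'M[R]_(n, k)) :
  mx_continuous f -> mx_continuous (fun x => (f x)^T).
Proof.
move=> fc i j; rewrite (_ : (fun x => _) = fun x => f x j i); first exact: fc.
by apply/funext => x; rewrite mxE.
Qed.

Lemma mx_continuous_cst (T : topologicalType) n k (A : 'M[R]_(n, k)) :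
  mx_continuous (fun _ : T => A).
Proof. by move=> i j x; exact: cst_continuous. Qed.

Lemma mx_continuous_col (T : topologicalType) n1 n2 k (f : T -> 'M[R]_(n1, k))
    (g : T -> 'M[R]_(n2, k)) :
  mx_continuous f -> mx_continuous g -> mx_continuous (fun x => col_mx (f x) (g x)).
Proof.
move=> fc gc i j; rewrite (_ : (fun x => _) = fun x =>
  match fintype.split i with inl i1 => f x i1 j | inr i2 => g x i2 j end).
  by case: (fintype.split i) => h; [exact: fc|exact: gc].
by apply/funext => x; rewrite mxE; case: (fintype.split i).
Qed.

Lemma mx_continuous_row (T : topologicalType) n k1 k2 (f : T -> 'M[R]_(n, k1))
    (g : T -> 'M[R]_(n, k2)) :
  mx_continuous f -> mx_continuous g -> mx_continuous (fun x => row_mx (f x) (g x)).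
Proof.
move=> fc gc i j; rewrite (_ : (fun x => _) = fun x =>
  match fintype.split j with inl j1 => f x i j1 | inr j2 => g x i j2 end).
  by case: (fintype.split j) => h; [exact: fc|exact: gc].
by apply/funext => x; rewrite mxE; case: (fintype.split j).
Qed.

Lemma mx_continuous_block (T : topologicalType) n1 n2 k1 k2
    (f : T -> 'M[R]_(n1, k1)) (g : T -> 'M[R]_(n1, k2))
    (h : T -> 'M[R]_(n2, k1)) (l : T -> 'M[R]_(n2, k2)) :
  mx_continuous f -> mx_continuous g -> mx_continuous h -> mx_continuous l ->
  mx_continuous (fun x => block_mx (f x) (g x) (h x) (l x)).
Proof.
by move=> fc gc hc lc; apply: mx_continuous_col; apply: mx_continuous_row.
Qed.

Lemma rot_continuous (T : topologicalType) b m o (c s : T -> nat -> R) :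
  (forall l, continuous (fun x => c x l)) -> (forall l, continuous (fun x => s x l)) ->
  mx_continuous (fun x => rot b m o (c x) (s x)).
Proof.
move=> cc sc; elim: b m o => [|b IH] m o /=; first exact: mx_continuous_cst.
case: (m < pw b)%N.
  by apply: mx_continuous_block => //; exact: mx_continuous_cst.
have AB o1 m1 : mx_continuous (fun x => rot b m1 o1 (c x) (s x)) by exact: IH.
apply: mx_continuous_block.
- exact: mx_continuousZ.
- by apply: mx_continuousN; exact: mx_continuousZ.
- exact: mx_continuousZ.
- apply: mx_continuousZ => //; apply: mx_continuousM => //.
  by apply: mx_continuousM => //; exact: mx_continuous_tr.
Qed.

(** Entries at natural indices, 0 outside the matrix, so that pairs of consecutive rows can be
    followed through block decompositions. *)
Definition ent n k (A : 'M[R]_(n, k)) (i j : nat) : R :=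
  if insub i is Some i' then if insub j is Some j' then A i' j' else 0 else 0.

Lemma entE n k (A : 'M[R]_(n, k)) (i : 'I_n) (j : 'I_k) : ent A i j = A i j.
Proof. by rewrite /ent !valK. Qed.

Lemma ent_row_out n k (A : 'M[R]_(n, k)) i j : (n <= i)%N -> ent A i j = 0.
Proof. by move=> ni; rewrite /ent insubF //; lia. Qed.

Lemma ent_col_out n k (A : 'M[R]_(n, k)) i j : (k <= j)%N -> ent A i j = 0.
Proof. by move=> kj; rewrite /ent; case: insubP => // i' _ _; rewrite insubF //; lia. Qed.

Lemma ent_col_mx n1 n2 k (A : 'M[R]_(n1, k)) (B : 'M[R]_(n2, k)) i j :
  ent (col_mx A B) i j = if (i < n1)%N then ent A i j else ent B (i - n1) j.
Proof.
case: (ltnP j k) => jk; last by rewrite !ent_col_out // if_same.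
case: ifP => i1.
  transitivity (col_mx A B (lshift n2 (Ordinal i1)) (Ordinal jk)).
    by rewrite -entE.
  by rewrite col_mxEu -entE.
case: (ltnP i (n1 + n2)) => i2; last by rewrite !ent_row_out //; lia.
have i3 : (i - n1 < n2)%N by lia.
transitivity (col_mx A B (rshift n1 (Ordinal i3)) (Ordinal jk)).
  by rewrite -entE /= subnKC //; lia.
by rewrite col_mxEd -entE.
Qed.

Lemma ent_row_mx n k1 k2 (A : 'M[R]_(n, k1)) (B : 'M[R]_(n, k2)) i j :
  (j < k1)%N -> ent (row_mx A B) i j = ent A i j.
Proof.
move=> jk; case: (ltnP i n) => ni; last by rewrite !ent_row_out.
transitivity (row_mx A B (Ordinal ni) (lshift k2 (Ordinal jk))).
  by rewrite -entE.
by rewrite row_mxEl -entE.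
Qed.

Lemma ent_scale n k a (A : 'M[R]_(n, k)) i j : ent (a *: A) i j = a * ent A i j.
Proof.
rewrite /ent; case: insub => [i'|]; last by rewrite mulr0.
by case: insub => [j'|]; rewrite ?mulr0 // mxE.
Qed.

Lemma ent0 n k i j : ent (0 : 'M[R]_(n, k)) i j = 0.
Proof. by rewrite /ent; case: insub => // i'; case: insub => // j'; rewrite mxE. Qed.

Lemma ent_lsubmx n k1 k2 (A : 'M[R]_(n, k1 + k2)) i j :
  (j < k1)%N -> ent (lsubmx A) i j = ent A i j.
Proof. by move=> jk; rewrite -[in RHS](hsubmxK A) ent_row_mx. Qed.

(* The second column is [J] times the first one, where [J] is the standard complex
   structure of [R ^ 2 + ... + R ^ 2]. *)
Definition col_rotated n k (A : 'M[R]_(n, k)) := forall x,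
  ent A x.*2.+1 1 = ent A x.*2 0 /\ ent A x.*2 1 = - ent A x.*2.+1 0.

Lemma col_rotatedZ n k a (A : 'M[R]_(n, k)) : col_rotated A -> col_rotated (a *: A).
Proof. by move=> h x; rewrite !ent_scale !(h x).1 !(h x).2 mulrN. Qed.

Lemma col_rotated_col n1 n2 k (A : 'M[R]_(n1, k)) (B : 'M[R]_(n2, k)) :
  ~~ odd n1 -> col_rotated A -> col_rotated B -> col_rotated (col_mx A B).
Proof.
move=> n1e hA hB x; have [y yE] : exists y, n1 = y.*2.
  by exists n1./2; rewrite -{1}(odd_double_half n1) (negPf n1e).
rewrite !ent_col_mx; case: ifP => x1; first by rewrite !ifT; [exact: hA|lia..].
rewrite !ifF; try lia.
rewrite (_ : x.*2.+1 - n1 = (x - y).*2.+1)%N; last by lia.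
by rewrite (_ : x.*2 - n1 = (x - y).*2)%N; [exact: hB|lia].
Qed.

Lemma col_rotated_col0 n1 n2 k (A : 'M[R]_(n1, k)) :
  col_rotated A -> col_rotated (col_mx A (0 : 'M[R]_(n2, k))).
Proof.
move=> hA x; have E i j : ent (col_mx A (0 : 'M[R]_(n2, k))) i j = ent A i j.
  by rewrite ent_col_mx; case: ifP => // i1; rewrite ent0 ent_row_out //; lia.
by rewrite !E; exact: hA.
Qed.

Lemma col_rotated_row n k1 k2 (A : 'M[R]_(n, k1)) (B : 'M[R]_(n, k2)) :
  (1 < k1)%N -> col_rotated A -> col_rotated (row_mx A B).
Proof. by move=> k1gt1 hA x; rewrite !ent_row_mx //; lia. Qed.

Lemma pw_gt0 b : (0 < pw b)%N. Proof. by rewrite pwE expn_gt0. Qed.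

Lemma odd_pwS b : odd (pw b.+1) = false.
Proof. by rewrite /= oddD addbb. Qed.

Lemma ent_block11 (A B C D : 'M[R]_1) : let M := block_mx A B C D in
  [/\ ent M 0 0 = A 0 0, ent M 0 1 = B 0 0, ent M 1 0 = C 0 0 & ent M 1 1 = D 0 0].
Proof.
move=> M; have E (i j : 'I_(1 + 1)) : ent M i j = M i j := entE M i j.
split; first exact: (etrans (E (lshift 1 0) (lshift 1 0)) (block_mxEul _ _ _ _ _ _)).
- exact: (etrans (E (lshift 1 0) (rshift 1 0)) (block_mxEur _ _ _ _ _ _)).
- exact: (etrans (E (rshift 1 0) (lshift 1 0)) (block_mxEdl _ _ _ _ _ _)).
- exact: (etrans (E (rshift 1 0) (rshift 1 0)) (block_mxEdr _ _ _ _ _ _)).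
Qed.

Lemma rot_col_rotated b m o c s : col_rotated (rot b.+1 m o c s).
Proof.
elim: b m o => [|b IH] m o.
  case=> [|x]; last by rewrite !ent_row_out ?oppr0 //=; lia.
  rewrite [rot _ _ _ _ _]/=; case: ifP => _ /=.
    by have [-> -> -> ->] := ent_block11 1%:M 0 0 1%:M; rewrite !mxE /= oppr0.
  match goal with |- context [block_mx ?A ?B ?C ?D] =>
    have [-> -> -> ->] := ent_block11 A B C D end.
  by rewrite trmx1 !mulmx1 !mxE.
have pw1 : (1 < pw b.+1)%N by have := pw_gt0 b; rewrite /=; lia.
rewrite rotS; case: ifP => _.
  rewrite /block_mx; apply: col_rotated_col.
  - by rewrite odd_pwS.
  - by apply: col_rotated_row.
  - by apply: col_rotated_row => // x; rewrite !ent0 oppr0.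
cbv zeta; rewrite /block_mx; apply: col_rotated_col.
- by rewrite odd_pwS.
- by apply: col_rotated_row => //; exact: col_rotatedZ.
- by apply: col_rotated_row => //; exact: col_rotatedZ.
Qed.

(** For [m < pw b], an odd map from the m-sphere, in the coordinates of [tau b m], to the frames.
    The offset [o] stays free so that one family can serve at several places of a forest. The
    condition on the columns is what later separates A from B. *)
Definition is_framing b m n k (F : nat -> (nat -> R) -> (nat -> R) -> 'M[R]_(n, k)) :=
  [/\ forall o c s, (forall l, c l ^+ 2 + s l ^+ 2 = 1) ->
        (F o c s)^T *m F o c s = 1%:M,
      forall i o c s c' s', sign_change i (tau b m) o c s c' s' ->
        F o c' s' = sgn R i (tree_class (tau b m) o) *: F o c s,
      forall (T : topologicalType) o (c s : T -> nat -> R),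
        (forall l, continuous (fun x => c x l)) ->
        (forall l, continuous (fun x => s x l)) ->
        mx_continuous (fun x => F o (c x) (s x)) &
      (1 < k)%N -> forall o c s, col_rotated (F o c s)].

Definition framable b m n k := exists F, @is_framing b m n k F.

Lemma framable_rot b m : framable b.+1 m (pw b.+1) (pw b.+1).
Proof.
exists (rot b.+1 m); split=> *; [exact: rot_orthogonal|exact: rot_sign| |
  exact: rot_col_rotated]; exact: rot_continuous.
Qed.

Lemma framable_lsub b m n k1 k2 : framable b m n (k1 + k2) -> framable b m n k1.
Proof.
case=> F [Fo Fs Fc Fr]; exists (fun o c s => lsubmx (F o c s)); split.
- move=> o c s cs; have := Fo o c s cs; rewrite -[in X in X -> _](hsubmxK (F o c s)).
  by rewrite tr_row_mx mul_col_row scalar_mx_block => /eq_block_mx[].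
- by move=> i o c s c' s' h; rewrite (Fs i o c s) // linearZ.
- move=> T o c s cc sc i j; rewrite (_ : (fun x => _) = fun x =>
    F o (c x) (s x) i (lshift k2 j)); first exact: Fc.
  by apply/funext => x; rewrite mxE.
- move=> k1gt1 o c s x; rewrite !ent_lsubmx //; try lia.
  by apply: Fr; lia.
Qed.

Lemma framable_addrow b m n r k : framable b m n k -> framable b m (n + r) k.
Proof.
case=> F [Fo Fs Fc Fr]; exists (fun o c s => col_mx (F o c s) 0); split.
- by move=> o c s cs; rewrite tr_col_mx mul_row_col mulmx0 addr0 Fo.
- by move=> i o c s c' s' h; rewrite (Fs i o c s) // scale_col_mx scaler0.
- by move=> T o c s cc sc; apply: mx_continuous_col; [exact: Fc|exact: mx_continuous_cst].
- by move=> kgt1 o c s; apply: col_rotated_col0; exact: Fr.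
Qed.

Lemma framable_diag b m n1 k1 n2 k2 : (1 < k1)%N ->
  framable b m n1 k1 -> framable b m n2 k2 -> framable b m (n1 + n2) (k1 + k2).
Proof.
move=> k1gt1 [F [Fo Fs Fc Fr]] [G [Go Gs Gc Gr]].
exists (fun o c s => block_mx (F o c s) 0 0 (G o c s)); split.
- move=> o c s cs; rewrite tr_block_mx mulmx_block !trmx0 !mulmx0 !mul0mx !addr0 add0r.
  by rewrite Fo // Go // -scalar_mx_block.
- by move=> i o c s c' s' h; rewrite (Fs i o c s) // (Gs i o c s) // scale_block_mx !scaler0.
- move=> T o c s cc sc; apply: mx_continuous_block; [exact: Fc| | |exact: Gc];
    exact: mx_continuous_cst.
- move=> _ o c s x.
  have E i j : (j < k1)%N -> ent (block_mx (F o c s) 0 0 (G o c s)) i j = ent (F o c s) i j.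
    move=> jk; rewrite ent_col_mx ent_row_mx //; case: ifP => // i1.
    by rewrite ent_row_mx // ent0 ent_row_out //; lia.
  by rewrite !E //; try lia; exact: Fr.
Qed.

Lemma framable_copies b m t : framable b.+1 m (t * pw b.+1) (t * pw b.+1).
Proof.
elim: t => [|t IH].
  exists (fun _ _ _ => 0); split=> //.
  - by move=> o c s _; apply/matrixP => -[].
  - by move=> *; rewrite scaler0.
  - by move=> *; exact: mx_continuous_cst.
rewrite mulSn; apply: framable_diag => //; last exact: framable_rot.
by have := pw_gt0 b; rewrite /=; lia.
Qed.

Lemma framable_id n k : (k <= n)%N -> framable 0 0 n k.
Proof.
move=> kn; exists (fun _ _ _ => pid_mx k); split.
- by move=> o c s _; rewrite tr_pid_mx mul_pid_mx minnn (minn_idPr kn) pid_mx_1.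
- by move=> *; rewrite sgn0 scale1r.
- by move=> *; exact: mx_continuous_cst.
- have E i j : (j < k)%N -> ent (pid_mx k : 'M[R]_(n, k)) i j = (i == j)%:R.
    move=> jk; case: (ltnP i n) => ni; last first.
      by rewrite ent_row_out //; case: eqP => // ?; lia.
    transitivity ((pid_mx k : 'M[R]_(n, k)) (Ordinal ni) (Ordinal jk)).
      by rewrite -entE.
    rewrite mxE /=; congr (_%:R); congr nat_of_bool; lia.
  move=> kgt1 o c s x; rewrite !E //; try lia.
  by case: x => [|x] /=; rewrite ?oppr0 ?mulr0n ?oppr0 // doubleS.
Qed.

Lemma framable_up b m n k : (m < pw b)%N -> framable b m n k -> framable b.+1 m n k.
Proof.
move=> mb [F [Fo Fs Fc Fr]]; exists F; split=> // i o c s c' s'.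
by rewrite /= mb; exact: Fs.
Qed.

(** A join: a framing over the left subtree, scaled by the cosine, is put on top of one over the
    right subtree, scaled by the sine. The columns stay orthonormal because the squares of the two
    factors add up to 1. *)
Lemma framable_stack b m n k1 k2 : (pw b <= m)%N -> (k1 + k2)%N = pw b ->
  framable b (m - pw b) n k1 -> framable b.+1 m (pw b + n) k1.
Proof.
move=> bm kE [F [Fo Fs Fc Fr]].
have [G [Go Gs Gc Gr]] : framable b (pw b).-1 (pw b) k1.
  apply: (@framable_lsub _ _ _ _ k2); rewrite kE.
  case: b {bm F Fo Fs Fc Fr} kE => [|b] kE; first exact: framable_id.
  exact: framable_rot.
have mb : (m < pw b)%N = false by lia.
pose l := tau b (pw b).-1; pose r := tau b (m - pw b).
exists (fun o c s => let k := (o + nodes l + nodes r)%N in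
  col_mx (c k *: G o c s) (s k *: F (o + nodes l)%N c s)); split.
- move=> o c s cs /=; rewrite tr_col_mx mul_row_col !linearZ /= -?scalemxAl.
  rewrite -?scalemxAr !scalerA Go // Fo // -scalerDl -!expr2 cs scale1r //.
- move=> i o c s c' s'; rewrite /= mb => /sign_change_node[hl hr hc hs].
  rewrite hc hs (Gs i o c s) // (Fs i _ c s) // scale_col_mx !scalerA.
  congr col_mx; congr (_ *: _).
    by rewrite mulrAC -sgnD.
  rewrite mulrAC -sgnD; congr (sgn R i _ * _).
  by rewrite -addrA addff addr0.
- move=> T o c s cc sc; apply: mx_continuous_col; apply: mx_continuousZ => //;
    [exact: Gc|exact: Fc].
- move=> k1gt1 o c s; apply: col_rotated_col; last 2 first.
  + by apply: col_rotatedZ; exact: Gr.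
  + by apply: col_rotatedZ; exact: Fr.
  have : (1 < pw b)%N by lia.
  by case: (b) => [|b'] //; rewrite odd_pwS.
Qed.

(** Induction on the binary digits of [m]. With [n = t * pw b.+1 + r], diagonal copies of [rot]
    provide the first [t * pw b.+1] columns; any remaining [q] columns are found in dimension [r] by
    a join that removes the leading digit of [m]. Lucas' rule carries the evenness hypothesis
    along. *)
Lemma framable_exists b m n k : (0 < k <= n)%N -> (m < pw b)%N ->
  (forall j, (n - k < j <= m)%N -> ~~ odd 'C(n, j)) -> framable b m n k.
Proof.
elim: b m n k => [|b IH] m n k kn mb H.
  have -> : m = 0%N by move: mb => /=; lia.
  by apply: framable_id; lia.
case: (ltnP m (pw b)) => mb'; first by apply: framable_up => //; apply: IH.
have nE := divn_eq n (pw b.+1); set t := (n %/ _)%N in nE; set r := (n %% _)%N in nE.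
have rlt : (r < pw b.+1)%N by rewrite ltn_mod pw_gt0.
case: (leqP k (t * pw b.+1)) => kt.
  rewrite nE; apply: framable_addrow; apply: (@framable_lsub _ _ _ _ (t * pw b.+1 - k)).
  by rewrite subnKC //; exact: framable_copies.
have [q kE] : exists q, k = (t * pw b.+1 + q)%N by exists (k - t * pw b.+1)%N; lia.
have Cr j : (j < pw b.+1)%N -> odd 'C(n, j) = odd 'C(r, j).
  by move=> jb; rewrite nE [pw b.+1]pwE odd_bin_small // -pwE.
have nkr : (n - k = r - q)%N by lia.
(* ['C(n, r)] is odd and [r] exceeds [n - k], so [r] must lie beyond [m]. *)
have mr : (m < r)%N.
  rewrite ltnNge; apply/negP => rm.
  by have := H r; rewrite Cr // binn nkr /=; move/(_ ltac:(lia)).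
have [r' rE] : exists r', r = (pw b + r')%N by exists (r - pw b)%N; lia.
have r'lt : (r' < pw b)%N by move: rlt; rewrite rE /=; lia.
have Cr' j : odd 'C(r, pw b + j) = odd 'C(r', j).
  by rewrite rE pwE odd_bin_shift // -pwE.
(* ['C(n, pw b)] is odd too, so [pw b] cannot exceed [n - k = r - q]. Hence the [q] columns fit into
   the lower block, which has [r'] rows. *)
have bq : (pw b <= r - q)%N.
  rewrite leqNgt; apply/negP => rq.
  have := H (pw b); rewrite Cr -1?(addn0 (pw b)) ?Cr' ?bin0 ?addn0 /=; last first.
    by have := pw_gt0 b; lia.
  by rewrite nkr; move/(_ ltac:(lia)).
have fr : framable b.+1 m r q.
  rewrite rE; apply: (@framable_stack _ _ _ _ (pw b - q)) => //; first by lia.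
  apply: IH; [by lia|by move: mb => /=; lia|] => j jr.
  rewrite -Cr' -Cr; last by move: mb => /=; lia.
  by apply: H; lia.
case: (posnP t) => t0; first by rewrite kE nE t0 !mul0n !add0n.
rewrite kE nE; apply: framable_diag => //; last exact: framable_copies.
by have := pw_gt0 b; rewrite /=; nia.
Qed.

End Frames.

(** * Borsuk-Ulam *)

Section BorsukUlam.
Variables (R : realType) (e : nat) (S : nat -> class e) (l : seq (class e)).
Hypothesis S_diag : forall i : 'I_e, S i i = 1.
Hypothesis S_tri : forall i k : 'I_e, (i < k)%N -> S i k = 0.
Hypothesis J1 : forall M, (1 < M)%N -> J M (fun i : 'I_e => S i) l = 1.
Variable F : nat -> 'rV[R]_e -> R.
Hypothesis F_cont : forall j, (j < e)%N -> continuous (F j).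

Definition reflx (i : 'I_e) (x : 'rV[R]_e) : 'rV[R]_e :=
  \row_k (sgn R i (S k) * x 0 k).

Hypothesis F_refl : forall j (i : 'I_e) (x : 'rV[R]_e), (j < e)%N -> `|x 0 i| = 1 ->
  F j (reflx i x) = sgn R i (nth 0 l j) * F j x.

Definition gridpt M (v : vertex e) : 'rV[R]_e := \row_k ((v k)%:R / M%:R - 1).

Lemma gridpt_refl M (i : 'I_e) (v : vertex e) : (0 < M)%N -> (forall k, v k <= M.*2)%N ->
  gridpt M (refl M (fun i : 'I_e => S i) i v) = reflx i (gridpt M v).
Proof.
move=> M0 vle; apply/rowP => k; rewrite !mxE ffunE /sgn.
have MN : M%:R != 0 :> R by rewrite pnatr_eq0 -lt0n.
case: (F2_eq01 (S k i)) => -> /=; first by rewrite expr0 mul1r.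
by rewrite natrB // expr1 -muln2 natrM; field.
Qed.

Lemma gridpt_facet M (i : 'I_e) (v : vertex e) : (0 < M)%N -> (v i == 0%N) || (v i == M.*2) ->
  `|gridpt M v 0 i| = 1.
Proof.
move=> M0; have MN : M%:R != 0 :> R by rewrite pnatr_eq0 -lt0n.
rewrite mxE => /orP[] /eqP ->; first by rewrite mul0r add0r normrN1.
by rewrite -muln2 natrM (_ : _ - 1 = 1) ?normr1 //; field.
Qed.

(** Where [F j] vanishes the reference sign is used; as it has the right class, the completed sign
    function has it as well. *)
Definition sign_bit M j (v : vertex e) : 'F_2 :=
  if F j (gridpt M v) == 0 :> R then ref M (fun i : 'I_e => S i) (nth 0 l j) v
  else (F j (gridpt M v) < 0 :> R)%:R.

Lemma sign_bit_class M j : (1 < M)%N -> (j < e)%N ->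
  of_class M (fun i : 'I_e => S i) (sign_bit M j) (nth 0 l j).
Proof.
move=> M1 je v i vle vi; have M0 : (0 < M)%N by lia.
rewrite /sign_bit gridpt_refl // F_refl ?gridpt_facet // mulf_eq0.
have -> : (sgn R i (nth 0 l j) == 0) = false by rewrite signr_eq0.
case: eqP => [_|/eqP Fn0] /=; first exact: ref_class.
rewrite /sgn; case: (F2_eq01 (nth 0 l j i)) => -> /=.
  by rewrite expr0 mul1r addr0.
rewrite expr1 mulN1r oppr_lt0 -natF2_neg -leNgt; congr (_%:R); congr nat_of_bool.
by rewrite le_eqVlt eq_sym (negPf Fn0).
Qed.

(** If on every path some [F j] kept a strict sign, then every path would contribute zero to the
    count, whose value is 1. *)
Lemma bad_path M : (1 < M)%N -> exists p : gpath e M, forall j, (j < e)%N ->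
  exists a b, [/\ (a <= e)%N, (b <= e)%N &
    F j (gridpt M (vtx p a)) * F j (gridpt M (vtx p b)) <= 0].
Proof.
move=> M1; apply: contrapT => /forallNP nob.
suff /eqP : J M (fun i : 'I_e => S i) l = 0 by rewrite J1 // oner_eq0.
rewrite -(J_class S_diag S_tri M1 (fun j je => sign_bit_class M1 je)).
apply: big1 => p _; have /existsNP[j /not_implyP[je /forallNP hj]] := nob p.
have pos a b : (a <= e)%N -> (b <= e)%N ->
    0 < F j (gridpt M (vtx p a)) * F j (gridpt M (vtx p b)).
  move=> ae be; rewrite ltNge; apply/negP => ab0.
  by apply: (hj a); exists b.
have nz a : (a <= e)%N -> (F j (gridpt M (vtx p a)) == 0) = false.
  by move=> ae; apply/eqP => Fa0; have := pos a a ae ae; rewrite Fa0 mul0r ltxx.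
rewrite (bigD1 (Ordinal je)) //= /dif /sign_bit !nz //; last exact: ltnW.
rewrite (_ : (F j (gridpt M (vtx p j)) < 0) = (F j (gridpt M (vtx p j.+1)) < 0)).
  by rewrite addFF mul0r.
by have := pos j j.+1 (ltnW je) je; apply: contraTeq; case: ltP => h1; case: ltP => h2 //= _;
  rewrite -leNgt; [apply: mulr_le0_ge0|apply: mulr_ge0_le0]; rewrite ?(ltW h1) ?(ltW h2).
Qed.

Lemma vtx_near M (p : gpath e M) a (k : 'I_e) : (0 < M)%N ->
  `|gridpt M (vtx p 0) 0 k - gridpt M (vtx p a) 0 k| <= M%:R^-1.
Proof.
move=> M0; have MN : 0 < M%:R^-1 :> R by rewrite invr_gt0 ltr0n.
rewrite !mxE opprB addrA subrK -mulrBl normrM (gtr0_norm MN) ler_piMl ?(ltW MN) //.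
rewrite !ffunE ltn0; case: ifP => _; last by rewrite subrr normr0.
rewrite -addn1 -!muln2 !natrD !natrM natrD ler_norml.
by case: (p.1.2 k) => /=; apply/andP; split; lra.
Qed.

Lemma gridpt_bound M (v : vertex e) k : (0 < M)%N -> (forall k, v k <= M.*2)%N ->
  -1 <= gridpt M v 0 k <= 1.
Proof.
move=> M0 vle; have MN : 0 < M%:R :> R by rewrite ltr0n.
rewrite mxE; apply/andP; split.
  by rewrite lerBrDl subrr divr_ge0 // ler0n.
by rewrite lerBlDl ler_pdivrMr //; have := vle k; rewrite -(ler_nat R) -muln2 natrM; lra.
Qed.

(** The paths of [bad_path] shrink as the mesh tends to 0. At a cluster point of their first
    vertices no [F j] can be nonzero, for it would keep its sign on an entire path nearby. *)
Theorem borsuk_ulam : exists x : 'rV[R]_e, forall j, (j < e)%N -> F j x = 0.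
Proof.
pose p n := projT1 (cid (@bad_path n.+2 isT)).
have hp n : forall j, (j < e)%N -> exists a b, [/\ (a <= e)%N, (b <= e)%N &
    F j (gridpt n.+2 (vtx (p n) a)) * F j (gridpt n.+2 (vtx (p n) b)) <= 0].
  exact: projT2 (cid (@bad_path n.+2 isT)).
pose u n := gridpt n.+2 (vtx (p n) 0).
have cK : compact [set x : 'rV[R]_e | forall i, `[-1 : R, 1]%classic (x 0 i)].
  by apply: (@rV_compact R e (fun=> `[-1 : R, 1]%classic)) => i; exact: segment_compact.
have [x [_ xu]] : [set x : 'rV[R]_e | forall i, `[-1 : R, 1]%classic (x 0 i)] `&`
    cluster (u @ \oo) !=set0.
  apply: cK; exists 0%N => // n _ i /=; rewrite in_itv /=.
  apply: (@gridpt_bound n.+2 (vtx (p n) 0) i) => // k; exact: vtx_le.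
exists x => j je; apply: contrapT => /eqP Fx0.
have /nbhs_ballP[r /= r0 br] : nbhs x [set y | 0 < F j y * F j x].
  have : 0 < F j x * F j x by rewrite -expr2 exprn_even_gt0.
  have : {for x, continuous (fun y => F j y * F j x)}.
    have h := F_cont je (x := x).
    by apply: continuousM; [exact: h|exact: cst_continuous].
  by move=> h h0; exact: (cvgr_gt _ h).
have r20 : 0 < r / 2 by rewrite divr_gt0.
have [N _ hN] : \forall n \near \oo, n.+2%:R^-1 < r / 2 :> R.
  have := near_infty_natSinv_lt (PosNum r20) => -[N _ hN]; exists N => // n /hN /=.
  by apply: le_lt_trans; rewrite lef_pV2 ?posrE ?ltr0n // ler_nat.
have uN : (u @ \oo) [set u n | n in [set n | (N <= n)%N]].
  by exists N => // n Nn; exists n.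
have [_ [[n Nn <-] [_ xn]]] := xu _ _ uN (nbhsx_ballx x _ r20).
have [a [b [ae be]]] := hp n j je; apply/negP; rewrite -ltNge.
have pos c : 0 < F j (gridpt n.+2 (vtx (p n) c)) * F j x.
  apply: br; split=> // i k; rewrite ord1; have := xn 0 k; rewrite /ball /= => xnk.
  rewrite [r]splitr; apply: le_lt_trans (ler_distD (u n 0 k) _ _) _.
  apply: ltrD => //; apply: le_lt_trans (hN n Nn); exact: vtx_near.
have := mulr_gt0 (pos a) (pos b); rewrite mulrACA -[X in _ * X]expr2 pmulr_lgt0 //.
by rewrite exprn_even_gt0.
Unshelve. all: by end_near. Qed.

End BorsukUlam.

(** * Coincidences *)

Definition seq_continuous (R : realType) (T : topologicalType) (f : T -> seq R) :=
  forall j, continuous (fun x => nth 0 (f x) j).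

Lemma seq_continuous_cat (R : realType) (T : topologicalType) (f g : T -> seq R) N :
  (forall x, size (f x) = N) -> seq_continuous f -> seq_continuous g ->
  seq_continuous (fun x => f x ++ g x).
Proof.
move=> fN fc gc j.
rewrite (_ : (fun x => _) = fun x => if (j < N)%N then nth 0 (f x) j else nth 0 (g x) (j - N)).
  by case: (j < N)%N; [exact: fc|exact: gc].
by apply/funext => x; rewrite nth_cat fN.
Qed.

Lemma seq_continuous_map (R : realType) (T : topologicalType) (I : Type) (r : seq I)
    (f : I -> T -> R) : (forall i, continuous (f i)) ->
  seq_continuous (fun x => [seq f i x | i <- r]).
Proof.
move=> fc; elim: r => [|i r IH] [|j]; try exact: cst_continuous.
  exact: fc.
exact: IH.
Qed.

Section Solve.
Variables (R : realType) (e K : nat) (tA tB : btree (class e)).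
Hypothesis leaves_A : leaf_all (fun w => w = 0) tA.
Hypothesis leaves_B : leaf_all (fun w => w = 0) tB.
Hypothesis dim_e : (nodes tA + nodes tB + K.*2)%N = e.
Local Notation S := (forest_sin K tA tB).
Local Notation z := (class_z K tA tB).
Implicit Types (c s : nat -> R) (g : (nat -> R) -> (nat -> R) -> R).

Definition forest_change (i : 'I_e) c s c' s' := forall l, (l < e)%N ->
  c' l = sgn R i (cosc e l) * c l /\ s' l = sgn R i (S l) * s l.

(** Continuity is tested along continuous families of angles, the form in which it is composed with
    the parametrization by the cube. *)
Definition cs_continuous g := forall (T : topologicalType) (c s : T -> nat -> R),
  (forall x l, c x l ^+ 2 + s x l ^+ 2 = 1) ->
  (forall l, continuous (fun x => c x l)) -> (forall l, continuous (fun x => s x l)) ->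
  continuous (fun x => g (c x) (s x)).

Definition has_class g (w : class e) := forall i c s c' s',
  (forall l, c l ^+ 2 + s l ^+ 2 = 1) -> forest_change i c s c' s' ->
  g c' s' = sgn R i w * g c s.

Let cosx (x : 'rV[R]_e) (l : nat) : R :=
  if insub l is Some k then cos (pi / 2 * x 0 k) else 1.
Let sinx (x : 'rV[R]_e) (l : nat) : R :=
  if insub l is Some k then sin (pi / 2 * x 0 k) else 0.

(** The angles are pi / 2 times the coordinates of the cube: reversing a coordinate changes the sign
    of its sine, and the gluing of facet [i] becomes the [i]-th generator of the sign group. *)
Lemma solve (ex : seq (class e * ((nat -> R) -> (nat -> R) -> R))) :
  size ex = e ->
  (forall M, (1 < M)%N -> J M (fun i : 'I_e => S i) (map fst ex) = 1) ->
  (forall j, (j < e)%N -> cs_continuous (nth (0, fun _ _ => 0) ex j).2 /\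
     has_class (nth (0, fun _ _ => 0) ex j).2 (nth (0, fun _ _ => 0) ex j).1) ->
  exists c s, (forall l, c l ^+ 2 + s l ^+ 2 = 1) /\
    forall j, (j < e)%N -> (nth (0, fun _ _ => 0) ex j).2 c s = 0.
Proof.
move=> sz J1 gP; pose F j x := (nth (0, fun _ _ => 0) ex j).2 (cosx x) (sinx x).
have cs1 x l : cosx x l ^+ 2 + sinx x l ^+ 2 = 1.
  rewrite /cosx /sinx; case: insub => [k|]; first exact: cos2Dsin2.
  by rewrite expr0n addr0 expr1n.
have ax k : continuous (fun x : 'rV[R]_e => pi / 2 * x 0 k).
  move=> x; apply: (@continuous_comp _ _ _ (fun y : 'rV[R]_e => y 0 k) (fun y => pi / 2 * y)).
    exact: coord_continuous.
  exact: mulrl_continuous.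
have cc l : continuous (fun x => cosx x l).
  rewrite /cosx; case: insub => [k|] x; last exact: cst_continuous.
  by apply: continuous_comp; [exact: ax|exact: continuous_cos].
have sc l : continuous (fun x => sinx x l).
  rewrite /sinx; case: insub => [k|] x; last exact: cst_continuous.
  by apply: continuous_comp; [exact: ax|exact: continuous_sin].
have Sd (i : 'I_e) := (forest_sin_spec leaves_A leaves_B dim_e i).1.
have St (i k : 'I_e) := (forest_sin_spec leaves_A leaves_B dim_e i).2 k.
have [|j i x je xi|x Fx] := @borsuk_ulam R e S (map fst ex) Sd St J1 F.
- by move=> j je; apply: (gP j je).1.
- rewrite (nth_map (0, fun _ _ => 0)) ?sz //.
  apply: (gP j je).2 => // l le; rewrite /cosx /sinx !insubT /=.
  rewrite mxE /=; split; last first.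
    rewrite /sgn; case: (F2_eq01 (S l i)) => -> /=; first by rewrite expr0 !mul1r.
    by rewrite expr1 !mulN1r mulrN sinN.
  have -> : cos (pi / 2 * (sgn R i (S l) * x 0 (Ordinal le))) = cos (pi / 2 * x 0 (Ordinal le)).
    rewrite /sgn; case: (F2_eq01 (S l i)) => -> /=; first by rewrite expr0 !mul1r.
    by rewrite expr1 !mulN1r mulrN cosN.
  (* The generator also reverses the cosine at node [i], while the gluing keeps it; both agree
     because this cosine vanishes on the facet. *)
  rewrite /sgn ffunE; case: eqP => [il|_]; last by rewrite expr0 mul1r.
  have Ei : Ordinal le = i by apply/val_inj.
  rewrite [Sub l le]Ei Ei.
  have -> : cos (pi / 2 * x 0 i) = 0.
    by move/eqP: xi; rewrite eqr_norml ler01 andbT => /orP[] /eqP ->;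
      rewrite ?mulrN1 ?cosN ?mulr1 cos_pihalf.
  by rewrite mulr0.
- by exists (cosx x), (sinx x); split=> // j je; exact: Fx.
Qed.

End Solve.

(** The independent entries of a symmetric matrix; their number [symdim k] is k(k+1)/2. *)
Definition sympairs k := enum [pred p : 'I_k * 'I_k | (p.1 <= p.2)%N].
Definition symdim k := size (sympairs k).

(** The differential at A of [A^T *m A]; for a frame A its kernel is the tangent space. *)
Definition symm_part (R : realType) n k (A X : 'M[R]_(n, k)) : 'M[R]_k :=
  A^T *m X + X^T *m A.

Lemma trmxN (R : realType) n k (A : 'M[R]_(n, k)) : (- A)^T = - A^T.
Proof. by apply/matrixP => i j; rewrite !mxE. Qed.

Lemma symm_partNl (R : realType) n k (A X : 'M[R]_(n, k)) :
  symm_part (- A) X = - symm_part A X.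
Proof. by rewrite /symm_part trmxN mulNmx mulmxN opprD. Qed.

Lemma symm_partNr (R : realType) n k (A X : 'M[R]_(n, k)) :
  symm_part A (- X) = - symm_part A X.
Proof. by rewrite /symm_part trmxN mulNmx mulmxN opprD. Qed.

Lemma symm_part_eq0 (R : realType) n k (A X : 'M[R]_(n, k)) :
  (forall p, p \in sympairs k -> symm_part A X p.1 p.2 = 0) -> symm_part A X = 0.
Proof.
move=> h; have tr : (symm_part A X)^T = symm_part A X.
  by rewrite /symm_part linearD /= !trmx_mul !trmxK addrC.
apply/matrixP => i j; rewrite [RHS]mxE; case: (leqP i j) => ij.
  by apply: (h (i, j)); rewrite mem_enum inE.
by rewrite -tr mxE; apply: (h (j, i)); rewrite mem_enum inE /= ltnW.
Qed.

Lemma nth_map_mul (R : realType) (a : R) (r : seq R) j :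
  nth 0 [seq a * v | v <- r] j = a * nth 0 r j.
Proof.
case: (ltnP j (size r)) => jr; first by rewrite (nth_map 0).
by rewrite !nth_default ?size_map ?mulr0.
Qed.

Lemma sgn_cases (R : realType) e (i : 'I_e) w : sgn R i w = 1 \/ sgn R i w = -1.
Proof. by rewrite /sgn; case: (F2_eq01 (w i)) => ->; [left|right]. Qed.

Lemma size_ord_enum d : size (ord_enum d) = d.
Proof. by rewrite -(size_map val) val_ord_enum size_iota. Qed.

Lemma nth_ord_enum_id d (i j : 'I_d) : nth i (ord_enum d) j = j.
Proof.
apply: val_inj; rewrite -(nth_map _ 0%N) ?size_ord_enum // val_ord_enum.
by rewrite nth_iota.
Qed.

Section Coincidence.
Variables (R : realType) (n k d : nat).
Local Notation mat := 'M[R]_(n, k).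
Local Notation V := (fun A : mat => A^T *m A = 1%:M).
Variables (E : mat -> 'rV[R]_d) (dE : mat -> mat -> 'rV[R]_d).
Hypothesis E_even : forall A, V A -> E (- A) = E A.
Hypothesis dE_oddl : forall A X, V A -> dE (- A) X = - dE A X.
Hypothesis dE_oddr : forall A X, V A -> dE A (- X) = - dE A X.
Hypothesis E_cont : forall (T : topologicalType) (A : T -> mat),
  (forall x, V (A x)) -> mx_continuous A -> mx_continuous (fun x => E (A x)).
Hypothesis dE_cont : forall (T : topologicalType) (A X : T -> mat),
  (forall x, V (A x)) -> mx_continuous A -> mx_continuous X ->
  mx_continuous (fun x => dE (A x) (X x)).

Definition coincidence (A B : mat) := exists X Y t,
  [/\ [\/ X != 0, Y != 0 | t != 0 :> R], symm_part A X = 0, symm_part B Y = 0 &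
      dE A X - dE B Y + t *: (E A - E B) = 0].

(** All equations have class z: replacing (A, X) by (-A, -X) changes none of them, and reversing (X,
    Y, t) changes the sign of all. [xtra] leaves room for equations of other classes. A solution is
    nontrivial because (X, Y, t) lies on the unit sphere. *)
Lemma coincidence_exists e (tA tB : btree (class e))
    (FA FB : (nat -> R) -> (nat -> R) -> mat)
    (xtra : seq (class e * ((nat -> R) -> (nat -> R) -> R))) :
  leaf_all (fun w => w = 0) tA -> leaf_all (fun w => w = 0) tB ->
  (nodes tA + nodes tB + (n * k).*2)%N = e ->
  (forall c s, (forall l, c l ^+ 2 + s l ^+ 2 = 1) -> V (FA c s) /\ V (FB c s)) ->
  (forall i j, cs_continuous (fun c s => FA c s i j)) ->
  (forall i j, cs_continuous (fun c s => FB c s i j)) ->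
  (forall i c s c' s', sign_change i tA 0 c s c' s' ->
     FA c' s' = sgn R i (class_x tA) *: FA c s) ->
  (forall i c s c' s', sign_change i tB (nodes tA) c s c' s' ->
     FB c' s' = sgn R i (class_y tA tB) *: FB c s) ->
  (forall j, (j < size xtra)%N ->
     cs_continuous (nth (0, fun _ _ => 0) xtra j).2 /\
     has_class (n * k) tA tB (nth (0, fun _ _ => 0) xtra j).2
       (nth (0, fun _ _ => 0) xtra j).1) ->
  (d + (symdim k).*2 + size xtra <= e)%N ->
  (forall M, (1 < M)%N -> J M (fun i : 'I_e => forest_sin (n * k) tA tB i)
     (map fst xtra ++ nseq (e - size xtra) (class_z (n * k) tA tB)) = 1) ->
  exists c s, [/\ forall l, c l ^+ 2 + s l ^+ 2 = 1,
    forall j, (j < size xtra)%N -> (nth (0, fun _ _ => 0) xtra j).2 c s = 0 &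
    coincidence (FA c s) (FB c s)].
Proof.
set K := (n * k)%N; set x := class_x tA; set y := class_y tA tB; set z := class_z K tA tB.
move=> lA lB dime FV FAc FBc FAs FBs xP xsz J1.
pose tZ := tree_Z K tA tB; pose co := @coords R e tZ (nodes tA + nodes tB).
pose X c s : mat := \matrix_(i, j) nth 0 (co c s) (i * k + j)%N.
pose Y c s : mat := \matrix_(i, j) nth 0 (co c s) (K + (i * k + j))%N.
pose t c s : R := nth 0 (co c s) K.*2.
pose eqn c s := dE (FA c s) (X c s) - dE (FB c s) (Y c s) +
  t c s *: (E (FA c s) - E (FB c s)).
pose zf c s := [seq eqn c s 0 j | j <- ord_enum d] ++
  [seq symm_part (FA c s) (X c s) p.1 p.2 | p <- sympairs k] ++
  [seq symm_part (FB c s) (Y c s) p.1 p.2 | p <- sympairs k].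
have size_zf (c s : nat -> R) : size (zf c s) = (d + (symdim k).*2)%N.
  by rewrite !size_cat !size_map size_ord_enum -addnn.
have nodeZ : nodes tZ = K.*2 := nodes_Z K tA tB.
have size_co (c s : nat -> R) : size (co c s) = K.*2.+1 by rewrite size_coords nodeZ.
have ik_lt (i : 'I_n) (j : 'I_k) : (i * k + j < K)%N.
  have := ltn_ord i; have := ltn_ord j; rewrite /K; nia.
have leafZ j : nth 0 (leaves tZ) j = if (j < K)%N then x else if (j < K.*2)%N then y else 0.
  rewrite leaves_comb nth_rcons size_cat !size_nseq addnn.
  case: ltnP => j2; last by rewrite if_same ifF //; lia.
  rewrite nth_cat size_nseq; case: ltnP => jK; rewrite nth_nseq ifT //; lia.
have chA i (c s c' s' : nat -> R) : forest_change K tA tB i c s c' s' -> sign_change i tA 0 c s c' s'.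
  have [le Se] := tree_in_A dime (isT : (1 < 2)%N).
  by move=> h l lo; have [|-> ->] := h l; [by case/andP: lo => _ /leq_trans; apply|rewrite Se].
have chB i (c s c' s' : nat -> R) : forest_change K tA tB i c s c' s' ->
    sign_change i tB (nodes tA) c s c' s'.
  have [le Se] := tree_in_B dime (isT : (1 < 2)%N).
  by move=> h l lo; have [|-> ->] := h l; [by case/andP: lo => _ /leq_trans; apply|rewrite Se].
have chZ i (c s c' s' : nat -> R) : forest_change K tA tB i c s c' s' ->
    sign_change i tZ (nodes tA + nodes tB) c s c' s'.
  have [le Se] := tree_in_Z dime (isT : (1 < 2)%N).
  by move=> h l lo; have [|-> ->] := h l; [by case/andP: lo => _ /leq_trans; apply|rewrite Se].
have co_sign i (c s c' s' : nat -> R) j : forest_change K tA tB i c s c' s' -> (j < K.*2.+1)%N ->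
    nth 0 (co c' s') j = sgn R i z *
      (sgn R i (if (j < K)%N then x else if (j < K.*2)%N then y else 0) * nth 0 (co c s) j).
  move=> h jK; rewrite mulrA -sgnD -leafZ; apply: coords_sign; last by rewrite nodeZ.
  exact: chZ.
have X_sign i (c s c' s' : nat -> R) : forest_change K tA tB i c s c' s' ->
    X c' s' = sgn R i z *: (sgn R i x *: X c s).
  move=> h; apply/matrixP => p q; rewrite !mxE (co_sign _ _ _ _ _ _ h).
    by rewrite ik_lt.
  by have := ik_lt p q; lia.
have Y_sign i (c s c' s' : nat -> R) : forest_change K tA tB i c s c' s' ->
    Y c' s' = sgn R i z *: (sgn R i y *: Y c s).
  move=> h; apply/matrixP => p q; have pq := ik_lt p q; rewrite !mxE (co_sign _ _ _ _ _ _ h).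
    by rewrite ifF ?ifT //; lia.
  by lia.
have t_sign i (c s c' s' : nat -> R) : forest_change K tA tB i c s c' s' ->
    t c' s' = sgn R i z * t c s.
  move=> h; rewrite /t (co_sign _ _ _ _ _ _ h) // !ifF ?sgn0 ?mul1r //; lia.
have E_sign i w A : V A -> E (sgn R i w *: A) = E A.
  by move=> VA; case: (sgn_cases R i w) => ->; rewrite ?scale1r // scaleN1r E_even.
have dE_sign i w A Z : V A -> dE (sgn R i w *: A) (sgn R i z *: (sgn R i w *: Z)) =
    sgn R i z *: dE A Z.
  move=> VA; have VN : V (- A) by rewrite trmxN mulNmx mulmxN opprK.
  case: (sgn_cases R i w) => ->; case: (sgn_cases R i z) => ->;
    by rewrite ?scale1r ?scaleN1r ?opprK ?dE_oddl ?dE_oddr ?opprK.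
have sym_sign i w (A Z : mat) :
    symm_part (sgn R i w *: A) (sgn R i z *: (sgn R i w *: Z)) = sgn R i z *: symm_part A Z.
  case: (sgn_cases R i w) => ->; case: (sgn_cases R i z) => ->;
    by rewrite ?scale1r ?scaleN1r ?opprK ?symm_partNl ?symm_partNr ?opprK.
have zf_sign i (c s c' s' : nat -> R) : (forall l, c l ^+ 2 + s l ^+ 2 = 1) ->
    forest_change K tA tB i c s c' s' -> zf c' s' = [seq sgn R i z * v | v <- zf c s].
  move=> cs h; have [VA VB] := FV c s cs.
  rewrite /zf !map_cat -!map_comp /eqn (FAs i c s c' s' (chA _ _ _ _ _ h)).
  rewrite (FBs i c s c' s' (chB _ _ _ _ _ h)).
  rewrite (X_sign _ _ _ _ _ h) (Y_sign _ _ _ _ _ h) (t_sign _ _ _ _ _ h).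
  congr (_ ++ _ ++ _); apply: eq_map => p /=.
  - by rewrite !dE_sign // !E_sign // -scalerBr -scalerA -scalerDr mxE.
  - by rewrite sym_sign mxE.
  - by rewrite sym_sign mxE.
(* Beyond the end of [zf] the default value of [nth] gives the zero function, which has every class
   and pads the system to exactly [e] equations. *)
pose ex := xtra ++ [seq (z, fun c s => nth 0 (zf c s) j) | j <- iota 0 (e - size xtra)].
have size_ex : size ex = e by rewrite size_cat size_map size_iota subnKC //; lia.
have nth_ex j : (size xtra <= j < e)%N -> nth (0, fun _ _ => 0) ex j =
    (z, fun c s => nth 0 (zf c s) (j - size xtra)).
  case/andP=> jx je; rewrite nth_cat ltnNge jx /=.
  have jlt : (j - size xtra < e - size xtra)%N by rewrite ltn_sub2r // (leq_ltn_trans jx).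
  by rewrite (nth_map 0%N) ?size_iota // nth_iota.
have [| | |c [s [cs sol]]] := @solve R e K tA tB lA lB dime ex.
- exact: size_ex.
- move=> M M1; rewrite map_cat -map_comp (_ : map _ (iota _ _) = nseq (e - size xtra) z) ?J1 //.
  by rewrite -[in RHS](size_iota 0 (e - size xtra)); elim: (iota _ _) => //= ? r ->.
- move=> j je; case: (ltnP j (size xtra)) => jx.
    by rewrite nth_cat jx; exact: xP.
  rewrite nth_ex ?jx //=; split; last first.
    by move=> i c s c' s' cs h; rewrite (zf_sign i c s) // nth_map_mul.
  move=> T c s cs cc sc.
  have Xc : mx_continuous (fun x => X (c x) (s x)).
    move=> p q; rewrite (_ : (fun x => _) = fun x => nth 0 (co (c x) (s x)) (p * k + q)).
      exact: coords_continuous.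
    by apply/funext => u; rewrite mxE.
  have Yc : mx_continuous (fun x => Y (c x) (s x)).
    move=> p q; rewrite (_ : (fun x => _) = fun x => nth 0 (co (c x) (s x)) (K + (p * k + q))).
      exact: coords_continuous.
    by apply/funext => u; rewrite mxE.
  have tc : continuous (fun x => t (c x) (s x)) by exact: coords_continuous.
  have Ac : mx_continuous (fun x => FA (c x) (s x)) by move=> p q; exact: FAc.
  have Bc : mx_continuous (fun x => FB (c x) (s x)) by move=> p q; exact: FBc.
  have VA u : V (FA (c u) (s u)) by have [] := FV (c u) (s u) (cs u).
  have VB u : V (FB (c u) (s u)) by have [] := FV (c u) (s u) (cs u).
  have symc (A Z : T -> mat) : mx_continuous A -> mx_continuous Z ->
      mx_continuous (fun u => symm_part (A u) (Z u)).
    move=> ac zc p q; rewrite (_ : (fun u => _) =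
      fun u => ((A u)^T *m Z u) p q + ((Z u)^T *m A u) p q); last first.
      by apply/funext => u; rewrite mxE.
    have h1 : mx_continuous (fun u => (A u)^T *m Z u).
      by apply: mx_continuousM => //; exact: mx_continuous_tr.
    have h2 : mx_continuous (fun u => (Z u)^T *m A u).
      by apply: mx_continuousM => //; exact: mx_continuous_tr.
    by move=> u; apply: cvgD; [exact: h1|exact: h2].
  suff zfc : seq_continuous (fun u => zf (c u) (s u)) by exact: zfc.
  apply: (@seq_continuous_cat _ _ _ _ d) => [u||].
  - by rewrite size_map size_ord_enum.
  - apply: seq_continuous_map => p.
    rewrite (_ : (fun u => _) = fun u => dE (FA (c u) (s u)) (X (c u) (s u)) 0 p -
        dE (FB (c u) (s u)) (Y (c u) (s u)) 0 p +
        t (c u) (s u) * (E (FA (c u) (s u)) 0 p - E (FB (c u) (s u)) 0 p)); last first.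
      by apply/funext => u; rewrite !mxE.
    move=> u; apply: cvgD; first by apply: cvgB; exact: dE_cont.
    by apply: cvgM; [exact: tc|apply: cvgB; exact: E_cont].
  - apply: (@seq_continuous_cat _ _ _ _ (symdim k)) => [u||].
    + by rewrite size_map.
    + by apply: seq_continuous_map => p; exact: symc.
    + by apply: seq_continuous_map => p; exact: symc.
exists c, s; split=> //.
  by move=> j jx; have := sol j; rewrite nth_cat jx; apply; lia.
have zf0 j : nth 0 (zf c s) j = 0.
  case: (ltnP j (d + (symdim k).*2)) => jd; last by rewrite nth_default ?size_zf.
  have := sol (size xtra + j)%N; rewrite nth_ex /= ?addKn; last by lia.
  by apply; lia.
exists (X c s), (Y c s), (t c s); split.
- case: (eqVneq (X c s) 0) => [X0|]; last by constructor 1.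
  case: (eqVneq (Y c s) 0) => [Y0|]; last by constructor 2.
  case: (eqVneq (t c s) 0) => [t0|]; last by constructor 3.
  have := coords_norm tZ (nodes tA + nodes tB) cs; rewrite (big_nth 0) size_coords nodeZ.
  rewrite big_nat big1; first by move/eqP; rewrite eq_sym oner_eq0.
  move=> j /andP[_ j2]; suff -> : nth 0 (co c s) j = 0 by rewrite expr0n.
  have entry (Z : mat) o : Z = 0 -> (forall p q, Z p q = nth 0 (co c s) (o + (p * k + q))%N) ->
      (o <= j < o + K)%N -> nth 0 (co c s) j = 0.
    move=> Z0 hZ jo; have kgt0 : (0 < k)%N by rewrite /K in jo; nia.
    have pl : ((j - o) %/ k < n)%N by rewrite ltn_divLR // -/K; lia.
    have ql : ((j - o) %% k < k)%N by rewrite ltn_mod.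
    have := hZ (Ordinal pl) (Ordinal ql); rewrite Z0 mxE /= -divn_eq subnKC //.
    by case/andP: jo.
  case: (ltnP j K) => jK; first by apply: (entry (X c s) 0%N X0) => // p q; rewrite mxE.
  case: (ltnP j K.*2) => jK2.
    by apply: (entry (Y c s) K Y0) => [p q|]; [rewrite mxE|lia].
  by rewrite (_ : j = K.*2) //; lia.
- apply: symm_part_eq0 => p pk; have := zf0 (d + index p (sympairs k))%N.
  rewrite nth_cat size_map size_ord_enum ltnNge leq_addr /= addKn.
  by rewrite nth_cat size_map index_mem pk (nth_map p) ?index_mem // nth_index.
- apply: symm_part_eq0 => p pk; have := zf0 (d + (symdim k + index p (sympairs k)))%N.
  rewrite nth_cat size_map size_ord_enum ltnNge leq_addr /= addKn.
  rewrite nth_cat size_map ltnNge leq_addr /= addKn.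
  by rewrite (nth_map p) ?index_mem // nth_index.
- apply/rowP => j; rewrite [RHS]mxE; have := zf0 j.
  rewrite nth_cat size_map size_ord_enum ltn_ord (nth_map j) ?size_ord_enum //.
  by rewrite nth_ord_enum_id.
Qed.

End Coincidence.

Section StiefelCoincidence.
Variables (R : realType) (n k d m : nat).
Local Notation mat := 'M[R]_(n, k).
Local Notation V := (fun A : mat => A^T *m A = 1%:M).
Variables (E : mat -> 'rV[R]_d) (dE : mat -> mat -> 'rV[R]_d).
Hypothesis E_even : forall A, V A -> E (- A) = E A.
Hypothesis dE_oddl : forall A X, V A -> dE (- A) X = - dE A X.
Hypothesis dE_oddr : forall A X, V A -> dE A (- X) = - dE A X.
Hypothesis E_cont : forall (T : topologicalType) (A : T -> mat),
  (forall x, V (A x)) -> mx_continuous A -> mx_continuous (fun x => E (A x)).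
Hypothesis dE_cont : forall (T : topologicalType) (A X : T -> mat),
  (forall x, V (A x)) -> mx_continuous A -> mx_continuous X ->
  mx_continuous (fun x => dE (A x) (X x)).
Hypothesis dim_le : (d + (symdim k).*2 <= (n * k + m).*2)%N.
Hypothesis hcoef_m : hcoef (n * k) m = 1.

(** Let J be the complex structure of [col_rotated], so the first two columns of A and B are v, Jv
    and w, Jw. The equation says v = a Jw and Jv = a w; applying J to the first gives Jv = - a w, so
    v = 0, which is not a unit vector. *)
Lemma swap_neq (A B : mat) (i0 i1 : 'I_k) (a : R) : i0 = 0%N :> nat -> i1 = 1%N :> nat ->
  col_rotated A -> col_rotated B -> V A -> A = a *: (B *m perm_mx (tperm i0 i1)) -> False.
Proof.
move=> E0 E1 rA rB VA AB.
have A0 i : ent A i 0 = a * ent B i 1.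
  case: (ltnP i n) => ni; last by rewrite !ent_row_out ?mulr0.
  have := entE A (Ordinal ni) i0; have := entE B (Ordinal ni) i1.
  rewrite /= E0 E1 => -> ->; rewrite AB mxE -[tperm _ _]tpermV -col_permE mxE.
  by rewrite tpermL.
have A1 i : ent A i 1 = a * ent B i 0.
  case: (ltnP i n) => ni; last by rewrite !ent_row_out ?mulr0.
  have := entE A (Ordinal ni) i1; have := entE B (Ordinal ni) i0.
  rewrite /= E0 E1 => -> ->; rewrite AB mxE -[tperm _ _]tpermV -col_permE mxE.
  by rewrite tpermR.
have A00 i : ent A i 0 = 0.
  have := odd_double_half i; case: (odd i) => <- /=; rewrite ?add0n ?add1n.
    have := A0 (i./2).*2.+1; have := A1 (i./2).*2.
    by have [_ ->] := rA i./2; have [-> _] := rB i./2; lra.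
  have := A0 (i./2).*2; have := A1 (i./2).*2.+1.
  by have [-> _] := rA i./2; have [_ ->] := rB i./2; rewrite mulrN; lra.
have /matrixP/(_ i0 i0) := VA; rewrite !mxE eqxx big1 => [/eqP|i _].
  by rewrite eq_sym oner_eq0.
by rewrite !mxE -(entE A) E0 A00 mul0r.
Qed.

(** The same family is used over two spheres of dimension m, at different nodes, so the value of the
    word is the square of [hcoef (n * k) m]. *)
Lemma coincidence_swap : (1 < k <= n)%N ->
  (forall j, (n - k < j <= m)%N -> ~~ odd 'C(n, j)) ->
  exists A B : mat, [/\ V A, V B, A <> B, A <> - B & coincidence E dE A B].
Proof.
case/andP=> k1 kn Cn; set K := (n * k)%N.
pose e := (m + m + K.*2)%N.
have mpw : (m < pw m)%N by rewrite pwE ltn_expl.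
have [F [Fo Fs Fc Fr]] : framable R e m m n k.
  by apply: framable_exists => //; apply/andP; split; [exact: ltnW|].
pose i0 : 'I_k := Ordinal (ltnW k1); pose i1 : 'I_k := Ordinal k1.
pose P : 'M[R]_k := perm_mx (tperm i0 i1).
pose t := tau e m m; have tm : nodes t = m by exact: nodes_tau.
have lt0 : leaf_all (fun w : class e => w = 0) t by exact: leaf_all_tau.
have dime : (nodes t + nodes t + K.*2)%N = e by rewrite tm.
have PP : P^T *m P = 1%:M by rewrite tr_perm_mx -perm_mxM mulVg perm_mx1.
have [|c s cs|i j T c s cs cc sc|i j T c s cs cc sc| | | | | |c [s [cs _ co]]] :=
  @coincidence_exists R n k d E dE E_even dE_oddl dE_oddr E_cont dE_cont e t t
   (F 0%N) (fun c s => F (nodes t) c s *m P) [::] lt0 lt0.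
- exact: dime.
- split; first exact: Fo.
  by rewrite trmx_mul -mulmxA (mulmxA _ _ P) Fo // mul1mx PP.
- exact: Fc.
- by apply: (mx_continuousM (f := fun x => F (nodes t) (c x) (s x)) (g := fun=> P));
    [exact: Fc|exact: mx_continuous_cst].
- by move=> i c s c' s' h; rewrite (Fs i 0%N c s c' s' h).
- by move=> i c s c' s' h; rewrite (Fs i _ c s c' s' h) scalemxAl.
- by [].
- by rewrite /= addn0; apply: leq_trans dim_le _; rewrite /e /K; lia.
- move=> M M1; rewrite /= subn0.
  have := @ev_power_z e K t t lt0 lt0 dime M M1 e (esym dime).
  by rewrite tm hcoef_m mulr1; apply; rewrite ?size_nseq.
have [VA VB] : V (F 0%N c s) /\ V (F (nodes t) c s) by split; exact: Fo.
exists (F 0%N c s), (F (nodes t) c s *m P); split=> //.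
- by rewrite trmx_mul -mulmxA (mulmxA _ _ P) Fo // mul1mx PP.
- move=> AB; apply: (@swap_neq _ _ i0 i1 1 _ _ (Fr k1 _ _ _) (Fr k1 _ _ _) VA) => //.
  by rewrite scale1r; exact: AB.
- move=> AB; apply: (@swap_neq _ _ i0 i1 (-1) _ _ (Fr k1 _ _ _) (Fr k1 _ _ _) VA) => //.
  by rewrite scaleN1r; exact: AB.
Qed.

(** With one column there is nothing to interchange. The sphere of B gets dimension m + 1, and the
    additional angle pays for the equation of orthogonality. The value is the square of [hcoef K m],
    plus, for m > 0, [hcoef K m.-1] times [hcoef K m.+1], which the last hypothesis makes zero. *)
Lemma coincidence_orthogonal : k = 1%N -> (m.+1 < n)%N ->
  (m = 0%N \/ hcoef (n * k) m.+1 = 0) ->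
  exists A B : mat, [/\ V A, V B, A <> B, A <> - B & coincidence E dE A B].
Proof.
move=> kE mn hm; set K := (n * k)%N in hm *.
pose e := (m + m.+1 + K.*2)%N.
pose tA : btree (class e) := comb (nseq m 0) 0.
pose tB : btree (class e) := comb (nseq m.+1 0) 0.
have nA : nodes tA = m by rewrite nodes_comb size_nseq.
have nB : nodes tB = m.+1 by rewrite nodes_comb size_nseq.
have lv q j : nth (0 : class e) (rcons (nseq q 0) 0) j = 0.
  by rewrite nth_rcons nth_nseq; case: ifP; case: ifP.
have lA : leaf_all (fun w : class e => w = 0) tA.
  by apply: leaf_all_comb => // v; rewrite mem_nseq => /andP[_ /eqP].
have lB : leaf_all (fun w : class e => w = 0) tB.
  by apply: leaf_all_comb => // v; rewrite mem_nseq => /andP[_ /eqP].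
have dime : (nodes tA + nodes tB + K.*2)%N = e by rewrite nA nB.
pose FA c s : mat := \matrix_(i, j) nth 0 (coords tA 0 c s) i.
pose FB c s : mat := \matrix_(i, j) nth 0 (coords tB (nodes tA) c s) i.
have kj (j j' : 'I_k) : j = j'.
  have jl (i : 'I_k) := leq_trans (ltn_ord i) (eq_leq kE).
  by apply/val_inj => /=; have := jl j; have := jl j'; lia.
have VF (t : btree (class e)) o c s : (nodes t < n)%N -> (forall l, c l ^+ 2 + s l ^+ 2 = 1) ->
    \sum_(i < n) nth 0 (coords t o c s) i ^+ 2 = 1 :> R.
  move=> tn cs; have := coords_norm t o cs; rewrite (big_nth 0) size_coords big_mkord.
  rewrite (big_ord_widen n (fun i => nth 0 (coords t o c s) i ^+ 2)) // => <-.
  rewrite [RHS]big_mkcond /=; apply: eq_bigr => i _; case: ifP => // it.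
  by rewrite nth_default ?expr0n // size_coords leqNgt it.
have VA c s : (forall l, c l ^+ 2 + s l ^+ 2 = 1) -> V (FA c s).
  move=> cs; apply/matrixP => i j; rewrite !mxE (kj i j) eqxx /=.
  by rewrite -[RHS](VF tA 0%N c s) ?nA //; [apply: eq_bigr => l _; rewrite !mxE|lia].
have VB c s : (forall l, c l ^+ 2 + s l ^+ 2 = 1) -> V (FB c s).
  move=> cs; apply/matrixP => i j; rewrite !mxE (kj i j) eqxx /=.
  by rewrite -[RHS](VF tB (nodes tA) c s) ?nB //; apply: eq_bigr => l _; rewrite !mxE.
have FAc i j : cs_continuous (fun c s => FA c s i j).
  move=> T c s cs cc sc.
  rewrite (_ : (fun x => _) = fun x => nth 0 (coords tA 0 (c x) (s x)) i).
    exact: coords_continuous.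
  by apply/funext => x; rewrite mxE.
have FBc i j : cs_continuous (fun c s => FB c s i j).
  move=> T c s cs cc sc.
  rewrite (_ : (fun x => _) = fun x => nth 0 (coords tB (nodes tA) (c x) (s x)) i).
    exact: coords_continuous.
  by apply/funext => x; rewrite mxE.
have FAs i c s c' s' : sign_change i tA 0 c s c' s' ->
    FA c' s' = sgn R i (class_x tA) *: FA c s.
  move=> h; apply/matrixP => p q; rewrite !mxE; case: (ltnP p (nodes tA).+1) => pt.
    by rewrite (coords_sign h) // leaves_comb lv addr0.
  by rewrite !nth_default ?mulr0 // size_coords.
have FBs i c s c' s' : sign_change i tB (nodes tA) c s c' s' ->
    FB c' s' = sgn R i (class_y tA tB) *: FB c s.
  move=> h; apply/matrixP => p q; rewrite !mxE; case: (ltnP p (nodes tB).+1) => pt.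
    by rewrite (coords_sign h) // leaves_comb lv addr0.
  by rewrite !nth_default ?mulr0 // size_coords.
pose j0 : 'I_k := cast_ord (esym kE) ord0.
pose dot c s := \sum_(i < n) FA c s i j0 * FB c s i j0.
have chA i c s c' s' : forest_change K tA tB i c s c' s' -> sign_change (R := R) i tA 0 c s c' s'.
  have [le Se] := tree_in_A dime (isT : (1 < 2)%N).
  by move=> h l lo; have [|-> ->] := h l; [by case/andP: lo => _ /leq_trans; apply|rewrite Se].
have chB i c s c' s' : forest_change K tA tB i c s c' s' ->
    sign_change (R := R) i tB (nodes tA) c s c' s'.
  have [le Se] := tree_in_B dime (isT : (1 < 2)%N).
  by move=> h l lo; have [|-> ->] := h l; [by case/andP: lo => _ /leq_trans; apply|rewrite Se].
have [|c s cs| | | | |[|[]] // _| | |c [s [cs dot0 co]]] :=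
  @coincidence_exists R n k d E dE E_even dE_oddl dE_oddr E_cont dE_cont e tA tB
   FA FB [:: (class_x tA + class_y tA tB, dot)] lA lB.
- exact: dime.
- by split; [exact: VA|exact: VB].
- exact: FAc.
- exact: FBc.
- exact: FAs.
- exact: FBs.
- split=> /=.
    move=> T c s cs cc sc; apply: continuous_sum => i _ x.
    by apply: cvgM; [exact: FAc|exact: FBc].
  move=> i c s c' s' cs h; rewrite /dot mulr_sumr; apply: eq_bigr => l _.
  rewrite (FAs i c s c' s' (chA _ _ _ _ _ h)) (FBs i c s c' s' (chB _ _ _ _ _ h)) !mxE sgnD.
  by rewrite mulrACA.
- by rewrite /= addn1; apply: leq_ltn_trans dim_le _; rewrite /e /K; lia.
- move=> M M1; rewrite /= subn1.
  have e0 : (0 < e)%N by rewrite /e; lia.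
  have b0 : (0 < nodes tB)%N by rewrite nB.
  have H := @ev_power_z_xy e K tA tB lA lB dime M M1 e.-1.
  rewrite (prednK e0) dime in H; have {H} := H erefl b0.
  move=> /(_ _ _ (perm_refl _)) ->; last by rewrite /= size_nseq prednK.
  rewrite nA nB -[m.+1.-1]/m hcoef_m mulr1.
  case: hm => [->|hm]; first by rewrite add0r.
  by case: (m) hm => [|m'] hm; rewrite ?hm ?mulr0 add0r.
have d0 := dot0 0%N isT; rewrite /= /dot in d0.
have AA : \sum_(i < n) FA c s i j0 * FA c s i j0 = 1.
  have /matrixP/(_ j0 j0) := VA c s cs; rewrite !mxE eqxx /= => h.
  by rewrite -[RHS]h; apply: eq_bigr => i _; rewrite [in RHS]mxE.
exists (FA c s), (FB c s); split=> //; [exact: VA|exact: VB| |].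
- move=> AB; move: d0; rewrite -AB AA => /eqP; by rewrite oner_eq0.
- move=> AB; move: d0.
  rewrite (_ : \sum_(i < n) _ = - \sum_(i < n) FA c s i j0 * FA c s i j0).
    by rewrite AA => /eqP; rewrite oppr_eq0 oner_eq0.
  rewrite -sumrN; apply: eq_bigr => i _; rewrite -mulrN; congr (_ * _).
  have oppE (A : mat) : (- A) i j0 = - A i j0 by rewrite mxE.
  by rewrite AB oppE opprK.
Qed.

End StiefelCoincidence.

(** * Smooth functions *)

Section SmoothCalculus.
Variables (R : realType) (V : normedModType R).
Implicit Types (f g : V -> R) (U W : set V).

Lemma differentiable_approx f (L : {linear V -> R}) x : continuous L ->
  (forall eps, 0 < eps -> \forall h \near 0, `|f (h + x) - f x - L h| <= eps * `|h|) ->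
  differentiable f x /\ 'd f x = L :> (V -> R).
Proof.
move=> Lc H.
have E : f \o shift x = cst (f x) + (L : V -> R) +o_ 0 id.
  apply/eqaddoP => eps e0; apply: filterS (H _ e0) => h /=.
  by rewrite !fctE opprD addrA.
have D := diff_unique Lc E; split=> //.
by apply/diff_locallyP; rewrite D.
Qed.

Lemma differentiable_error f x : differentiable f x -> forall eps, 0 < eps ->
  \forall h \near 0, `|f (h + x) - f x - 'd f x h| <= eps * `|h|.
Proof.
move=> /diff_locallyP[_ /eqaddoP H] eps e0; apply: filterS (H _ e0) => h /=.
by rewrite !fctE opprD addrA.
Qed.

Lemma near_eq_differentiable f g x : {near x, f =1 g} ->
  differentiable f x -> differentiable g x.
Proof.
move=> fg df; have gf := nbhs_singleton fg.
apply: (proj1 (@differentiable_approx _ ('d f x) _ _ _)) => [|eps e0].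
  exact: diff_continuous.
have fg' : \forall h \near 0, f (h + x) = g (h + x).
  move/nbhs_ballP: fg => [d d0 hd]; apply/nbhs_ballP; exists d => // h.
  rewrite -!ball_normE /= => hh; apply: hd; rewrite -ball_normE /=.
  by move: hh; rewrite sub0r normrN [h + x]addrC opprD addrA subrr sub0r normrN.
apply: filterS2 fg' (differentiable_error df e0) => h.
by move=> <-; rewrite -gf.
Qed.

Lemma open_near_eq W f g x : open W -> W x -> {in W, f =1 g} -> {near x, f =1 g}.
Proof.
move=> Wo Wx fg; have : \forall y \near x, W y by exact: open_nbhs_nbhs.
by apply: filterS => y Wy; apply: fg; rewrite inE.
Qed.

Lemma cont_diffS r U f : cont_diff r.+1 U f -> cont_diff r U f.
Proof.
elim: r f => [|r IH] f [df Df]; first by move=> x Ux; exact/differentiable_continuous/df.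
by split=> // v; apply: IH; exact: Df.
Qed.

Lemma cont_diff_eq r U W f g : open W -> W `<=` U -> {in W, f =1 g} ->
  cont_diff r U f -> cont_diff r W g.
Proof.
elim: r f g => [|r IH] f g Wo WU fg /=.
  move=> fc x Wx; have fx := fc x (WU x Wx).
  rewrite /prop_for /continuous_at -(fg x) ?inE //; apply: cvg_trans fx.
  by apply: near_eq_cvg; exact: open_near_eq Wo Wx _.
move=> [df Df]; split.
  by move=> x Wx; apply: near_eq_differentiable (df x (WU x Wx)); exact: open_near_eq Wo Wx _.
move=> v; apply: IH (Df v) => // x /set_mem Wx.
by apply: near_eq_derive; exact: open_near_eq Wo Wx _.
Qed.

Lemma cont_diff_local r U f :
  (forall x, U x -> exists W, [/\ open W, W x & cont_diff r W f]) -> cont_diff r U f.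
Proof.
elim: r f => [|r IH] f H /=.
  by move=> x /H[W [_ Wx h]]; exact: h.
split=> [x /H[W [_ Wx [df _]]]|v]; first exact: df.
by apply: IH => x /H[W [Wo Wx [_ Df]]]; exists W; split=> //; exact: Df.
Qed.

Lemma cont_diff_cst r U a : cont_diff r U (fun=> a).
Proof.
elim: r a => [|r IH] a /=; first by move=> x _; exact: cst_continuous.
split=> [x _|v]; first exact: differentiable_cst.
by rewrite (_ : 'D_v _ = fun=> 0) //; apply/funext => x; rewrite derive_cst.
Qed.

Lemma cont_diffD r U f g : open U -> cont_diff r U f -> cont_diff r U g ->
  cont_diff r U (fun x => f x + g x).
Proof.
move=> Uo; elim: r f g => [|r IH] f g /=.
  by move=> fc gc x Ux; apply: continuousD; [exact: fc|exact: gc].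
move=> [df Df] [dg Dg]; split=> [x Ux|v].
  by apply: differentiableD; [exact: df|exact: dg].
apply: (@cont_diff_eq _ U U (fun x => 'D_v f x + 'D_v g x)) => //.
  move=> x /set_mem Ux.
  by rewrite -deriveD //; apply: diff_derivable; [exact: df|exact: dg].
by apply: IH.
Qed.

Lemma cont_diffM r U f g : open U -> cont_diff r U f -> cont_diff r U g ->
  cont_diff r U (fun x => f x * g x).
Proof.
move=> Uo; elim: r f g => [|r IH] f g /=.
  by move=> fc gc x Ux; apply: continuousM; [exact: fc|exact: gc].
move=> [df Df] [dg Dg]; split=> [x Ux|v].
  by apply: differentiableM; [exact: df|exact: dg].
apply: (@cont_diff_eq _ U U (fun x => f x * 'D_v g x + g x * 'D_v f x)) => //.
  move=> x /set_mem Ux.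
  by apply/esym; apply: deriveM; apply: diff_derivable; [exact: df|exact: dg].
by apply: cont_diffD => //; apply: IH => //; apply: cont_diffS.
Qed.

Lemma smooth_fun_eq U W f g : open W -> W `<=` U -> {in W, f =1 g} ->
  smooth_fun U f -> smooth_fun W g.
Proof. by move=> Wo WU fg sf r; exact: cont_diff_eq (sf r). Qed.

Lemma smooth_funW U W f : open W -> W `<=` U -> smooth_fun U f -> smooth_fun W f.
Proof. by move=> Wo WU; exact: smooth_fun_eq. Qed.

Lemma smooth_fun_local U f :
  (forall x, U x -> exists W, [/\ open W, W x & smooth_fun W f]) -> smooth_fun U f.
Proof.
move=> H r; apply: cont_diff_local => x /H[W [Wo Wx sf]]; exists W.
by split=> //; exact: sf.
Qed.

Lemma smooth_fun_cst U a : smooth_fun U (fun=> a).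
Proof. by move=> r; exact: cont_diff_cst. Qed.

Lemma smooth_funD U f g : open U -> smooth_fun U f -> smooth_fun U g ->
  smooth_fun U (fun x => f x + g x).
Proof. by move=> Uo sf sg r; exact: cont_diffD. Qed.

Lemma smooth_funM U f g : open U -> smooth_fun U f -> smooth_fun U g ->
  smooth_fun U (fun x => f x * g x).
Proof. by move=> Uo sf sg r; exact: cont_diffM. Qed.

Lemma smooth_fun_sum U I (s : seq I) (F : I -> V -> R) : open U ->
  (forall i, smooth_fun U (F i)) -> smooth_fun U (fun x => \sum_(i <- s) F i x).
Proof.
move=> Uo sF; elim: s => [|i s IH].
  by rewrite (_ : (fun _ => _) = fun=> 0); [exact: smooth_fun_cst|apply/funext => x; rewrite big_nil].
rewrite (_ : (fun _ => _) = fun x => F i x + \sum_(j <- s) F j x); last first.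
  by apply/funext => x; rewrite big_cons.
exact: smooth_funD.
Qed.

Lemma smooth_fun_diff U f x : smooth_fun U f -> U x -> differentiable f x.
Proof. by move=> /(_ 1%N)[df _]; exact: df. Qed.

Lemma smooth_fun_derive U f v : smooth_fun U f -> smooth_fun U ('D_v f).
Proof. by move=> sf r; case: (sf r.+1) => _; exact. Qed.

Lemma smooth_fun_continuous U f x : smooth_fun U f -> U x -> {for x, continuous f}.
Proof. by move=> /(_ 0%N); exact. Qed.

Lemma smooth_fun_linear U (L : {linear V -> R}) : continuous L -> smooth_fun U L.
Proof.
move=> Lc; case=> [|r] /=; first by move=> x _; exact: Lc.
split=> [x _|v]; first exact: linear_differentiable.
rewrite (_ : 'D_v L = fun=> L v); first exact: cont_diff_cst.
apply/funext => x; rewrite deriveE; last exact: linear_differentiable.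
by rewrite diff_lin.
Qed.

End SmoothCalculus.

Section SmoothComposition.
Variables (R : realType) (V : normedModType R).

Lemma derive_affine (V' : normedModType R) (f : V -> R) (L : {linear V' -> V}) (a : V) v x :
  'D_v (fun y => f (L y + a)) x = 'D_(L v) f (L x + a).
Proof.
rewrite /derive (_ : (fun h => _) = fun h => h^-1 *: ((f \o shift (L x + a)) (h *: L v) - f (L x + a))) //.
by apply/funext => h /=; rewrite (linearD L) (linearZZ L) addrA.
Qed.

Lemma smooth_fun_affine (V' : normedModType R) (U : set V) (f : V -> R)
    (L : {linear V' -> V}) (a : V) : continuous L -> smooth_fun U f ->
  smooth_fun ((fun y => L y + a) @^-1` U) (fun y => f (L y + a)).
Proof.
move=> Lc sf r; move: (sf r); elim: r f {sf} => [|r IH] f /=.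
  move=> fc y Uy; apply: (@continuous_comp _ _ _ (fun y => L y + a) f); last exact: fc.
  by apply: continuousD; [exact: Lc|exact: cst_continuous].
move=> [df Df]; split=> [y Uy|v].
  apply: (@differentiable_comp _ _ _ _ (fun y => L y + a) f); last exact: df.
  by apply: differentiableD; [exact: linear_differentiable|exact: differentiable_cst].
rewrite (_ : 'D_v _ = fun y => 'D_(L v) f (L y + a)); last first.
  by apply/funext => y; exact: derive_affine.
by apply: (IH ('D_(L v) f)); exact: Df.
Qed.

End SmoothComposition.

Section SmoothMatrix.
Variables (R : realType) (n k : nat).
Local Notation mat := 'M[R]_(n, k).

Lemma smooth_fun_coord (U : set mat) i j : smooth_fun U (fun A : mat => A i j).
Proof.
have @f : {linear mat -> R}.
  by exists (fun N : mat => N i j); do 2![eexists]; do ?[constructor];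
     rewrite ?mxE// => ? *; rewrite ?mxE//; move=> ?; rewrite !mxE.
rewrite (_ : (fun _ => _) = f) //; apply: smooth_fun_linear; exact: coord_continuous.
Qed.

Lemma derive_coord (A X : mat) i j : 'D_X (fun B : mat => B i j) A = X i j.
Proof.
have @f : {linear mat -> R}.
  by exists (fun N : mat => N i j); do 2![eexists]; do ?[constructor];
     rewrite ?mxE// => ? *; rewrite ?mxE//; move=> ?; rewrite !mxE.
have fc : continuous f by exact: coord_continuous.
rewrite (_ : (fun _ => _) = f) // deriveE; last exact: linear_differentiable.
by rewrite diff_lin.
Qed.

Lemma derive_delta (f : mat -> R) A X : differentiable f A ->
  'D_X f A = \sum_i \sum_j X i j * 'D_(delta_mx i j) f A.
Proof.
move=> df; rewrite deriveE // {1}(matrix_sum_delta X) linear_sum; apply: eq_bigr => i _.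
rewrite linear_sum; apply: eq_bigr => j _.
by rewrite linearZ deriveE.
Qed.

End SmoothMatrix.

(** * Tangent vectors of the projective Stiefel manifold *)

Section Cayley.
Variables (R : realType) (n k : nat).
Local Notation mat := 'M[R]_(n, k).

Lemma cvg_mx (T : Type) (F : set_system T) (f : T -> mat) (A : mat) : Filter F ->
  (forall i j, f x i j @[x --> F] --> A i j) -> f @ F --> A.
Proof.
move=> FF fA; apply/cvg_ballP => eps e0.
have H : \forall x \near F, forall ij : 'I_n * 'I_k, ball (A ij.1 ij.2) eps (f x ij.1 ij.2).
  by apply: filter_forall => ij; move/cvg_ballP: (fA ij.1 ij.2); exact.
by apply: filterS H => x H; split=> // i j; exact: (H (i, j)).
Qed.

Lemma mx_continuousE (T : topologicalType) (f : T -> mat) :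
  mx_continuous f -> continuous f.
Proof. by move=> fc x; apply: cvg_mx => i j; exact: fc. Qed.

Lemma stiefel_entry_le (A : mat) i j : A^T *m A = 1%:M -> `|A i j| <= 1.
Proof.
move=> /matrixP/(_ j j); rewrite !mxE eqxx /= => AA.
rewrite -(@ler_pXn2r _ 2) ?nnegrE // expr1n real_normK ?num_real //.
rewrite -[leRHS]AA (bigD1 i) //= mxE -expr2 lerDl; apply: sumr_ge0 => l _.
by rewrite mxE -expr2 sqr_ge0.
Qed.

(** If u = a u W, pairing with u gives u u^T = a u W u^T = 0, since W is skew-symmetric. *)
Lemma skew_unitmx (W : 'M[R]_n) a : W^T = - W -> 1%:M - a *: W \in unitmx.
Proof.
move=> WT; rewrite -row_free_unit; apply: inj_row_free => u.
rewrite mulmxBr mulmx1 -scalemxAr => /eqP; rewrite subr_eq0 => /eqP uE.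
have uW : (u *m W *m u^T) 0 0 = 0.
  have : (u *m W *m u^T)^T = - (u *m W *m u^T).
    by rewrite !trmx_mul trmxK WT mulNmx mulmxN mulmxA.
  by move=> /matrixP/(_ 0 0); rewrite [LHS]mxE [RHS]mxE; lra.
have : (u *m u^T) 0 0 = 0 by rewrite {1}uE -scalemxAl mxE uW mulr0.
rewrite mxE => /eqP; rewrite psumr_eq0 => [/allP h|i _]; last by rewrite mxE -expr2 sqr_ge0.
apply/rowP => i; rewrite [RHS]mxE; have := h i (mem_index_enum i).
by rewrite mxE -expr2 sqrf_eq0 => /eqP.
Qed.

Lemma cvg_mul_bounded (f : R -> R) (C : R) : (forall h, `|f h| <= C) ->
  (h * f h) @[h --> 0^'] --> (0 : R).
Proof.
move=> fC; have C0 : 0 <= C by apply: le_trans (fC 0).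
apply/cvgr0Pnorm_lt => eps e0; near=> h.
rewrite normrM; apply: le_lt_trans (ler_wpM2l (normr_ge0 _) (fC h)) _.
apply: (@le_lt_trans _ _ (`|h| * (C + 1))).
  by rewrite ler_wpM2l // lerDl.
rewrite -ltr_pdivlMr; last by rewrite ltr_wpDl.
near: h; apply: dnbhs0_lt; rewrite divr_gt0 // ltr_wpDl //.
Unshelve. all: by end_near. Qed.

(* The Cayley transform [h |-> (1 - h W / 2)^-1 (1 + h W / 2) A] of a skew-symmetric
   matrix [W] with [W A = X]. *)
Lemma stiefel_curve (A X : mat) : A^T *m A = 1%:M -> symm_part A X = 0 ->
  exists g : R -> mat, [/\ forall h, (g h)^T *m g h = 1%:M, g 0 = A & is_derive (0 : R) (1 : R) g X].
Proof.
move=> AA AX; have XA : A^T *m X = - (X^T *m A) by apply/eqP; rewrite -addr_eq0 -/(symm_part A X) AX.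
(* The third term cancels A X^T A in W A, leaving X. It is skew-symmetric because X^T A is, which is
   the tangency of X. *)
pose W := X *m A^T - A *m X^T + A *m (X^T *m A) *m A^T.
have WT : W^T = - W.
  rewrite /W !linearD /= !trmxN !trmx_mul !trmxK XA mulNmx mulmxN.
  by rewrite ?opprD ?opprK ?mulmxA [A *m X^T - _]addrC.
have WA : W *m A = X.
  rewrite /W !mulmxDl mulNmx -!mulmxA AA mulmx1 [A *m (_ *m (_ *m 1%:M))]mulmxA mulmx1.
  by rewrite !mulmxA addrNK.
pose P h := 1%:M - (h / 2) *: W; pose Q h := 1%:M + (h / 2) *: W.
have PQ h : P h *m Q h = Q h *m P h.
  rewrite /P /Q; set Z := _ *: W; rewrite mulmxBl mul1mx mulmxDr mulmx1 mulmxDl mul1mx.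
  by rewrite mulmxBr mulmx1 opprD !addrA addrK addrNK.
have PT h : (P h)^T = Q h by rewrite /P /Q linearB /= linearZ /= trmx1 WT scalerN opprK.
have QT h : (Q h)^T = P h by rewrite -PT trmxK.
have Pu h : P h \in unitmx by exact: skew_unitmx.
have Qu h : Q h \in unitmx by rewrite -PT unitmx_tr.
pose g h := invmx (P h) *m Q h *m A.
have gV h : (g h)^T *m g h = 1%:M.
  rewrite /g !trmx_mul trmx_inv PT QT -!mulmxA.
  have -> : invmx (P h) *m (Q h *m A) = Q h *m (invmx (P h) *m A).
    rewrite !mulmxA; congr (_ *m A); apply: (can_inj (mulKmx (Pu h))).
    by rewrite !mulmxA mulmxV // mul1mx PQ mulmxK.
  by rewrite (mulmxA (invmx (Q h))) mulVmx // mul1mx (mulmxA (P h)) mulmxV // mul1mx AA.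
have g0 : g 0 = A.
  by rewrite /g /P /Q mul0r scale0r subr0 addr0 invmx1 !mul1mx.
have gE h : g h - A = (h / 2) *: (W *m (g h + A)).
  have : P h *m g h = Q h *m A by rewrite /g !mulmxA mulmxV // mul1mx.
  rewrite /P /Q mulmxBl mulmxDl !mul1mx -!scalemxAl mulmxDr scalerDr => /eqP.
  rewrite subr_eq => /eqP {1}->.
  by rewrite -[A + _ + _]addrA addrAC subrr add0r addrC.
(* Inserting [gE] into itself isolates the limit X; the error is h times a bounded matrix, as
   entries of frames are at most 1 in absolute value. *)
have quot h : h != 0 -> h^-1 *: (g h - A) = X + h *: (4^-1 *: (W *m W *m (g h + A))).
  move=> h0; rewrite gE scalerA mulrA mulVf // mul1r.
  have D : g h + A = 2 *: A + (g h - A) by rewrite scaler_nat mulr2n addrAC addrA addrNK addrC.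
  rewrite [in LHS]D [in LHS]gE mulmxDr scalerDr -!scalemxAr WA !scalerA mulVf ?pnatr_eq0 // scale1r.
  congr (_ + _); rewrite -mulmxA; congr (_ *: _); by field.
exists g; split=> //.
have lim : h^-1 *: ((g \o shift 0) (h *: 1) - g 0) @[h --> 0^'] --> X.
  apply: cvg_mx => i j; rewrite g0.
  have : (X i j + h * (4^-1 *: (W *m W *m (g h + A))) i j) @[h --> 0^'] --> X i j + 0.
    apply: cvgD; first exact: cvg_cst.
    apply: (@cvg_mul_bounded _ (4^-1 * \sum_l (`|(W *m W) i l| * 2))) => h.
    rewrite mxE normrM ger0_norm // ler_wpM2l // mxE.
    apply: le_trans (ler_norm_sum _ _ _) _; apply: ler_sum => l _.
    rewrite normrM ler_wpM2l // mxE; apply: le_trans (ler_normD _ _) _.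
    by apply: lerD; exact: stiefel_entry_le.
  rewrite addr0; apply: cvg_trans; apply: near_eq_cvg; near=> h.
  rewrite /= addr0 [h%:A]mulr1 quot; first by rewrite [RHS]mxE [in RHS]mxE.
  by near: h; exact: nbhs_dnbhs_neq.
apply: DeriveDef; first by apply/cvg_ex; exists X.
exact: cvg_lim lim.
Unshelve. all: by end_near. Qed.

(** Both derivatives can be computed along the curve of frames with velocity X, on which the two
    functions agree. *)
Lemma tangent_unique (A X : mat) (W : set mat) (G1 G2 : mat -> R) :
  A^T *m A = 1%:M -> symm_part A X = 0 -> open W -> W A ->
  differentiable G1 A -> differentiable G2 A ->
  (forall B : mat, B^T *m B = 1%:M -> W B -> G1 B = G2 B) ->
  'D_X G1 A = 'D_X G2 A.
Proof.
move=> AA AX Wo WA d1 d2 G12; have [g [gV g0 dg]] := stiefel_curve AA AX.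
have gd : differentiable g 0 by apply/derivable1_diffP; exact: ex_derive.
have E (G : mat -> R) : differentiable G A -> 'D_X G A = 'D_1 (G \o g) 0.
  move=> dG; have dG' : differentiable G (g 0) by rewrite g0.
  rewrite deriveE // deriveE; last exact: differentiable_comp.
  have -> : 'd (G \o g) (0 : R) = 'd G (g 0) \o 'd g (0 : R) :> (R -> R) by exact: diff_comp.
  have -> : ('d G (g 0) \o 'd g (0 : R)) 1 = 'd G (g 0) ('d g (0 : R) 1) by [].
  have -> : 'd g (0 : R) 1 = X by rewrite -deriveE //; exact: derive_val.
  by rewrite g0.
rewrite !E //; apply: near_eq_derive.
have := differentiable_continuous gd; rewrite /= => gc.
have : \forall h \near 0, W (g h) by apply: gc; rewrite g0; exact: open_nbhs_nbhs.
by apply: filterS => h Wh /=; apply: G12.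
Qed.

End Cayley.

(** * Smooth functions and tangent vectors on the quotient *)

Section Quotient.
Variables (R : realType) (n k : nat).
Local Notation mat := 'M[R]_(n, k).
Local Notation PV := (projective_stiefel R n k).

Definition prs (A : @stiefel_set R n k) : PV :=
  (\pi_(quotient_topology {eq_quot @sign_equiv R n k}) A)%qT.

Lemma prs_eq A B : prs A = prs B <-> set_val B = set_val A \/ set_val B = - set_val A.
Proof.
have P : reflect (prs A = prs B) (sign_rel A B) := @eqmodP _ (@sign_equiv R n k) A B.
split; first by move=> /P /orP[] /eqP ->; [left|right].
by move=> h; apply/P/orP; case: h => h; [left|right]; apply/eqP.
Qed.

Lemma prs_surj (p : PV) : exists A, prs A = p.
Proof. by exists (repr p); exact: reprK. Qed.

Lemma stiefel_valP (A : @stiefel_set R n k) : (set_val A)^T *m set_val A = 1%:M.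
Proof. exact: set_mem (valP A). Qed.

Definition mkst (A : mat) (h : A^T *m A = 1%:M) : @stiefel_set R n k :=
  SigSub (mem_set h).

Definition local_ext (f : PV -> R) (A : mat) (G : mat -> R) :=
  exists W : set mat, [/\ open W, W A, smooth_fun W G &
    forall y : @stiefel_set R n k, W (set_val y) -> f (prs y) = G (set_val y)].

Lemma smooth_onP (f : PV -> R) : smooth_on setT f <->
  forall A : @stiefel_set R n k, exists G, local_ext f (set_val A) G.
Proof.
split=> [sf A|H pr A _].
  have [W [G [Wo WA sG fG]]] := sf A I; exists G, W; split=> // y Wy; exact: fG.
have [G [W [Wo WA sG fG]]] := H A; exists W, G; split=> // y _ Wy; exact: fG.
Qed.

Lemma local_extD f g A F G : local_ext f A F -> local_ext g A G ->
  local_ext (fun x => f x + g x) A (fun B => F B + G B).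
Proof.
move=> [W [Wo WA sF fF]] [W' [Wo' WA' sG gG]]; exists (W `&` W'); split=> //.
- exact: openI.
- apply: smooth_funD; first exact: openI.
    by apply: smooth_funW sF; [exact: openI|move=> x []].
  by apply: smooth_funW sG; [exact: openI|move=> x []].
- by move=> y [Wy Wy']; rewrite fF // gG.
Qed.

Lemma local_extM f g A F G : local_ext f A F -> local_ext g A G ->
  local_ext (fun x => f x * g x) A (fun B => F B * G B).
Proof.
move=> [W [Wo WA sF fF]] [W' [Wo' WA' sG gG]]; exists (W `&` W'); split=> //.
- exact: openI.
- apply: smooth_funM; first exact: openI.
    by apply: smooth_funW sF; [exact: openI|move=> x []].
  by apply: smooth_funW sG; [exact: openI|move=> x []].
- by move=> y [Wy Wy']; rewrite fF // gG.
Qed.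

Lemma local_ext_cst a A : local_ext (fun=> a) A (fun=> a).
Proof. by exists setT; split=> //; [exact: openT|exact: smooth_fun_cst]. Qed.

Lemma smooth_onT_cst a : smooth_on setT ((fun=> a) : PV -> R).
Proof. by apply/smooth_onP => A; eexists; exact: local_ext_cst. Qed.

Lemma smooth_onTD (f g : PV -> R) : smooth_on setT f -> smooth_on setT g ->
  smooth_on setT ((fun x => f x + g x) : PV -> R).
Proof.
move=> /smooth_onP sf /smooth_onP sg; apply/smooth_onP => A.
have [F hF] := sf A; have [G hG] := sg A; eexists; exact: local_extD hF hG.
Qed.

Lemma smooth_onTM (f g : PV -> R) : smooth_on setT f -> smooth_on setT g ->
  smooth_on setT ((fun x => f x * g x) : PV -> R).
Proof.
move=> /smooth_onP sf /smooth_onP sg; apply/smooth_onP => A.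
have [F hF] := sf A; have [G hG] := sg A; eexists; exact: local_extM hF hG.
Qed.

Lemma smooth_onT_sum I (s : seq I) (F : I -> PV -> R) :
  (forall i, smooth_on setT (F i)) -> smooth_on setT ((fun x => \sum_(i <- s) F i x) : PV -> R).
Proof.
move=> sF; elim: s => [|i s IH].
  by rewrite (_ : (fun _ => _) = fun=> 0); [exact: smooth_onT_cst|apply/funext => x; rewrite big_nil].
rewrite (_ : (fun _ => _) = fun x => F i x + \sum_(j <- s) F j x); last first.
  by apply/funext => x; rewrite big_cons.
exact: smooth_onTD.
Qed.

Lemma local_ext_diff f A G : local_ext f A G -> differentiable G A.
Proof. by case=> W [Wo WA sG _]; exact: smooth_fun_diff sG WA. Qed.

Lemma smooth_opp (U : set mat) (G : mat -> R) : smooth_fun U G ->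
  smooth_fun (-%R @^-1` U) (fun B => G (- B)).
Proof.
move=> sG; have := @smooth_fun_affine R mat mat U G (-%R : {linear mat -> mat}) 0 _ sG.
rewrite (_ : (fun y : mat => _ + 0) = -%R); last by apply/funext => y; rewrite addr0.
rewrite (_ : (fun y : mat => G (_ + 0)) = fun B => G (- B)).
  by apply; exact: opp_continuous.
by apply/funext => y; rewrite addr0.
Qed.

Lemma derive_opp (G : mat -> R) A X : 'D_X (fun B => G (- B)) A = 'D_(- X) G (- A).
Proof.
have := @derive_affine R mat mat G (-%R : {linear mat -> mat}) 0 X A.
rewrite (_ : (fun y : mat => G (_ + 0)) = fun B => G (- B)) ?addr0 //.
by apply/funext => y; rewrite addr0.
Qed.

Lemma mkst_opp (A : mat) (h : A^T *m A = 1%:M) : (- A)^T *m - A = 1%:M.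
Proof. by rewrite trmxN mulmxN mulNmx opprK. Qed.

Lemma local_ext_opp f A G : local_ext f A G -> local_ext f (- A) (fun B => G (- B)).
Proof.
case=> W [Wo WA sG fG]; exists (-%R @^-1` W); split.
- by apply: open_comp Wo => A0 _; exact: opp_continuous.
- by rewrite /= opprK.
- exact: smooth_opp.
- move=> y Wy; pose z := mkst (mkst_opp (stiefel_valP y)).
  have -> : prs y = prs z by apply/prs_eq; right.
  exact: (fG z).
Qed.

(** The extension is chosen by [xget], with the zero function as default; for a frame A and X
    tangent at A, [tangE] shows that every local extension gives the same value. *)
Definition tang (A X : mat) (f : PV -> R) : R :=
  'D_X (xget (fun=> 0) [set G | local_ext f A G]) A.

Lemma tangE A X f G : A^T *m A = 1%:M -> symm_part A X = 0 -> local_ext f A G ->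
  tang A X f = 'D_X G A.
Proof.
move=> AA AX hG; rewrite /tang; case: xgetP => [F _ hF|/(_ G)]; last by [].
have dF := local_ext_diff hF; have dG := local_ext_diff hG.
move: hF hG => [W [Wo WA _ fF]] [W' [Wo' WA' _ fG]].
apply: (@tangent_unique _ _ _ A X (W `&` W')) => //; first exact: openI.
move=> B BB [WB WB'].
by rewrite -(fF (mkst BB)) // -(fG (mkst BB)).
Qed.

Lemma tang_derivation (A : @stiefel_set R n k) X : symm_part (set_val A) X = 0 ->
  derivation_at (prs A) (tang (set_val A) X).
Proof.
move=> AX; split=> [a f g|f g] /smooth_onP/(_ A)[F hF] /smooth_onP/(_ A)[G hG].
  have h := local_extD (local_extM (local_ext_cst a _) hF) hG.
  rewrite (tangE (stiefel_valP A) AX h) !(tangE (stiefel_valP A) AX hF) !(tangE (stiefel_valP A) AX hG).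
  have dF := local_ext_diff hF; have dG := local_ext_diff hG.
  have -> : (fun B => a * F B + G B) = (a *: F) + G by [].
  have dFX := diff_derivable (v := X) dF; have dGX := diff_derivable (v := X) dG.
  have dF' : derivable (a *: F) (set_val A) X by exact: derivableZ.
  by rewrite (deriveD dF' dGX) (deriveZ _ dFX).
have h := local_extM hF hG.
rewrite (tangE (stiefel_valP A) AX h) !(tangE (stiefel_valP A) AX hF) !(tangE (stiefel_valP A) AX hG).
have dF := local_ext_diff hF; have dG := local_ext_diff hG.
have -> : (fun B => F B * G B) = F * G by [].
rewrite (deriveM (diff_derivable (v := X) dF) (diff_derivable (v := X) dG)).
have [W [_ WA _ fF]] := hF; have [W' [_ WA' _ fG]] := hG.
by rewrite (fF _ WA) (fG _ WA') addrC mulrC.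
Qed.

End Quotient.

Section Tangents.
Variables (R : realType) (n k : nat).
Local Notation mat := 'M[R]_(n, k).
Local Notation PV := (projective_stiefel R n k).
Local Notation V := (fun A : mat => A^T *m A = 1%:M).

Lemma entry_neq0 (A : mat) : (0 < k)%N -> V A -> exists a : 'I_n * 'I_k, A a.1 a.2 != 0.
Proof.
move=> k0 AA; case: (pselect (exists a : 'I_n * 'I_k, A a.1 a.2 != 0)) => [//|N].
exfalso; have /matrixP/(_ (Ordinal k0) (Ordinal k0)) := AA.
rewrite !mxE eqxx big1 => [/eqP|l _]; first by rewrite eq_sym oner_eq0.
case: (eqVneq (A l (Ordinal k0)) 0) => [->|h]; first by rewrite mulr0.
by case: N; exists (l, Ordinal k0).
Qed.

(** The orthogonal projection to the tangent space at a frame A. It gives the differential a meaning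
    for all X, as the system is set up before X is known to be tangent. *)
Definition tproj (A X : mat) : mat := X - 2^-1 *: (A *m symm_part A X).

Lemma tproj_tangent A X : V A -> symm_part A (tproj A X) = 0.
Proof.
move=> AA; rewrite /tproj; set S := symm_part A X.
have SE : A^T *m X + X^T *m A = S by [].
have ST : S^T = S by rewrite /S /symm_part linearD /= !trmx_mul !trmxK addrC.
have PT : (X - 2^-1 *: (A *m S))^T = X^T - 2^-1 *: (S *m A^T).
  by rewrite linearB linearZ /= trmx_mul ST.
rewrite /symm_part PT mulmxBr mulmxBl -scalemxAl -scalemxAr -!mulmxA AA mulmx1 mulmxA AA mul1mx addrACA SE -opprD.
have h2 : 2^-1 + 2^-1 = 1 :> R by field.
by rewrite -scalerDl h2 scale1r subrr.
Qed.

Lemma tproj_id A X : symm_part A X = 0 -> tproj A X = X.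
Proof. by move=> h; rewrite /tproj h mulmx0 scaler0 subr0. Qed.

Lemma tprojNl A X : tproj (- A) X = tproj A X.
Proof. by rewrite /tproj symm_partNl mulNmx mulmxN opprK. Qed.

Lemma tprojNr A X : tproj A (- X) = - tproj A X.
Proof. by rewrite /tproj symm_partNr mulmxN scalerN opprD. Qed.

Lemma tangNr A X f G : V A -> symm_part A X = 0 -> local_ext f A G ->
  tang A (- X) f = - tang A X f.
Proof.
move=> AA AX hG; have dG := local_ext_diff hG.
have AX' : symm_part A (- X) = 0 by rewrite symm_partNr AX oppr0.
by rewrite (tangE AA AX' hG) (tangE AA AX hG) !deriveE // linearN.
Qed.

Lemma tangNl A X f G : V A -> symm_part A X = 0 -> local_ext f A G ->
  tang (- A) X f = - tang A X f.
Proof.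
move=> AA AX hG; have dG := local_ext_diff hG.
have AX' : symm_part (- A) X = 0 by rewrite symm_partNl AX oppr0.
rewrite (tangE (mkst_opp AA) AX' (local_ext_opp hG)) (tangE AA AX hG).
by rewrite derive_opp opprK !deriveE // linearN.
Qed.

Definition eval (f : PV -> R) (A : mat) : R :=
  if pselect (V A) is left h then f (prs (mkst h)) else 0.

Lemma evalE f (A : @stiefel_set R n k) : eval f (set_val A) = f (prs A).
Proof.
rewrite /eval; case: pselect => [h|/(_ (stiefel_valP A))] //.
by congr (f _); apply/prs_eq; left.
Qed.

Lemma eval_cont f (T : topologicalType) (A : T -> mat) : smooth_on setT f ->
  (forall x, V (A x)) -> mx_continuous A -> continuous (fun x => eval f (A x)).
Proof.
move=> /smooth_onP sf VA Ac x; have [G [W [Wo WA sG fG]]] := sf (mkst (VA x)).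
rewrite /continuous_at; have fE (B : mat) (VB : V B) : W B -> eval f B = G B.
  by move=> WB; rewrite -[B]/(set_val (mkst VB)) evalE fG.
have Gc := smooth_fun_continuous sG WA.
have Ax := mx_continuousE Ac (x := x).
rewrite fE //; apply: cvg_trans (cvg_comp _ _ Ax Gc).
apply: near_eq_cvg; have : \forall y \near x, W (A y) by apply: Ax; exact: open_nbhs_nbhs.
by apply: filterS => y Wy; rewrite fE.
Qed.

Lemma tang_cont f (T : topologicalType) (A X : T -> mat) : smooth_on setT f ->
  (forall x, V (A x)) -> mx_continuous A -> mx_continuous X ->
  continuous (fun x => tang (A x) (tproj (A x) (X x)) f).
Proof.
move=> /smooth_onP sf VA Ac Xc x; have [G [W [Wo WA sG fG]]] := sf (mkst (VA x)).
have Pc : mx_continuous (fun y => tproj (A y) (X y)).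
  have Sc : mx_continuous (fun y => symm_part (A y) (X y)).
    move=> i j y; rewrite (_ : (fun y => _) = fun y =>
      ((A y)^T *m X y) i j + ((X y)^T *m A y) i j); last by apply/funext => z; rewrite mxE.
    have h1 := mx_continuousM (mx_continuous_tr Ac) Xc.
    have h2 := mx_continuousM (mx_continuous_tr Xc) Ac.
    by apply: cvgD; [exact: h1|exact: h2].
  have ASc := mx_continuousM Ac Sc.
  move=> i j y; rewrite (_ : (fun y => _) = fun y =>
    X y i j - 2^-1 * (A y *m symm_part (A y) (X y)) i j); last first.
    by apply/funext => z; rewrite /tproj mxE [X in _ + X]mxE [X in - X]mxE.
  by apply: cvgB; [exact: Xc|apply: cvgM; [exact: cvg_cst|exact: ASc]].
(* One extension G serves all frames near [A x], so the value is a combination of continuous partial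
   derivatives of G. *)
have fE y : W (A y) -> tang (A y) (tproj (A y) (X y)) f =
    \sum_i \sum_j tproj (A y) (X y) i j * 'D_(delta_mx i j) G (A y).
  move=> Wy; have hG : local_ext f (A y) G by exists W.
  rewrite (tangE (VA y) (tproj_tangent _ (VA y)) hG) derive_delta //.
  exact: local_ext_diff hG.
have Ax := mx_continuousE Ac (x := x).
rewrite /continuous_at fE //.
have : (\sum_i \sum_j tproj (A y) (X y) i j * 'D_(delta_mx i j) G (A y)) @[y --> x] -->
    \sum_i \sum_j tproj (A x) (X x) i j * 'D_(delta_mx i j) G (A x).
  apply: cvg_big => [|i _]; first exact: add_continuous.
  apply: cvg_big => [|j _]; first exact: add_continuous.
  apply: cvgM; first exact: Pc.
  exact: (cvg_comp _ _ Ax (smooth_fun_continuous (smooth_fun_derive (delta_mx i j) sG) WA)).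
apply: cvg_trans; apply: near_eq_cvg.
have : \forall y \near x, W (A y) by apply: Ax; exact: open_nbhs_nbhs.
by apply: filterS => y Wy; rewrite fE.
Qed.

Definition quad (a b : 'I_n * 'I_k) (p : PV) : R :=
  set_val (repr p) a.1 a.2 * set_val (repr p) b.1 b.2.

Lemma quad_prs a b A : quad a b (prs A) = set_val A a.1 a.2 * set_val A b.1 b.2.
Proof.
rewrite /quad; have : prs (repr (prs A)) = prs A by exact: reprK.
case/prs_eq => ->; first by [].
by rewrite !mxE mulrNN.
Qed.

Lemma quad_ext a b A : local_ext (quad a b) A (fun B => B a.1 a.2 * B b.1 b.2).
Proof.
exists setT; split=> //; first exact: openT.
  by apply: smooth_funM; [exact: openT|exact: smooth_fun_coord|exact: smooth_fun_coord].
by move=> y _; rewrite quad_prs.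
Qed.

Lemma quad_smooth a b : smooth_on setT (quad a b).
Proof. by apply/smooth_onP => A; eexists; exact: quad_ext. Qed.

Lemma tang_quad A X a b : V A -> symm_part A X = 0 ->
  tang A X (quad a b) = A a.1 a.2 * X b.1 b.2 + A b.1 b.2 * X a.1 a.2.
Proof.
move=> AA AX; rewrite (tangE AA AX (quad_ext a b A)).
have dc i j : derivable (fun B : mat => B i j) A X.
  by apply: diff_derivable; exact: differentiable_coord.
by rewrite (deriveM (dc _ _) (dc _ _)) !derive_coord.
Qed.

Lemma quad_inj p q : (forall a b, quad a b p = quad a b q) -> p = q.
Proof.
have [A <-] := prs_surj p; have [B <-] := prs_surj q => h.
have {}h a b : set_val A a.1 a.2 * set_val A b.1 b.2 = set_val B a.1 a.2 * set_val B b.1 b.2.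
  by rewrite -!quad_prs.
apply/prs_eq; have [A0|[a a0]] : set_val A = 0 \/ exists a : 'I_n * 'I_k, set_val A a.1 a.2 != 0.
- case: (pselect (exists a : 'I_n * 'I_k, set_val A a.1 a.2 != 0)) => [?|N]; [by right|left].
  apply/matrixP => i j; rewrite [RHS]mxE; apply/eqP; apply: contra_notT N => ij.
  by exists (i, j).
- left; rewrite A0; apply/matrixP => i j; have := h (i, j) (i, j).
  by rewrite A0 /= !mxE mul0r => /esym/eqP; rewrite mulf_eq0 orbb => /eqP.
have /eqP := h a a; rewrite -!expr2 eqf_sqr => /orP[]/eqP e.
  left; apply/matrixP => i j; have := h a (i, j); rewrite /= -e.
  by move=> /(mulfI a0).
right; apply/matrixP => i j; have := h a (i, j); rewrite /= e mulNr.
move=> hh; rewrite [RHS]mxE; apply/eqP; rewrite -eqr_oppLR.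
have b0 : set_val B a.1 a.2 != 0 by rewrite -oppr_eq0 -e.
by apply/eqP; apply: (mulfI b0); rewrite mulrN -hh opprK.
Qed.

Lemma tang_eq0 A X : V A -> symm_part A X = 0 ->
  (forall g, smooth_on setT g -> tang A X g = 0) -> X = 0.
Proof.
move=> AA AX h.
have {}h a b : A a.1 a.2 * X b.1 b.2 + A b.1 b.2 * X a.1 a.2 = 0.
  by rewrite -tang_quad //; apply: h; exact: quad_smooth.
have [A0|[a a0]] : (forall a : 'I_n * 'I_k, A a.1 a.2 = 0) \/ exists a : 'I_n * 'I_k, A a.1 a.2 != 0.
- case: (pselect (exists a : 'I_n * 'I_k, A a.1 a.2 != 0)) => [?|N]; [by right|left].
  by move=> a; apply/eqP; apply: contra_notT N => aa; exists a.
- apply/matrixP => i j; have /matrixP/(_ j j) := AA; rewrite !mxE eqxx big1.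
    by move=> /eqP; rewrite eq_sym oner_eq0.
  by move=> l _; rewrite (A0 (l, j)) mulr0.
have Xa : X a.1 a.2 = 0.
  by have := h a a; rewrite -mulr2n => /eqP; rewrite mulrn_eq0 mulf_eq0 (negbTE a0) /= => /eqP.
apply/matrixP => i j; rewrite [RHS]mxE; have := h a (i, j).
by rewrite Xa mulr0 addr0 => /eqP; rewrite mulf_eq0 (negbTE a0) /= => /eqP.
Qed.

End Tangents.

(** * The lower bound *)

Section Derivations.
Variables (R : realType) (M : smooth_space R) (d : nat) (f : M -> 'rV[R]_d).

Lemma derivation_scale p D c : derivation_at p D -> @derivation_at R M p (fun g => c * D g).
Proof.
move=> [lin leib]; split=> [a g h sg sh|g h sg sh]; first by rewrite lin //; ring.
by rewrite leib //; ring.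
Qed.

Lemma differential_scale c D : differential f (fun g => c * D g) = c *: differential f D.
Proof. by apply/rowP => j; rewrite !mxE. Qed.

Lemma line_affine_tangent p D : derivation_at p D ->
  line (f p) (differential f D) `<=` affine_tangent f p.
Proof.
move=> hD _ [c _ <-]; exists (fun g => c * D g); first exact: derivation_scale.
by rewrite differential_scale.
Qed.

End Derivations.

Section LowerBound.
Variables (R : realType) (n k d : nat).
Local Notation mat := 'M[R]_(n, k).
Local Notation PV := (projective_stiefel R n k).
Local Notation V := (fun A : mat => A^T *m A = 1%:M).
Variable f : PV -> 'rV[R]_d.
Hypothesis f_skew : skew_embedding f.

Let f_smooth : smooth_map f. Proof. by have [[[]]] := f_skew. Qed.

Let E (A : mat) : 'rV[R]_d := \row_j eval (coordinate f j) A.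
Let dE (A X : mat) : 'rV[R]_d := \row_j tang A (tproj A X) (coordinate f j).

Let ext_at j A : V A -> exists G, local_ext (coordinate f j) A G.
Proof. by move=> VA; have /smooth_onP/(_ (mkst VA)) := f_smooth j. Qed.

(** If t is nonzero, dividing by it exhibits a common point of the two affine tangent spaces. If t =
    0, the common vector df X = df Y is either the direction of two parallel lines or zero, and then
    the immersion property gives X = Y = 0. *)
Lemma skew_no_coincidence (A B : mat) : V A -> V B -> A <> B -> A <> - B ->
  coincidence E dE A B -> False.
Proof.
move=> VA VB AB AnB [X [Y [t [nz AX BY eq0]]]].
pose p := prs (mkst VA); pose q := prs (mkst VB).
have pq : p <> q.
  move=> /prs_eq [] h; first exact: AB (esym h).
  by apply: AnB; rewrite -[B]/(set_val (mkst VB)) h opprK.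
have Ep : E A = f p by apply/rowP => j; rewrite mxE -[A]/(set_val (mkst VA)) evalE.
have Eq : E B = f q by apply/rowP => j; rewrite mxE -[B]/(set_val (mkst VB)) evalE.
have dA : dE A X = differential f (tang A X) by apply/rowP => j; rewrite !mxE tproj_id.
have dB : dE B Y = differential f (tang B Y) by apply/rowP => j; rewrite !mxE tproj_id.
have derA : derivation_at p (tang A X) by exact: (tang_derivation (A := mkst VA)).
have derB : derivation_at q (tang B Y) by exact: (tang_derivation (A := mkst VB)).
have [sk0 skl] := f_skew.2 p q pq; have [[imm_s imm] _ _] := f_skew.1.
move: eq0; rewrite Ep Eq dA dB; have [t0|t0] := eqVneq t 0.
  rewrite t0 scale0r addr0 => /eqP; rewrite subr_eq0 => /eqP dd.
  have [d0|dn0] := eqVneq (differential f (tang A X)) 0.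
    have X0 : X = 0.
      by apply: (tang_eq0 VA AX); exact: (imm p).
    have Y0 : Y = 0.
      by apply: (tang_eq0 VB BY); apply: (imm q) => //; rewrite -dd.
    by case: nz; rewrite ?X0 ?Y0 ?t0 eqxx.
  apply: skl; exists (f p), (f q), (differential f (tang A X)); split=> //.
    exact: line_affine_tangent.
  by rewrite dd; exact: line_affine_tangent.
move=> eq0; suff : (affine_tangent f p `&` affine_tangent f q) (f p + t^-1 *: differential f (tang A X)).
  by rewrite sk0.
split; first by apply: (line_affine_tangent derA); exists t^-1.
apply: (line_affine_tangent derB); exists t^-1 => //.
apply/(scalerI t0); rewrite !scalerDr !scalerA mulfV // !scale1r.
apply/eqP; rewrite -subr_eq0 -oppr_eq0; apply/eqP; rewrite -[RHS]eq0 scalerBr.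
by apply/rowP => j; rewrite !mxE; ring.
Qed.

Lemma skew_dim_bound m : (0 < k < n)%N -> hcoef (n * k) m = 1 ->
  (1 < k -> forall j, n - k < j <= m -> ~~ odd 'C(n, j))%N ->
  (k = 1%N -> (m.+1 < n)%N /\ (m = 0%N \/ hcoef (n * k) m.+1 = 0)) ->
  ((n * k + m).*2 < d + (symdim k).*2)%N.
Proof.
move=> /andP[k0 kn] hm h1 h2; rewrite ltnNge; apply/negP => dim_le.
have [A [B [VA VB AB AnB co]]] : exists A B : mat, [/\ V A, V B, A <> B, A <> - B & coincidence E dE A B].
  have E_even A : V A -> E (- A) = E A.
    move=> VA; apply/rowP => j; rewrite !mxE.
    rewrite -[A]/(set_val (mkst VA)) evalE -[- _]/(set_val (mkst (mkst_opp VA))) evalE.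
    by congr (coordinate f j _); apply/prs_eq; right; rewrite /= opprK.
  have dE_oddl A X : V A -> dE (- A) X = - dE A X.
    move=> VA; apply/rowP => j; have [G hG] := ext_at j VA.
    by rewrite !mxE tprojNl (tangNl VA (tproj_tangent X VA) hG).
  have dE_oddr A X : V A -> dE A (- X) = - dE A X.
    move=> VA; apply/rowP => j; have [G hG] := ext_at j VA.
    by rewrite !mxE tprojNr (tangNr VA (tproj_tangent X VA) hG).
  have E_cont (T : topologicalType) (A : T -> mat) :
      (forall x, V (A x)) -> mx_continuous A -> mx_continuous (fun x => E (A x)).
    move=> VA Ac i j; rewrite (_ : (fun x => _) = fun x => eval (coordinate f j) (A x)).
      exact: eval_cont.
    by apply/funext => x; rewrite mxE.
  have dE_cont (T : topologicalType) (A X : T -> mat) : (forall x, V (A x)) ->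
      mx_continuous A -> mx_continuous X -> mx_continuous (fun x => dE (A x) (X x)).
    move=> VA Ac Xc i j.
    rewrite (_ : (fun x => _) = fun x => tang (A x) (tproj (A x) (X x)) (coordinate f j)).
      exact: tang_cont.
    by apply/funext => x; rewrite mxE.
  case: (ltnP 1 k) => k1.
    by apply: (@coincidence_swap R n k d m) => //; [rewrite k1 ltnW|exact: h1].
  have kE : k = 1%N by apply/eqP; rewrite eqn_leq k1.
  have [mn hc] := h2 kE.
  exact: (@coincidence_orthogonal R n k d m).
exact: skew_no_coincidence co.
Qed.

End LowerBound.

(** * The dimension *)

Section Dimension.
Variables (R : realType) (n k : nat).
Local Notation mat := 'M[R]_(n, k).
Local Notation PV := (projective_stiefel R n k).
Local Notation V := (fun A : mat => A^T *m A = 1%:M).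

Lemma symm_partD (A X Y : mat) : symm_part A (X + Y) = symm_part A X + symm_part A Y.
Proof. by rewrite /symm_part mulmxDr [(X + Y)^T]linearD /= mulmxDl addrACA. Qed.

(** The matrices A S with S symmetric form a complement to the tangent space: [symm_part A] sends A
    S to 2 S and kills the image of [b]. Hence the sum of both maps is injective into the n by k
    matrices. *)
Lemma tangent_rank q (b : 'rV[R]_q -> mat) (A : mat) : V A -> linear b ->
  (forall v, symm_part A (b v) = 0) -> (forall v, b v = 0 -> v = 0) ->
  (q + symdim k <= n * k)%N.
Proof.
move=> AA lin bA binj.
pose tp (t : 'I_(symdim k)) : 'I_k * 'I_k := tnth (in_tuple (sympairs k)) t.
have tple t : ((tp t).1 <= (tp t).2)%N.
  by have := mem_tnth t (in_tuple (sympairs k)); rewrite mem_enum inE.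
have tpinj : injective tp by apply/tuple_uniqP; exact: enum_uniq.
pose T (w : 'rV[R]_(symdim k)) : 'M[R]_k := \sum_t w 0 t *: delta_mx (tp t).1 (tp t).2.
have Tij w i j : T w i j = \sum_t w 0 t * ((i, j) == tp t)%:R.
  by rewrite summxE; apply: eq_bigr => t _; rewrite !mxE; case: (tp t).
have Tlow w (i j : 'I_k) : (j < i)%N -> T w i j = 0.
  move=> ji; rewrite Tij big1 // => t _; case: eqP => [e|_]; last by rewrite mulr0.
  by have := tple t; rewrite -e leqNgt ji.
have T0 w : T w = 0 -> w = 0.
  move=> /matrixP Tw; apply/rowP => t; rewrite [RHS]mxE.
  have := Tw (tp t).1 (tp t).2; rewrite Tij mxE (bigD1 t) //= big1 => [|t' tt'].
    by rewrite -surjective_pairing eqxx mulr1 addr0.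
  rewrite -surjective_pairing (inj_eq tpinj) [t == t']eq_sym (negbTE tt') mulr0 //.
have Tlin : linear T.
  move=> a u v; rewrite /T scaler_sumr -big_split /=; apply: eq_bigr => t _.
  by rewrite scalerA -scalerDl !mxE.
pose S w := T w + (T w)^T.
have ST w : (S w)^T = S w by rewrite /S linearD /= trmxK addrC.
have S0 w : S w = 0 -> w = 0.
  move=> Sw; apply: T0; apply/matrixP => i j; rewrite [RHS]mxE.
  have := congr1 (fun Z : 'M[R]_k => Z i j) Sw; rewrite /S !mxE; case: (ltngtP i j) => ij.
  - by rewrite (Tlow w j i) // addr0.
  - by rewrite (Tlow w i j).
  - by move/val_inj: ij => -> e; lra.
have Slin : linear S.
  by move=> a u v; rewrite /S Tlin linearD linearZ /= scalerDr addrACA.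
pose F (u : 'rV[R]_(q + symdim k)) : 'rV[R]_(n * k) :=
  mxvec (b (lsubmx u) + A *m S (rsubmx u)).
have Flin : linear F.
  move=> a u v; rewrite /F (linearP lsubmx) (linearP rsubmx) lin Slin mulmxDr -scalemxAr.
  by rewrite -(linearP mxvec) scalerDr addrACA.
pose HF := GRing.isLinear.Build _ _ _ _ F Flin.
pose FL : {linear _ -> _} := HB.pack F HF.
have FE u : F u = u *m lin1_mx FL by rewrite mul_rV_lin1.
have : row_free (lin1_mx FL).
  apply: inj_row_free => u; rewrite -FE /F => h.
  have {}h : b (lsubmx u) + A *m S (rsubmx u) = 0.
    by rewrite -[LHS]mxvecK h linear0.
  have u2 : rsubmx u = 0.
    apply: S0; have := congr1 (symm_part A) h.
    rewrite symm_partD bA add0r /symm_part.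
    rewrite trmx_mul ST mulmxA AA mul1mx -mulmxA AA mulmx1 mulmx0 trmx0 mul0mx addr0.
    by rewrite -mulr2n -scaler_nat => /eqP; rewrite scaler_eq0 pnatr_eq0 => /eqP.
  have u1 : lsubmx u = 0.
    apply: binj; move: h; rewrite u2 /S (_ : T 0 = 0) ?trmx0 ?addr0 ?mulmx0 ?addr0 //.
    by rewrite /T big1 // => t _; rewrite mxE scale0r.
  by rewrite -[u]hsubmxK u1 u2 row_mx0.
by rewrite /row_free => /eqP <-; exact: rank_leq_col.
Qed.

Lemma differentiable_mx (W : normedModType R) (B : W -> mat) y :
  (forall i j, differentiable (fun z => B z i j) y) -> differentiable B y.
Proof.
move=> dB; rewrite (_ : B = \sum_i \sum_j (fun z => B z i j *: (delta_mx i j : mat))).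
  apply: differentiable_sum => i; apply: differentiable_sum => j.
  exact: differentiableZl.
apply/funext => z; rewrite {1}(matrix_sum_delta (B z)) fct_sumE; apply: eq_bigr => i _.
by rewrite fct_sumE.
Qed.

Lemma derive_comp (W : normedModType R) (B : W -> mat) (F : mat -> R) y v :
  differentiable B y -> differentiable F (B y) ->
  'D_v (F \o B) y = 'D_('d B y v) F (B y).
Proof.
move=> dB dF; rewrite deriveE; last exact: differentiable_comp.
by rewrite diff_comp // [RHS]deriveE.
Qed.

(* Near its base point a chart of the quotient lifts to a differentiable map [B] into the
   frames: divide [A_a A], which depends on [+- A] only, by [sqrt (A_a A_a) = +- A_a]. *)
Lemma chart_lift q (p : PV) (U : set PV) (phi : PV -> 'rV[R]_q) psi :
  U p -> is_chart U phi psi ->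
  (0 < k)%N -> exists B : 'rV[R]_q -> mat, differentiable B (phi p) /\
    \forall y \near phi p, exists C : @stiefel_set R n k,
      [/\ set_val C = B y, prs C = psi y & (phi @` U) y].
Proof.
move=> Up [[Uo pUo] psiK _ chart] k0; have [A pA] := prs_surj p.
have [a a0] := entry_neq0 k0 (stiefel_valP A).
set W := phi @` U; set y0 := phi p.
have Wy0 : W y0 by exists p.
have smooth_e b : smooth_fun W (fun y => quad a b (psi y)).
  apply/chart => // pr C [UC _]; exists setT, (fun B : mat => B a.1 a.2 * B b.1 b.2).
  split=> //; first exact: openT.
    by apply: smooth_funM; [exact: openT|exact: smooth_fun_coord|exact: smooth_fun_coord].
  by move=> D [UD _] _; rewrite /= -quad_prs psiK.
have de b : differentiable (fun y => quad a b (psi y)) y0 by exact: smooth_fun_diff (smooth_e b) Wy0.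
have psi0 : psi y0 = prs A by rewrite /y0 psiK.
pose s y := Num.sqrt (quad a a (psi y)).
have ee : 0 < quad a a (psi y0) by rewrite psi0 quad_prs -expr2 exprn_even_gt0.
have ds : differentiable s y0.
  apply: (@differentiable_comp _ _ _ _ (fun y => quad a a (psi y)) Num.sqrt) => //.
  apply/derivable1_diffP; exact: (@ex_derive _ _ _ _ _ _ _ (is_derive1_sqrt ee)).
have s0 : s y0 != 0.
  by rewrite /s sqrtr_eq0 -ltNge.
exists (fun y => \matrix_(i, j) (quad a (i, j) (psi y) * (s y)^-1)); split.
  apply: differentiable_mx => i j.
  rewrite (_ : (fun z => _) = (fun y => quad a (i, j) (psi y)) * (fun y => (s y)^-1)).
    by apply: differentiableM => //; exact: differentiableV.
  by apply/funext => z; rewrite mxE.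
have near_pos : \forall y \near y0, 0 < quad a a (psi y).
  have := differentiable_continuous (de a); rewrite /= => h.
  have pos : nbhs (quad a a (psi y0)) [set t : R | 0 < t] by exact: lt_nbhsr.
  exact: h _ pos.
have near_W : \forall y \near y0, W y by exact: open_nbhs_nbhs.
apply: filterS2 near_pos near_W => y ey Wy; have [C pC] := prs_surj (psi y).
have q_y b : quad a b (psi y) = set_val C a.1 a.2 * set_val C b.1 b.2 by rewrite -pC quad_prs.
have sy : s y = `|set_val C a.1 a.2| by rewrite /s q_y -expr2 sqrtr_sqr.
have sy0 : s y != 0 by rewrite /s sqrtr_eq0 -ltNge.
case: (ger0P (set_val C a.1 a.2)) => Ca; rewrite ?(ger0_norm Ca) ?(ltr0_norm Ca) in sy.
  exists C; split=> //; apply/matrixP => i j; rewrite [RHS]mxE q_y -sy.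
  by rewrite mulrAC mulfV // mul1r.
exists (mkst (mkst_opp (stiefel_valP C))); split=> //.
  apply/matrixP => i j; rewrite [RHS]mxE q_y [LHS]mxE -[set_val C a.1 a.2]opprK -sy.
  by rewrite mulNr mulNr mulrAC mulfV // mul1r.
by rewrite -pC; apply/prs_eq; right; rewrite /= opprK.
Qed.

(** [tangent_rank] is applied to the differential of the lift: it takes tangent values, since the
    lift consists of frames, and it is injective, since the chart coordinates are smooth functions
    of the lift. *)
Lemma chart_dim q (p : PV) (U : set PV) (phi : PV -> 'rV[R]_q) psi :
  U p -> is_chart U phi psi -> (0 < k)%N -> (q + symdim k <= n * k)%N.
Proof.
move=> Up ch k0; have [B [dB nB]] := chart_lift Up ch k0.
have [[Uo pUo] psiK _ chart] := ch.
set y0 := phi p in dB nB; have [C [CB pC [x0 Ux0 x0y]]] := nbhs_singleton nB.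
have VB0 : V (B y0) by rewrite -CB; exact: stiefel_valP.
have Wy0 : (phi @` U) y0 by exists p.
apply: (@tangent_rank q ('d B y0) (B y0)) => //.
- by move=> a u v; rewrite linearP.
- move=> v; apply/matrixP => i j.
  pose F (M : mat) := \sum_l M l i * M l j.
  have dM l h : differentiable (fun M : mat => M l h) (B y0) by exact: differentiable_coord.
  have FE : F = \sum_l ((fun M : mat => M l i) * (fun M : mat => M l j)).
    by apply/funext => M; rewrite fct_sumE.
  have dF : differentiable F (B y0).
    by rewrite FE; apply: differentiable_sum => l; exact: differentiableM.
  have := derive_comp v dB dF.
  rewrite (@near_eq_derive _ _ _ _ (fun=> (i == j)%:R : R)).
    rewrite derive_cst FE derive_sum => [h|l]; last first.
      by apply: diff_derivable; exact: differentiableM.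
    rewrite [RHS]mxE h !mxE -big_split; apply: eq_bigr => l _ /=.
    rewrite (deriveM (diff_derivable (dM _ _)) (diff_derivable (dM _ _))).
    by rewrite !derive_coord !mxE; congr (_ + _); exact: mulrC.
  apply: filterS nB => y [D [DB _ _]].
  have /matrixP/(_ i j) := stiefel_valP D; rewrite DB !mxE => <-.
  by apply: eq_bigr => l _; rewrite mxE.
- move=> v bv; apply/rowP => i; rewrite [RHS]mxE.
  (* The [i]-th chart coordinate is smooth on the quotient, so near [B y0] it extends to a smooth F
     with F (B y) = y_i; the chain rule turns dB v = 0 into v_i = 0. *)
  have sg : smooth_fun (phi @` U) (fun y : 'rV[R]_q => y 0 i) by exact: smooth_fun_coord.
  have /(chart _ _ pUo (@subset_refl _ _))/(_ C) := sg.
  have in_chart (D : @stiefel_set R n k) x : U x -> prs D = psi (phi x) ->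
      (U `&` phi @^-1` (phi @` U)) (prs D).
    by move=> Ux ->; rewrite psiK //; split=> //; exists x.
  case=> [|W [F [Wo WB sF gF]]]; first by apply: (in_chart C x0) => //; rewrite x0y.
  rewrite CB in WB; have dF := smooth_fun_diff sF WB.
  have := derive_comp v dB dF; rewrite (@near_eq_derive _ _ _ _ (fun y : 'rV[R]_q => y 0 i)).
    by rewrite derive_coord => ->; rewrite bv derive0.
  have Bc : \forall y \near y0, W (B y).
    by have := differentiable_continuous dB; apply; exact: open_nbhs_nbhs.
  apply: filterS2 Bc nB => y WBy [D [DB pD [x Ux xy]]].
  rewrite /= -DB -gF ?DB //.
    by rewrite /= -[(\pi_ _ D)%qT]/(prs D) pD -xy psiK.
  by apply: (in_chart D x) => //; rewrite xy.
Qed.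

End Dimension.

(** * Hadamard's lemma *)

Section UnitIntegral.
Variable R : realType.
Implicit Types f g : R -> R.
Local Notation mu := (@lebesgue_measure R).

Definition cont01 f := forall t : R, 0 <= t <= 1 -> {for t, continuous f}.
Definition int01 f : R := \int[mu]_(t in `[0, 1]) f t.

Lemma cont01_within f : cont01 f -> {within `[0, 1], continuous f}.
Proof.
by move=> cf; apply: continuous_in_subspaceT => t; rewrite inE /= in_itv /=; exact: cf.
Qed.

Lemma cont01_integrable f : cont01 f -> mu.-integrable `[0, 1] (EFin \o f).
Proof.
move=> cf; apply: continuous_compact_integrable; first exact: segment_compact.
exact: cont01_within.
Qed.

Lemma int01D f g : cont01 f -> cont01 g -> int01 (fun t => f t + g t) = int01 f + int01 g.
Proof. by move=> cf cg; apply: RintegralD => //; exact: cont01_integrable. Qed.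

Lemma int01B f g : cont01 f -> cont01 g -> int01 (fun t => f t - g t) = int01 f - int01 g.
Proof. by move=> cf cg; apply: RintegralB => //; exact: cont01_integrable. Qed.

Lemma int01Z a f : cont01 f -> int01 (fun t => a * f t) = a * int01 f.
Proof. by move=> cf; apply: RintegralZl => //; exact: cont01_integrable. Qed.

Lemma eq_int01 f g : (forall t : R, 0 <= t <= 1 -> f t = g t) -> int01 f = int01 g.
Proof. by move=> fg; apply: eq_Rintegral => t; rewrite inE /= in_itv /=; exact: fg. Qed.

Lemma int01_le f (c : R) : cont01 f -> (forall t : R, 0 <= t <= 1 -> `|f t| <= c) -> `|int01 f| <= c.
Proof.
move=> cf fc; apply: le_trans (le_normr_Rintegral _ (cont01_integrable cf)) _ => //.
have -> : c = int01 (fun=> c).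
  rewrite /int01 Rintegral_cst //.
  have E : mu `[(0 : R), 1] = 1%E by rewrite lebesgue_measure_itv /= lte_fin ltr01 oppr0 adde0.
  by rewrite -[LHS]mulr1; congr (_ * _); rewrite [X in fine X]E.
apply: le_Rintegral => //.
- apply: (@cont01_integrable (fun t => `|f t|)) => t t01.
  by apply: continuous_comp; [exact: cf|exact: norm_continuous].
- by apply: (@cont01_integrable (fun=> c)) => t _; exact: cst_continuous.
Qed.

Lemma int01_derive (F f : R -> R) : cont01 f -> (forall t : R, 0 <= t <= 1 -> is_derive t 1 F (f t)) ->
  int01 f = F 1 - F 0.
Proof.
move=> cf dF; rewrite /int01 /Rintegral (@continuous_FTC2 _ f F) //.
- exact: cont01_within.
- have cF (t : R) : 0 <= t <= 1 -> {for t, continuous F}.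
    move=> t01; apply: differentiable_continuous; apply/derivable1_diffP.
    exact: (@ex_derive _ _ _ _ _ _ _ (dF t t01)).
  split.
  + move=> t; rewrite in_itv /= => /andP[t0 t1].
    by apply: (@ex_derive _ _ _ _ _ _ _ (dF t _)); rewrite !ltW.
  + by apply: cvg_at_right_filter; apply: cF; rewrite lexx ler01.
  + by apply: cvg_at_left_filter; apply: cF; rewrite lexx ler01.
- move=> t; rewrite in_itv /= => /andP[t0 t1].
  by rewrite derive1E; apply: (@derive_val _ _ _ _ _ _ _ (dF t _)); rewrite !ltW.
Qed.

End UnitIntegral.

Section Hadamard.
Variables (R : realType) (n k : nat).
Local Notation mat := 'M[R]_(n, k).
Variables (A : mat) (r : R).
Local Notation W := (ball A r).

Lemma mx_norm_entry (B : mat) i j : `|B i j| <= `|B|.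
Proof.
rewrite [leRHS]/Num.norm /= mx_normrE.
exact: (le_trans _ (le_bigmax _ (fun ij : 'I_n * 'I_k => `|B ij.1 ij.2|) (i, j))).
Qed.

Lemma linear_mx_continuous (L : {linear mat -> R}) : continuous L.
Proof.
rewrite (_ : (L : mat -> R) = fun B => \sum_i \sum_j B i j * L (delta_mx i j)).
  apply: continuous_sum => i _; apply: continuous_sum => j _ B.
  have cB := @coord_continuous R n k i j B.
  exact: (cvgM cB (cvg_cst _)).
apply/funext => B; rewrite {1}(matrix_sum_delta B) linear_sum; apply: eq_bigr => i _.
by rewrite linear_sum; apply: eq_bigr => j _; rewrite linearZ.
Qed.

Definition seg (t : R) (B : mat) := t *: (B - A) + A.

Lemma seg_ball (t : R) B : 0 <= t <= 1 -> W B -> W (seg t B).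
Proof.
move=> /andP[t0 t1]; rewrite -ball_normE /= /seg distrC => h.
rewrite opprD addrCA subrr addr0 normrN normrZ ger0_norm //.
by apply: le_lt_trans h; rewrite ler_piMl.
Qed.

Lemma seg_cont (Phi : mat -> R) (t : R) B : (forall C, W C -> {for C, continuous Phi}) ->
  0 <= t <= 1 -> W B ->
  Phi (seg z.1 z.2) @[z --> (t, B)] --> Phi (seg t B).
Proof.
move=> Pc t01 WB.
have sc : seg z.1 z.2 @[z --> (t, B)] --> seg t B.
  apply: cvgD; last exact: cvg_cst.
  by apply: cvgZ; [exact: cvg_fst|apply: cvgB; [exact: cvg_snd|exact: cvg_cst]].
exact: cvg_comp sc (Pc _ (seg_ball t01 WB)).
Qed.

(** The tube lemma over the compact interval of parameters. *)
Lemma seg_uniform (Phi : mat -> R) B eps : (forall C, W C -> {for C, continuous Phi}) ->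
  W B -> 0 < eps ->
  \forall C \near B, forall t : R, 0 <= t <= 1 -> `|Phi (seg t C) - Phi (seg t B)| < eps.
Proof.
move=> Pc WB e0.
have /compact_near_coveringP cov := @segment_compact R 0 1.
have : \forall C \near B, `[0, 1] `<=` [set t | `|Phi (seg t C) - Phi (seg t B)| < eps].
  apply: (cov mat (nbhs B) (fun C t => `|Phi (seg t C) - Phi (seg t B)| < eps)) => t.
  rewrite /= in_itv /= => t01.
  have h1 := seg_cont Pc t01 WB.
  have h2 : (Phi (seg z.1 B)) @[z --> (t, B)] --> Phi (seg t B).
    have sc : seg z.1 B @[z --> (t, B)] --> seg t B.
      apply: cvgD; last exact: cvg_cst.
      by apply: cvgZ; [exact: cvg_fst|exact: cvg_cst].
    exact: cvg_comp sc (Pc _ (seg_ball t01 WB)).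
  have h0 : (Phi (seg z.1 z.2) - Phi (seg z.1 B)) @[z --> (t, B)] --> (0 : R).
    by rewrite -[X in _ --> X](subrr (Phi (seg t B))); exact: cvgB.
  by move/cvgr0Pnorm_lt: h0 => /(_ _ e0).
by apply: filterS => C h t t01; apply: h; rewrite /= in_itv.
Qed.

(** The power of t makes the family closed under differentiation: each derivative in B brings out
    one factor t, so smoothness follows by induction for all [q] at once. *)
Definition seg_int (q : nat) (Phi : mat -> R) (B : mat) : R :=
  int01 (fun t => t ^+ q * Phi (seg t B)).

Lemma seg_cont01 q (Phi : mat -> R) B : (forall C, W C -> {for C, continuous Phi}) ->
  W B -> cont01 (fun t => t ^+ q * Phi (seg t B)).
Proof.
move=> Pc WB t t01; apply: cvgM; first exact: exprn_continuous.
have sc : seg z B @[z --> t] --> seg t B.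
  by apply: cvgD; [apply: cvgZ; [exact: cvg_id|exact: cvg_cst]|exact: cvg_cst].
exact: cvg_comp sc (Pc _ (seg_ball t01 WB)).
Qed.

Lemma seg_int_cont q (Phi : mat -> R) B : (forall C, W C -> {for C, continuous Phi}) ->
  W B -> {for B, continuous (seg_int q Phi)}.
Proof.
move=> Pc WB; apply/(cvgrPdistC_le (F := nbhs (B : mat))) => eps e0.
have WC : \forall C \near B, W C by apply: open_nbhs_nbhs; split=> //; exact: ball_open.
apply: filterS2 WC (seg_uniform Pc WB e0) => C WC h.
rewrite /seg_int -int01B; try exact: seg_cont01.
apply: int01_le => [t t01|t t01].
  by apply: continuousB; apply: seg_cont01.
rewrite -mulrBr normrM; apply: le_trans (ler_wpM2l (normr_ge0 _) (ltW (h t t01))) _.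
case/andP: t01 => t0 t1; rewrite ger0_norm ?exprn_ge0 // ler_piMl ?exprn_ile1 //; exact: ltW.
Qed.

Lemma seg_move (s t : R) (B h : mat) : seg t (B + s *: h) = s *: (t *: h) + seg t B.
Proof.
by rewrite /seg addrAC scalerDr !scalerA [t * s]mulrC addrA [_ + t *: (B - A)]addrC.
Qed.

Lemma deriveZdir (Phi : mat -> R) C (a : R) h : differentiable Phi C ->
  'D_(a *: h) Phi C = a * 'D_h Phi C.
Proof. by move=> dP; rewrite !deriveE // linearZ. Qed.

Lemma is_derive_line (Phi : mat -> R) (C h : mat) (s : R) : differentiable Phi (s *: h + C) ->
  is_derive s (1 : R) (fun s => Phi (s *: h + C)) ('D_h Phi (s *: h + C)).
Proof.
move=> dP; have E : (fun e : R => e^-1 *: (((fun s => Phi (s *: h + C)) \o shift s) (e *: (1 : R)) -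
    Phi (s *: h + C))) = fun e => e^-1 *: ((Phi \o shift (s *: h + C)) (e *: h) - Phi (s *: h + C)).
  by apply/funext => e /=; rewrite [e%:A]mulr1 scalerDl addrA.
by apply: DeriveDef; rewrite /derivable /derive E //; exact: diff_derivable.
Qed.

(** Differentiation under the integral sign: the mean value theorem on each segment, with the
    partial derivatives close to those at B uniformly in t. *)
Lemma seg_int_diff q (Phi : mat -> R) B : (forall C, W C -> differentiable Phi C) ->
  (forall v C, W C -> {for C, continuous ('D_v Phi)}) -> W B ->
  differentiable (seg_int q Phi) B /\
  forall v, 'D_v (seg_int q Phi) B = seg_int q.+1 ('D_v Phi) B.
Proof.
move=> dP Dc WB; pose L h := seg_int q.+1 ('D_h Phi) B.
have Pc C : W C -> {for C, continuous Phi}.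
  by move=> WC; apply: differentiable_continuous; exact: dP.
have Llin : linear_for *%R L.
  move=> a u v; rewrite /L /seg_int -int01Z; last exact: seg_cont01 (Dc u) WB.
  rewrite -int01D; last exact: seg_cont01 (Dc v) WB.
    apply: eq_int01 => t t01; have d := dP _ (seg_ball t01 WB).
    by rewrite !deriveE // linearP /= mulrDr mulrCA.
  move=> t t01; have h := seg_cont01 (q := q.+1) (Dc u) WB t01.
  exact: (cvgM (cvg_cst a) h).
pose HL := GRing.isLinear.Build _ _ _ _ L Llin.
pose LL : {linear mat -> R} := HB.pack L HL.
have [|dI DI] := @differentiable_approx R mat (seg_int q Phi) LL B (@linear_mx_continuous LL).
  (* The error is a sum over n k entries; the successor keeps the divisor positive. *)
  move=> eps e0; pose N : R := (n * k).+1%:R; have N0 : 0 < N by rewrite ltr0n.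
  have eN : 0 < eps / N by exact: divr_gt0.
  have U : \forall C \near B, W C /\ forall ij : 'I_n * 'I_k, forall t : R, 0 <= t <= 1 ->
      `|'D_(delta_mx ij.1 ij.2) Phi (seg t C) - 'D_(delta_mx ij.1 ij.2) Phi (seg t B)| < eps / N.
    have WC : \forall C \near B, W C by apply: open_nbhs_nbhs; split=> //; exact: ball_open.
    apply: filterS2 WC _ => [C WC h|]; first by split=> //; exact: h.
    have h (ij : 'I_n * 'I_k) := seg_uniform (Dc (delta_mx ij.1 ij.2)) WB eN.
    exact: filter_forall h.
  move/nbhs_ballP: U => [d d0 hd]; apply/nbhs_ballP; exists d => // h.
  rewrite -ball_normE /= sub0r normrN => hlt.
  have inball (s : R) : 0 <= s <= 1 -> ball B d (B + s *: h).
    move=> /andP[s0 s1]; rewrite -ball_normE /= opprD addrA subrr sub0r normrN normrZ ger0_norm //.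
    by apply: le_lt_trans hlt; rewrite ler_piMl.
  have WBh : W (B + h).
    by have [] := hd (B + 1 *: h) (inball 1 _); rewrite ?ler01 ?lexx // scale1r.
  rewrite [h + B]addrC /= /L /seg_int -int01B; try exact: seg_cont01.
  have cBh := seg_cont01 (q := q) Pc WBh; have cB := seg_cont01 (q := q) Pc WB.
  have cD := seg_cont01 (q := q.+1) (Dc h) WB.
  have cBB : cont01 (fun t => t ^+ q * Phi (seg t (B + h)) - t ^+ q * Phi (seg t B)).
    by move=> t t01; exact: cvgB (cBh t t01) (cB t t01).
  rewrite -(int01B cBB cD).
  apply: int01_le => [t t01|t t01].
    exact: cvgB (cBB t t01) (cD t t01).
  have [t0 t1] := andP t01.
  have [c c01 E] : exists2 c, c \in `[0 : R, 1] & Phi (seg t (B + h)) - Phi (seg t B) =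
      t * 'D_h Phi (seg t (B + c *: h)).
    have dseg (s : R) : 0 <= s <= 1 -> is_derive s (1 : R) (fun s => Phi (s *: (t *: h) + seg t B))
        ('D_(t *: h) Phi (s *: (t *: h) + seg t B)).
      move=> s01; apply: is_derive_line; rewrite -seg_move; apply: dP; apply: seg_ball => //.
      by have [] := hd _ (inball s s01).
    have [|||c c01 E] := @MVT_segment R (fun s => Phi (s *: (t *: h) + seg t B))
      (fun s => 'D_(t *: h) Phi (s *: (t *: h) + seg t B)) 0 1.
    - exact: ler01.
    - by move=> s; rewrite in_itv /= => /andP[s0 s1]; apply: dseg; rewrite !ltW.
    - apply: cont01_within => s s01; apply: differentiable_continuous; apply/derivable1_diffP.
      exact: (@ex_derive _ _ _ _ _ _ _ (dseg s s01)).
    exists c => //; move: E; rewrite scale0r add0r subr0 mulr1 -!seg_move scale1r => ->.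
    rewrite deriveZdir //; apply: dP; apply: seg_ball => //.
    by have [] := hd _ (inball c _); rewrite // -in_itv.
  have {}c01 : 0 <= c <= 1 by move: c01; rewrite in_itv.
  have [Wc hc] := hd _ (inball c c01).
  have dc := dP _ (seg_ball t01 Wc); have dB := dP _ (seg_ball t01 WB).
  have -> : t ^+ q * Phi (seg t (B + h)) - t ^+ q * Phi (seg t B) - t ^+ q.+1 * 'D_h Phi (seg t B) =
    t ^+ q.+1 * \sum_i \sum_j h i j * ('D_(delta_mx i j) Phi (seg t (B + c *: h)) -
       'D_(delta_mx i j) Phi (seg t B)).
    rewrite -mulrBr E mulrA -exprSr -mulrBr; congr (_ * _).
    rewrite !derive_delta // -sumrB; apply: eq_bigr => i _; rewrite -sumrB.
    by apply: eq_bigr => j _; rewrite mulrBr.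
  rewrite normrM ger0_norm ?exprn_ge0 //.
  set S := \sum_i _; apply: (@le_trans _ _ `|S|); first by rewrite ler_piMl // exprn_ile1.
  apply: (@le_trans _ _ (\sum_(i < n) \sum_(j < k) `|h| * (eps / N))).
    apply: le_trans (ler_norm_sum _ _ _) _; apply: ler_sum => i _.
    apply: le_trans (ler_norm_sum _ _ _) _; apply: ler_sum => j _.
    rewrite normrM ler_pM ?mx_norm_entry //; exact: ltW (hc (i, j) t t01).
  rewrite !sumr_const !card_ord -mulrnA mulnC -mulr_natr.
  have -> : `|h| * (eps / N) * (n * k)%:R = eps * `|h| * ((n * k)%:R / N).
    by rewrite -!mulrA [LHS]mulrCA; congr (_ * _); congr (_ * _); rewrite mulrC.
  apply: ler_piMr; first by apply: mulr_ge0 => //; exact: ltW.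
  by rewrite ler_pdivrMr // mul1r ler_nat.
by split=> // v; rewrite deriveE // DI.
Qed.

Lemma seg_int_smooth (Phi : mat -> R) q : smooth_fun W Phi -> smooth_fun W (seg_int q Phi).
Proof.
move=> sP r'; elim: r' q Phi sP => [|r' IH] q Phi sP /=.
  by move=> C WC; apply: seg_int_cont => // D WD; exact: smooth_fun_continuous sP WD.
have dP C : W C -> differentiable Phi C by exact: smooth_fun_diff.
have Dc v C : W C -> {for C, continuous ('D_v Phi)}.
  exact: smooth_fun_continuous (smooth_fun_derive v sP).
split=> [C WC|v]; first by have [] := seg_int_diff q dP Dc WC.
apply: (cont_diff_eq (ball_open _ _) (@subset_refl _ _) _ (IH q.+1 _ (smooth_fun_derive v sP))).
by move=> C /set_mem WC; have [_ ->] := seg_int_diff q dP Dc WC.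
Qed.

Lemma hadamard (G : mat -> R) : smooth_fun W G -> exists h : 'I_n -> 'I_k -> mat -> R,
  (forall i j, smooth_fun W (h i j)) /\
  forall B, W B -> G B - G A = \sum_i \sum_j (B i j - A i j) * h i j B.
Proof.
move=> sG; exists (fun i j => seg_int 0 ('D_(delta_mx i j) G)); split=> [i j|B WB].
  by apply: seg_int_smooth; exact: smooth_fun_derive.
have dG C : W C -> differentiable G C by exact: smooth_fun_diff.
have Dc v C : W C -> {for C, continuous ('D_v G)}.
  exact: smooth_fun_continuous (smooth_fun_derive v sG).
have c1 v := seg_cont01 (q := 0) (Dc v) WB.
have E v : int01 (fun t => 'D_v G (seg t B)) = seg_int 0 ('D_v G) B.
  by apply: eq_int01 => t _; rewrite expr0 mul1r.
have c0 v : cont01 (fun t => 'D_v G (seg t B)).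
  move=> t t01; have := c1 v t t01; rewrite (_ : (fun t => _) = fun t => 'D_v G (seg t B)) //.
  by apply/funext => s; rewrite expr0 mul1r.
have -> : G B - G A = int01 (fun t => 'D_(B - A) G (seg t B)).
  have dseg (t : R) : 0 <= t <= 1 ->
      is_derive t (1 : R) (fun t => G (seg t B)) ('D_(B - A) G (seg t B)).
    by move=> t01; apply: is_derive_line; apply: dG; exact: seg_ball.
  by rewrite (int01_derive (c0 (B - A)) dseg) /seg scale1r scale0r add0r subrK.
pose f i j t := (B i j - A i j) * 'D_(delta_mx i j) G (seg t B).
have fc i j : cont01 (f i j) by move=> t t01; exact: cvgM (cvg_cst _) (c0 _ t t01).
have sumc (I : Type) (s : seq I) (F : I -> R -> R) : (forall i, cont01 (F i)) ->
    cont01 (fun t => \sum_(i <- s) F i t) /\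
    int01 (fun t => \sum_(i <- s) F i t) = \sum_(i <- s) int01 (F i).
  move=> cF; elim: s => [|i s [cs Es]].
    rewrite (_ : (fun t => _) = fun=> 0); last by apply/funext => t; rewrite big_nil.
    split; first by move=> t _; exact: cvg_cst.
    have c00 : cont01 (fun=> 0 : R) by move=> t _; exact: cvg_cst.
    rewrite big_nil -[RHS](mul0r (int01 (fun=> 0))) -int01Z //.
    by apply: eq_int01 => t _; rewrite mulr0.
  rewrite (_ : (fun t => _) = fun t => F i t + \sum_(j <- s) F j t); last first.
    by apply/funext => t; rewrite big_cons.
  split; first by move=> t t01; exact: cvgD (cF i t t01) (cs t t01).
  by rewrite int01D // Es big_cons.
transitivity (int01 (fun t => \sum_i \sum_j f i j t)).
  apply: eq_int01 => t t01; rewrite derive_delta; last by apply: dG; exact: seg_ball.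
  by apply: eq_bigr => i _; apply: eq_bigr => j _; rewrite /f !mxE.
rewrite (sumc _ _ _ (fun i => (sumc _ _ _ (fc i)).1)).2.
apply: eq_bigr => i _; rewrite (sumc _ _ _ (fc i)).2; apply: eq_bigr => j _.
by rewrite /f int01Z // E.
Qed.

End Hadamard.

(** * Bump functions and derivations *)

Section Bump.
Variable R : realType.

(* A family closed under differentiation. *)
Definition flat (q : nat) (x : R) : R := if 0 < x then x^-1 ^+ q * expR (- x^-1) else 0.

(** For x > 0 and y = 1/x, the exponential of y is at least y^(q+1) / (q+1)!. *)
Lemma flat_le q x : `|flat q x| <= q.+1`!%:R * `|x|.
Proof.
rewrite /flat; case: ifPn => [x0|_]; last by rewrite normr0 mulr_ge0.
have y0 : 0 < x^-1 by rewrite invr_gt0.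
rewrite !gtr0_norm ?mulr_gt0 ?exprn_gt0 ?expR_gt0 //.
have -> : x^-1 ^+ q * expR (- x^-1) = (x^-1 ^+ q.+1 / expR x^-1) * x.
  by rewrite exprSr expRN [RHS]mulrAC -[_ * _ * x]mulrA mulVf ?gt_eqF // mulr1.
apply: ler_wpM2r; first exact: ltW.
rewrite ler_pdivrMr ?expR_gt0 //.
rewrite -ler_pdivrMl ?ltr0n ?fact_gt0 // mulrC.
by apply: le_trans (expR_ge1Dxn q (ltW y0)); rewrite lerDr.
Qed.

Lemma flat_cvg0 q : flat q x @[x --> (0 : R)] --> (0 : R).
Proof.
apply/(cvgr0Pnorm_le (F := nbhs (0 : R))) => eps e0.
have F0 : 0 < q.+1`!%:R :> R by rewrite ltr0n fact_gt0.
have : \forall x \near (0 : R), `|x| <= eps / q.+1`!%:R by apply: nbhs0_le; exact: divr_gt0.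
apply: filterS => x; rewrite ler_pdivlMr // mulrC; exact: le_trans (flat_le q x).
Qed.

(** Away from 0 this is calculus; at 0 the difference quotient of [flat q] is [flat q.+1], which
    tends to 0. *)
Lemma is_derive_flat q (x : R) :
  is_derive x (1 : R) (flat q) (- (q%:R * flat q.+1 x) + flat q.+2 x).
Proof.
case: (ltgtP x 0) => [x0|x0|->].
- have -> : - (q%:R * flat q.+1 x) + flat q.+2 x = 0.
    by rewrite /flat ltNge ltW //= mulr0 oppr0 addr0.
  apply: (@near_eq_is_derive _ _ _ (fun=> 0 : R)).
  have : \forall y \near x, y < 0 by exact: lt_nbhsl.
  by apply: filterS => y y0; rewrite /flat ltNge ltW.
- have N : \forall y \near x, y^-1 ^+ q * expR (- y^-1) = flat q y.
    have : \forall y \near x, 0 < y by exact: lt_nbhsr.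
    by apply: filterS => y y0; rewrite /flat y0.
  have xn0 : x != 0 by rewrite gt_eqF.
  have dV : is_derive x (1 : R) (fun y : R => y^-1) (- x ^- 2).
    have := @is_deriveV R id x 1 1 xn0 (is_derive_id _ _).
    by rewrite /GRing.scale /= mulr1.
  have dX : is_derive x (1 : R) (fun y : R => y^-1 ^+ q) ((q%:R * x^-1 ^+ q.-1) * - x ^- 2).
    rewrite (_ : (fun y => _) = (fun y : R => y^-1) ^+ q); last by apply/funext => y; rewrite exprfctE.
    exact: (@is_deriveX R R (fun y : R => y^-1) q x 1 _ dV).
  have dE : is_derive x (1 : R) (fun y : R => expR (- y^-1)) (expR (- x^-1) * - - x ^- 2).
    exact: (@is_derive1_comp _ expR (fun y => - y^-1) x _ _ (is_derive_expR _) (is_deriveN dV)).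
  have := is_deriveM dX dE; rewrite /GRing.scale /= => h; apply: is_derive_eq (near_eq_is_derive N h) _.
  rewrite /flat x0 opprK -exprVn; case: (q) => [|p] /=.
    by rewrite expr0 !mul0r mulr0 addr0 oppr0 add0r mul1r mulrC.
  by rewrite !exprS; ring.
- have -> : - (q%:R * flat q.+1 0) + flat q.+2 0 = 0 by rewrite /flat ltxx mulr0 oppr0 addr0.
  have lim : h^-1 *: ((flat q \o shift 0) (h *: 1) - flat q 0) @[h --> 0^'] --> (0 : R).
    have : flat q.+1 h @[h --> 0^'] --> (0 : R).
      by apply: cvg_trans (flat_cvg0 q.+1); apply: cvg_app; exact: cvg_within.
    apply: cvg_trans; apply: near_eq_cvg; near=> h.
    rewrite /= addr0 [h%:A]mulr1 /flat ltxx subr0; case: ifP => _; last by rewrite scaler0.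
    by rewrite /GRing.scale /= mulrA -exprS.
  apply: DeriveDef; first by apply/cvg_ex; exists 0.
  exact: cvg_lim lim.
Unshelve. all: by end_near. Qed.

Lemma flat_comp_smooth (V : normedModType R) (u : V -> R) q : smooth_fun setT u ->
  smooth_fun setT (fun x => flat q (u x)).
Proof.
move=> su r; elim: r q => [|r IH] q /=.
  move=> x _; apply: (@continuous_comp _ _ _ u (flat q)); first exact: smooth_fun_continuous su I.
  apply: differentiable_continuous; apply/derivable1_diffP.
  exact: (@ex_derive _ _ _ _ _ _ _ (is_derive_flat q (u x))).
have df p x : differentiable (flat p) (u x).
  by apply/derivable1_diffP; exact: (@ex_derive _ _ _ _ _ _ _ (is_derive_flat p (u x))).
have du x : differentiable u x by exact: smooth_fun_diff su I.
split=> [x _|v]; first exact: (differentiable_comp (du x) (df q x)).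
rewrite (_ : 'D_v _ = fun x => (- q%:R * flat q.+1 (u x) + flat q.+2 (u x)) * 'D_v u x).
  apply: cont_diffM; [exact: openT| |exact: smooth_fun_derive su r].
  apply: cont_diffD; [exact: openT| |exact: IH].
  by apply: cont_diffM; [exact: openT|exact: cont_diff_cst|exact: IH].
apply/funext => x; rewrite deriveE; last exact: (differentiable_comp (du x) (df q x)).
have -> : 'd (fun x => flat q (u x)) x = 'd (flat q) (u x) \o 'd u x :> (V -> R).
  exact: diff_comp (du x) (df q x).
have -> : ('d (flat q) (u x) \o 'd u x) v = 'd (flat q) (u x) ('D_v u x) by rewrite deriveE.
rewrite deriv1E; last by apply/derivable1_diffP; exact: df.
rewrite derive1E (@derive_val _ _ _ _ _ _ _ (is_derive_flat q (u x))) mulNr.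
by rewrite [LHS]mulrC.
Qed.

Section MatrixBump.
Variables (n k : nat) (A : 'M[R]_(n, k)) (eps : R).
Hypothesis eps_gt0 : 0 < eps.
Local Notation mat := 'M[R]_(n, k).

(** The squared Euclidean distance; the norm on matrices is the maximum norm, which is not
    smooth. *)
Let dist2 (B : mat) := \sum_i \sum_j (B i j - A i j) ^+ 2.

Let dist2_smooth : smooth_fun setT dist2.
Proof.
apply: smooth_fun_sum => [|i]; first exact: openT.
apply: smooth_fun_sum => [|j]; first exact: openT.
have h : smooth_fun setT (fun B : mat => B i j + - A i j).
  by apply: smooth_funD; [exact: openT|exact: smooth_fun_coord|exact: smooth_fun_cst].
exact: (smooth_funM openT h h).
Qed.

Definition bump (B : mat) : R := flat 0 (eps ^+ 2 - dist2 B).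

Lemma bump_smooth : smooth_fun setT bump.
Proof.
apply: flat_comp_smooth; apply: smooth_funD; [exact: openT|exact: smooth_fun_cst|].
rewrite (_ : (fun x => - _) = fun x => (-1) * dist2 x); last first.
  by apply/funext => x; rewrite mulN1r.
by apply: smooth_funM; [exact: openT|exact: smooth_fun_cst|].
Qed.

Lemma bump_center : 0 < bump A.
Proof.
rewrite /bump /dist2 big1 => [|i _]; last by rewrite big1 // => j _; rewrite subrr expr0n.
by rewrite subr0 /flat exprn_gt0 // expr0 mul1r expR_gt0.
Qed.

Lemma ball_entries (B : mat) (r : R) : 0 < r -> (forall i j, `|B i j - A i j| < r) -> ball A r B.
Proof.
move=> r0 h; rewrite -ball_normE /= distrC [ltLHS]/Num.norm /= mx_normrE.
by apply: bigmax_lt => // ij _; rewrite !mxE; exact: h.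
Qed.

Lemma dist2_entry (B : mat) i j : `|B i j - A i j| ^+ 2 <= dist2 B.
Proof.
rewrite /dist2 (bigD1 i) //= (bigD1 j) //= real_normK ?num_real // -addrA lerDl.
by apply: addr_ge0; apply: sumr_ge0 => l _; [exact: sqr_ge0|apply: sumr_ge0 => p _; exact: sqr_ge0].
Qed.

Lemma bump_ball (B : mat) : bump B != 0 -> ball A eps B.
Proof.
rewrite /bump /flat; case: ifPn => [h _|_]; last by rewrite eqxx.
apply: ball_entries => // i j.
rewrite -(@ltr_pXn2r _ 2) ?nnegrE // ?ltW //; apply: le_lt_trans (dist2_entry B i j) _.
by rewrite -subr_gt0.
Qed.

(** Two open sets cover all matrices: the ball of radius r, where both factors are smooth, and the
    region where [dist2] exceeds the square of [eps], where the product is zero. *)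
Lemma bumpM_smooth (u : mat -> R) (r : R) : eps < r -> smooth_fun (ball A r) u ->
  smooth_fun setT (fun B => bump B * u B).
Proof.
move=> er su; apply: smooth_fun_local => B _.
have [Br|Bn] := pselect (ball A r B).
  exists (ball A r); split=> //; first exact: ball_open.
  apply: smooth_funM => //; first exact: ball_open.
  by apply: smooth_funW bump_smooth => //; exact: ball_open.
exists (dist2 @^-1` [set x | eps ^+ 2 < x]); split.
- apply: open_comp; last exact: open_gt.
  by move=> C _; exact: smooth_fun_continuous dist2_smooth I.
- rewrite /= ltNge; apply/negP => h; apply: Bn; apply: ball_entries => [|i j].
    exact: lt_trans er.
  apply: le_lt_trans er; rewrite -(@ler_pXn2r _ 2) ?nnegrE ?(ltW eps_gt0) //.
  exact: le_trans (dist2_entry B i j) h.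
- apply: (@smooth_fun_eq _ _ setT _ (fun=> 0)); last exact: smooth_fun_cst.
  + apply: open_comp; last exact: open_gt.
    by move=> C _; exact: smooth_fun_continuous dist2_smooth I.
  + by [].
  + move=> C /set_mem /= h; rewrite /bump /flat subr_gt0 ltNge ltW //= mul0r //.
Qed.

End MatrixBump.

End Bump.

Section StiefelDerivations.
Variables (R : realType) (n k : nat).
Local Notation mat := 'M[R]_(n, k).
Local Notation PV := (projective_stiefel R n k).
Local Notation V := (fun A : mat => A^T *m A = 1%:M).
Local Notation smooth := (@smooth_on R PV setT).

Lemma close_opp (x y : R) : `|x - y| < `|x| -> `|x - - y| < `|x| -> False.
Proof.
rewrite !ltr_norml; case: (lerP 0 x) => x0; rewrite ?(ger0_norm x0) ?(ltr0_norm x0).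
  by move=> /andP[? ?] /andP[? ?]; lra.
by move=> /andP[? ?] /andP[? ?]; lra.
Qed.

Variables (p : PV) (D : (PV -> R) -> R).
Hypothesis D_der : derivation_at p D.

Lemma der_lin a f g : smooth f -> smooth g -> D (fun x => a * f x + g x) = a * D f + D g.
Proof. exact: D_der.1. Qed.

Lemma derM f g : smooth f -> smooth g -> D (fun x => f x * g x) = D f * g p + f p * D g.
Proof. exact: D_der.2. Qed.

Lemma der_cst c : D (fun=> c) = 0.
Proof.
have s a := smooth_onT_cst (R := R) (n := n) (k := k) a.
have D1 : D (fun=> 1) = 0 by have := derM (s 1) (s 1); rewrite mulr1; lra.
have D0 : D (fun=> 0) = 0 by have := der_lin (-1) (s 1) (s 1); rewrite mulr1 addNr D1; lra.
by have := der_lin c (s 1) (s 0); rewrite mulr1 addr0 D1 D0 mulr0 addr0.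
Qed.

Lemma derD f g : smooth f -> smooth g -> D (fun x => f x + g x) = D f + D g.
Proof.
move=> sf sg; rewrite -[D f in RHS]mul1r -der_lin //; congr D.
by apply/funext => x; rewrite mul1r.
Qed.

Lemma der_sum I (s : seq I) (F : I -> PV -> R) : (forall i, smooth (F i)) ->
  D (fun x => \sum_(i <- s) F i x) = \sum_(i <- s) D (F i).
Proof.
move=> sF; elim: s => [|i s IH].
  rewrite big_nil -[RHS](der_cst 0); congr D; apply/funext => x; exact: big_nil.
rewrite big_cons -IH -derD //; last exact: smooth_onT_sum.
by congr D; apply/funext => x; rewrite big_cons.
Qed.

(** Symmetrization lets a function of matrices descend to the quotient; for one supported near a
    single frame nothing is lost. *)
Definition even_part (w : mat -> R) (q : PV) : R :=
  w (set_val (repr q)) + w (- set_val (repr q)).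

Lemma even_part_prs w A : even_part w (prs A) = w (set_val A) + w (- set_val A).
Proof.
rewrite /even_part; have : prs (repr (prs A)) = prs A by exact: reprK.
by case/prs_eq => ->; rewrite ?opprK // addrC.
Qed.

Lemma even_part_smooth w : smooth_fun setT w -> smooth (even_part w).
Proof.
move=> sw; apply/smooth_onP => A; exists (fun B => w B + w (- B)), setT; split=> //.
- exact: openT.
- apply: smooth_funD => //; first exact: openT.
  by have := smooth_opp sw; rewrite preimage_setT.
- by move=> y _; rewrite even_part_prs.
Qed.

(** By Hadamard's lemma, g - g p is near p a sum of (B_ij - A_ij) h_ij. Single entries do not
    descend to the quotient, but cut off by a bump function they do, and D is shown to kill the
    cut-off differences [d i j], which also vanish at p. *)
Lemma derivation_eq0 : (0 < k)%N -> (forall a b, D (quad a b) = 0) ->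
  forall g, smooth g -> D g = 0.
Proof.
move=> k0 DE g sg; have [A pA] := prs_surj p.
have [a a0] := entry_neq0 k0 (stiefel_valP A); set A' := set_val A in a0.
have [G [W [Wo WA sG gG]]] := (smooth_onP g).1 sg A.
have [r1 r10 Wr1] : exists2 r, 0 < r & ball A' r `<=` W.
  by have /nbhs_ballP[r r0 h] : nbhs A' W by [exact: open_nbhs_nbhs]; exists r.
(* A radius of at most |A_a| prevents the ball around A from containing both B and -B; this is
   [bN]. *)
pose r := Num.min r1 `|A' a.1 a.2|; have r0 : 0 < r by rewrite lt_min r10 normr_gt0.
have Wr : ball A' r `<=` W.
  by apply: subset_trans Wr1; apply: le_ball; rewrite ge_min lexx.
have [h [sh Gh]] := hadamard (smooth_funW (ball_open _ _) Wr sG).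
pose e := r / 2; have e0 : 0 < e by rewrite divr_gt0.
have er : e < r by rewrite ltr_pdivrMr // ltr_pMr // ltr1n.
pose b := bump A' e; have b0 : 0 < b A' by exact: bump_center.
have bball B : b B != 0 -> ball A' r B.
  by move=> /(bump_ball e0); apply: le_ball; exact: ltW.
have bN B : b B * b (- B) = 0.
  apply/eqP; rewrite mulf_eq0; apply/negPn/negP; rewrite negb_or => /andP[/bball h1 /bball h2].
  have ent C : ball A' r C -> `|A' a.1 a.2 - C a.1 a.2| < `|A' a.1 a.2|.
    rewrite -ball_normE /= => hC; apply: (lt_le_trans (y := r)); last by rewrite ge_min lexx orbT.
    by apply: le_lt_trans hC; have := mx_norm_entry (A' - C) a.1 a.2; rewrite !mxE.
  by have := ent _ h2; rewrite mxE; exact: close_opp (ent _ h1).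
have bNA : b (- A') = 0.
  by have /eqP := bN A'; rewrite mulf_eq0 gt_eqF //= => /eqP.
pose psi := even_part b.
pose c i j := even_part (fun B => b B * B i j).
pose d i j := even_part (fun B => b B * (B i j - A' i j)).
pose H i j := even_part (fun B => b B * h i j B).
have sb : smooth_fun setT b by exact: bump_smooth.
have spsi : smooth psi by exact: even_part_smooth.
have sc i j : smooth (c i j).
  by apply: even_part_smooth; apply: smooth_funM => //; [exact: openT|exact: smooth_fun_coord].
have sd i j : smooth (d i j).
  apply: even_part_smooth; apply: smooth_funM => //; first exact: openT.
  by apply: smooth_funD; [exact: openT|exact: smooth_fun_coord|exact: smooth_fun_cst].
have sH i j : smooth (H i j).
  by apply: even_part_smooth; apply: (bumpM_smooth e0 er); exact: sh.
have psip : psi p = b A' by rewrite /psi -pA even_part_prs bNA addr0.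
have cp i j : c i j p = b A' * A' i j by rewrite /c -pA even_part_prs bNA mul0r addr0.
have dp i j : d i j p = 0 by rewrite /d -pA even_part_prs bNA mul0r addr0 subrr mulr0.
(* As the cross terms vanish by [bN], products of cut-off entries are multiples of the functions
   [quad]. Applying D determines its values on the cut-off entries: they are D psi times the entries
   of A. *)
have cE x y : (fun q => c x.1 x.2 q * c y.1 y.2 q) = fun q => psi q * psi q * quad x y q.
  apply/funext => q; have [B <-] := prs_surj q.
  rewrite /c /psi !even_part_prs quad_prs !mxE; set B' := set_val B.
  have := bN B'; move: (b B') (b (- B')) => s t st.
  transitivity ((s ^+ 2 + t ^+ 2 - 2 * (s * t)) * (B' x.1 x.2 * B' y.1 y.2)); first by ring.
  by rewrite st; transitivity ((s ^+ 2 + t ^+ 2 + 2 * (s * t)) * (B' x.1 x.2 * B' y.1 y.2));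
    [rewrite st; ring|ring].
pose dl := D psi.
have Dc x y : A' x.1 x.2 * D (c y.1 y.2) + A' y.1 y.2 * D (c x.1 x.2) = 2 * dl * A' x.1 x.2 * A' y.1 y.2.
  have := congr1 D (cE x y); rewrite derM //.
  rewrite derM //; [|exact: smooth_onTM|exact: quad_smooth].
  rewrite DE mulr0 addr0 derM // !cp psip -[X in quad _ _ X]pA quad_prs -/A' -/dl => E.
  by apply: (mulfI (lt0r_neq0 b0)); move: E; lra.
have Dca : D (c a.1 a.2) = dl * A' a.1 a.2.
  by apply: (mulfI a0); have := Dc a a; lra.
have Dcb i j : D (c i j) = dl * A' i j.
  by apply: (mulfI a0); have := Dc a (i, j); rewrite /= Dca; lra.
have Dd i j : D (d i j) = 0.
  have -> : d i j = fun q => (- A' i j) * psi q + c i j q.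
    apply/funext => q; have [B <-] := prs_surj q.
    by rewrite /d /psi /c !even_part_prs !mxE; ring.
  by rewrite der_lin // Dcb -/dl; ring.
(* Hadamard's formula multiplied by the squared cut-off. D annihilates the right-hand side, and the
   left-hand side gives psi(p)^2 D g. *)
have key : (fun q => psi q * psi q * (g q + - g p)) = fun q => \sum_i \sum_j d i j q * H i j q.
  apply/funext => q; have [B <-] := prs_surj q; set B' := set_val B.
  pose NB := mkst (mkst_opp (stiefel_valP B)).
  have loc (C : @stiefel_set R n k) : b (set_val C) ^+ 2 * (g (prs C) - g p) =
      \sum_i \sum_j b (set_val C) ^+ 2 * ((set_val C i j - A' i j) * h i j (set_val C)).
    have [z|/bball bC] := eqVneq (b (set_val C)) 0.
      by rewrite z expr0n mul0r big1 // => i _; rewrite big1 // => j _; rewrite mul0r.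
    rewrite gG; last exact: Wr.
    rewrite -pA gG // -/A' Gh // mulr_sumr; apply: eq_bigr => i _; exact: mulr_sumr.
  have bb := bN B'.
  transitivity (b B' ^+ 2 * (g (prs B) - g p) + b (- B') ^+ 2 * (g (prs NB) - g p)).
    have -> : prs NB = prs B by apply/prs_eq; right; rewrite /= opprK.
    rewrite /psi even_part_prs -/B'; transitivity ((b B' ^+ 2 + b (- B') ^+ 2 + 2 * (b B' * b (- B'))) * (g (prs B) - g p)); first by ring.
    by rewrite bb; ring.
  rewrite loc (loc NB) -/B' -big_split; apply: eq_bigr => i _; rewrite -big_split.
  apply: eq_bigr => j _ /=; rewrite /d /H !even_part_prs -/B' -[set_val NB]/(- B').
  move: bb; set s := b B'; set t := b (- B'); set u := _ - A' i j; set v := _ - A' i j => st.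
  transitivity (s ^+ 2 * (u * h i j B') + t ^+ 2 * (v * h i j (- B')) +
    (s * t) * (u * h i j (- B') + v * h i j B')); last by ring.
  by rewrite st mul0r addr0.
have := congr1 D key.
have scst := smooth_onT_cst (R := R) (n := n) (k := k) (- g p).
rewrite derM; [|exact: smooth_onTM|exact: smooth_onTD].
rewrite subrr mulr0 add0r derD // der_cst addr0 psip.
rewrite der_sum => [|i]; last first.
  by apply: smooth_onT_sum => j; exact: smooth_onTM.
rewrite big1 => [/eqP|i _].
  by rewrite mulf_eq0 mulf_eq0 orbb gt_eqF //= => /eqP.
rewrite der_sum => [|j]; last exact: smooth_onTM.
by rewrite big1 // => j _; rewrite derM // Dd dp !mul0r addr0.
Qed.

End StiefelDerivations.

(** * A skew embedding *)

Section SkewEmbedding.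
Variables (R : realType) (n k : nat).
Hypothesis k_gt0 : (0 < k)%N.
Local Notation mat := 'M[R]_(n, k).
Local Notation PV := (projective_stiefel R n k).
Local Notation V := (fun A : mat => A^T *m A = 1%:M).
Local Notation smooth := (@smooth_on R PV setT).

Definition quad_index : finType := (('I_n * 'I_k) * ('I_n * 'I_k))%type.
Definition mono_index : finType := (quad_index + quad_index * quad_index + quad_index)%type.

Definition qd (c : quad_index) : PV -> R := quad c.1 c.2.

Definition mono (t : mono_index) (p : PV) : R := match t with
  | inl (inl c) => qd c p
  | inl (inr c) => qd c.1 p * qd c.2 p
  | inr c => qd c p * qd c p * qd c p
  end.

Definition veronese (p : PV) : 'rV[R]_#|mono_index| := \row_j mono (enum_val j) p.

Lemma qd_smooth c : smooth (qd c). Proof. exact: quad_smooth. Qed.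

Lemma mono_smooth t : smooth (mono t).
Proof.
case: t => [[c|[c c']]|c] /=; first exact: qd_smooth.
  exact: (smooth_onTM (qd_smooth c) (qd_smooth c')).
exact: (smooth_onTM (smooth_onTM (qd_smooth c) (qd_smooth c)) (qd_smooth c)).
Qed.

Lemma coordinate_veronese j : coordinate veronese j = mono (enum_val j).
Proof. by apply/funext => p; rewrite /coordinate mxE. Qed.

Lemma veroneseE p t : veronese p 0 (enum_rank t) = mono t p.
Proof. by rewrite mxE enum_rankK. Qed.

Lemma differential_veronese D t : differential veronese D 0 (enum_rank t) = D (mono t).
Proof. by rewrite mxE coordinate_veronese enum_rankK. Qed.

Lemma mono_der p D t : derivation_at p D -> D (mono t) = match t with
  | inl (inl c) => D (qd c)
  | inl (inr c) => D (qd c.1) * qd c.2 p + qd c.1 p * D (qd c.2)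
  | inr c => 3 * qd c p ^+ 2 * D (qd c)
  end.
Proof.
move=> hD; case: t => [[c|[c c']]|c] //=; first exact: (derM hD (qd_smooth c) (qd_smooth c')).
have sc := qd_smooth c.
rewrite [LHS](derM hD (smooth_onTM sc sc) sc) (derM hD sc sc); ring.
Qed.

Lemma veronese_inj : injective veronese.
Proof.
move=> p q pq; apply: quad_inj => a b.
by have := congr1 (fun v : 'rV_ _ => v 0 (enum_rank (inl (inl (a, b)) : mono_index))) pq;
  rewrite !veroneseE.
Qed.

Lemma veronese_immersion : immersion veronese.
Proof.
split=> [j|p D hD d0]; first by rewrite coordinate_veronese; exact: mono_smooth.
apply: (derivation_eq0 hD k_gt0) => a b.
have := congr1 (fun v : 'rV_ _ => v 0 (enum_rank (inl (inl (a, b)) : mono_index))) d0.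
by rewrite differential_veronese mxE.
Qed.

Lemma qd_separates (p q : PV) : p <> q -> exists c, qd c p != qd c q.
Proof.
move=> pq; case: (pselect (exists c, qd c p != qd c q)) => // N; exfalso; apply: pq.
apply: quad_inj => a b; apply/eqP; apply/negPn/negP => h; by apply: N; exists (a, b).
Qed.

(* Cubic Hermite interpolation in one separating function [qd c] shows that the affine
   tangents are disjoint; quadratic functions suffice against parallel lines. *)
Lemma veronese_skew (p q : PV) : p <> q -> Defs.skew (affine_tangent veronese p) (affine_tangent veronese q).
Proof.
move=> pq; have [c abE] := qd_separates pq; split.
  apply/seteqP; split=> // v [[D hD <-]] [D' hD' E].
  have {}E t : mono t q + D' (mono t) = mono t p + D (mono t).
    have := congr1 (fun v : 'rV_ _ => v 0 (enum_rank t)) E.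
    by rewrite !mxE -!/(coordinate _ _) !coordinate_veronese !enum_rankK.
  have := E (inl (inl c)); have := E (inl (inr (c, c))); have := E (inr c).
  rewrite !(mono_der _ hD) !(mono_der _ hD') /=.
  move: (qd c p) (qd c q) (D (qd c)) (D' (qd c)) abE => a b al be ab e3 e2 e1.
  have beE : be = a + al - b by lra.
  have D0 : a - b != 0 by rewrite subr_eq0.
  have h2 : a - b + 2 * al = 0.
    by apply: (mulfI D0); rewrite mulr0; move: e2; rewrite beE => e2; lra.
  have h3 : (a - b) * (a + 2 * b) + 3 * al * (a + b) = 0.
    by apply: (mulfI D0); rewrite mulr0; move: e3; rewrite beE => e3; lra.
  have : (a - b) * (a - b) = 0.
    have alE : al = (b - a) / 2 by lra.
    move: h3; rewrite alE => h3; lra.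
  by move=> /eqP; rewrite mulf_eq0 (negbTE D0).
have tan (r : PV) x u : line x u `<=` affine_tangent veronese r ->
    exists2 D, derivation_at r D & u = differential veronese D.
  move=> h; have [|D1 hD1 E1] := h (x + 0 *: u); first by exists 0.
  have [|D2 hD2 E2] := h (x + 1 *: u); first by exists 1.
  exists (fun g => D2 g - D1 g).
    split=> [a f g sf sg|f g sf sg]; first by rewrite hD1.1 // hD2.1 //; ring.
    by rewrite hD1.2 // hD2.2 //; ring.
  apply/rowP => j; rewrite mxE; have := congr1 (fun v : 'rV_ _ => v 0 j) E1.
  have := congr1 (fun v : 'rV_ _ => v 0 j) E2; rewrite !mxE; lra.
move=> [x [y [u [u0 /tan[D hD uD] /tan[D' hD' uD']]]]].
have E t : D (mono t) = D' (mono t).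
  by rewrite -!differential_veronese -uD -uD'.
have D0 : qd c p - qd c q != 0 by rewrite subr_eq0.
have Dc : D (qd c) = 0.
  have := E (inl (inl c)); have := E (inl (inr (c, c))).
  rewrite !(mono_der _ hD) !(mono_der _ hD') /= => e2 e1; rewrite -e1 in e2.
  by apply: (mulfI D0); lra.
have Dq y' : D (qd y') = 0.
  have Dc' : D' (qd c) = 0.
    by have := E (inl (inl c)); rewrite !(mono_der _ hD) !(mono_der _ hD') /= Dc.
  have := E (inl (inl y')); have := E (inl (inr (y', c))).
  rewrite !(mono_der _ hD) !(mono_der _ hD') /= Dc Dc' !mulr0 !addr0 => e2 e1.
  by rewrite -e1 in e2; apply: (mulfI D0); lra.
move/eqP: u0; apply; rewrite uD; apply/rowP => j; rewrite mxE coordinate_veronese mxE.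
rewrite (mono_der _ hD); case: (enum_val j) => [[i|[i i']]|i] /=; rewrite ?Dq ?mulr0 ?mul0r ?addr0 //.
Qed.

Definition mono_lift (t : mono_index) (B : mat) : R :=
  let e (c : quad_index) := B c.1.1 c.1.2 * B c.2.1 c.2.2 in
  match t with
  | inl (inl c) => e c
  | inl (inr c) => e c.1 * e c.2
  | inr c => e c * e c * e c
  end.

Definition veronese_lift (B : mat) : 'rV[R]_#|mono_index| := \row_j mono_lift (enum_val j) B.

Lemma veronese_prs A : veronese (prs A) = veronese_lift (set_val A).
Proof.
apply/rowP => j; rewrite !mxE; case: (enum_val j) => [[c|[c c']]|c];
  by rewrite /mono /mono_lift /qd !quad_prs.
Qed.

Lemma veronese_lift_continuous : continuous veronese_lift.
Proof.
apply: mx_continuousE => i j; rewrite (_ : (fun x => _) = mono_lift (enum_val j)); last first.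
  by apply/funext => B; rewrite mxE.
have ec (c : quad_index) : continuous (fun B : mat => B c.1.1 c.1.2 * B c.2.1 c.2.2).
  by move=> B; exact: (cvgM (@coord_continuous R n k c.1.1 c.1.2 B) (@coord_continuous R n k c.2.1 c.2.2 B)).
case: (enum_val j) => [[c|[c c']]|c] B; first exact: ec.
  exact: (cvgM (ec c B) (ec c' B)).
exact: (cvgM (cvgM (ec c B) (ec c B)) (ec c B)).
Qed.

Lemma closed_stiefel : closed (@stiefel_set R n k).
Proof.
have c : continuous (fun A : mat => A^T *m A).
  have idc : mx_continuous (id : mat -> mat) by move=> i j; exact: coord_continuous.
  apply: mx_continuousE; exact: (mx_continuousM (mx_continuous_tr idc) idc).
rewrite (_ : @stiefel_set R n k = (fun A : mat => A^T *m A) @^-1` [set 1%:M]) //.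
apply: preimage_closed => [A _|]; first exact: c.
by apply: accessible_closed_set1; apply: hausdorff_accessible; exact: norm_hausdorff.
Qed.

Lemma compact_stiefel (C : set mat) : closed C -> C `<=` @stiefel_set R n k -> compact C.
Proof.
move=> Cc CV; pose C' := [set v : 'rV[R]_(n * k) | C (vec_mx v)].
have vc : continuous (vec_mx : 'rV[R]_(n * k) -> mat).
  apply: mx_continuousE => i j; rewrite (_ : (fun x => _) = fun v : 'rV[R]__ => v 0 (mxvec_index i j)).
    exact: coord_continuous.
  by apply/funext => v; rewrite mxE.
have -> : C = vec_mx @` C'.
  apply/seteqP; split=> [A CA|_ [v Cv <-]] //.
  by exists (mxvec A); rewrite /C' /= mxvecK.
apply: continuous_compact; first exact: continuous_subspaceT.
apply: bounded_closed_compact; last by apply: preimage_closed => // v _; exact: vc.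
exists 1; split=> // M M1 v /CV Vv; rewrite /= [leLHS]/Num.norm /= mx_normrE.
apply: bigmax_le => [|[i l] _]; first by rewrite ltW // (lt_trans ltr01).
rewrite /= ord1; case/mxvec_indexP: l => a b.
have -> : v 0 (mxvec_index a b) = (vec_mx v) a b by rewrite mxE.
by apply: le_trans (ltW M1); exact: stiefel_entry_le.
Qed.

(** An open U of the quotient is cut out by the complement of the image of the frames lying over the
    complement of U; these frames form a compact set, so their image is closed. *)
Lemma veronese_embedding : embedding veronese.
Proof.
split; [exact: veronese_immersion|exact: veronese_inj|move=> U; split].
  move=> Uo; have [Z Zo ZU] : exists2 Z : set mat, open Z & set_val @^-1` Z = @prs R n k @^-1` U.
    exact: Uo.
  pose C := @stiefel_set R n k `&` ~` Z.
  have Cc : compact C.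
    apply: compact_stiefel; last by move=> ? [].
    by apply: closedI; [exact: closed_stiefel|exact: open_closedC].
  exists (~` (veronese_lift @` C)).
    apply: closed_openC; apply: compact_closed; first exact: norm_hausdorff.
    apply: continuous_compact => //; apply: continuous_subspaceT.
    exact: veronese_lift_continuous.
  have UZ B : U (prs B) <-> Z (set_val B).
    by have := congr1 (fun S => S B) ZU; rewrite /= => ->.
  apply/seteqP; split=> p; have [B <-] := prs_surj p.
    move=> /UZ ZB [D [VD nZD]]; rewrite veronese_prs => E.
    have BD : prs B = prs (mkst VD) by apply: veronese_inj; rewrite !veronese_prs -E.
    by apply: nZD; apply/(UZ (mkst VD)); rewrite -BD; exact/UZ.
  move=> h; apply/UZ; apply: contrapT => nZ; apply: h; exists (set_val B).
    by split=> //; exact: stiefel_valP.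
  by rewrite -veronese_prs.
move=> [W Wo ->]; have : exists2 Z : set mat, open Z & set_val @^-1` Z = @prs R n k @^-1` (veronese @^-1` W).
  exists (veronese_lift @^-1` W).
    by apply: open_comp => // B _; exact: veronese_lift_continuous.
  by apply/funext => B /=; rewrite veronese_prs.
by [].
Qed.

Lemma projective_stiefel_skew_embedding : admits_skew_embedding PV #|mono_index|.
Proof. by exists veronese; split; [exact: veronese_embedding|exact: veronese_skew]. Qed.

End SkewEmbedding.

(** * The invariants N and m *)

Section Arithmetic.
Local Open Scope nat_scope.
Variables (n k : nat).
Hypothesis (k_gt0 : 0 < k) (k_lt_n : k < n).

Lemma mod2_odd x : (x != 0 %[mod 2]) = odd x.
Proof. by rewrite mod0n modn2 eqb0 negbK. Qed.

Lemma stiefel_N_gt : n - k < stiefel_N n k.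
Proof.
rewrite /stiefel_N; case: arg_minnP => [|i /andP[]//].
by rewrite /= binn andbT ltn_subrL k_gt0 (leq_trans _ k_lt_n).
Qed.

Lemma stiefel_N_min j : n - k < j < stiefel_N n k -> ~~ odd 'C(n, j).
Proof.
rewrite /stiefel_N; case: arg_minnP => [|i _ imin /andP[nj ji]].
  by rewrite /= binn andbT ltn_subrL k_gt0 (leq_trans _ k_lt_n).
have jn : j < n.+1 by exact: ltn_trans ji (ltn_ord i).
apply/negP => oj; have := imin (Ordinal jn); rewrite /= nj oj => /(_ isT).
by rewrite leqNgt ji.
Qed.

Lemma odd_hcoef j : odd 'C(n * k + j - 1, n * k - 1) = (hcoef (n * k) j == 1%R).
Proof.
have nk : 0 < n * k by rewrite muln_gt0 k_gt0 (leq_trans _ k_lt_n).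
have -> : n * k - 1 = (n * k + j - 1) - j by lia.
rewrite bin_sub; last by lia.
rewrite /hcoef; set x := 'C(_, _); have h2 : (2%:R = 0 :> 'F_2)%R by exact/val_inj.
rewrite -[in RHS](odd_double_half x) -mul2n natrD natrM h2 mul0r addr0.
by case: (odd x).
Qed.

Lemma stiefel_mP : exists2 j : 'I_(stiefel_N n k), stiefel_m n k = j &
  odd 'C(n * k + j - 1, n * k - 1).
Proof.
have N0 : 0 < stiefel_N n k by exact: leq_ltn_trans stiefel_N_gt.
pose P := [pred j : 'I_(stiefel_N n k) | odd 'C(n * k + j - 1, n * k - 1)].
have P0 : 0 < #|P|.
  by apply/card_gt0P; exists (Ordinal N0); rewrite inE /= addn0 binn.
have [j Pj E] := eq_bigmax_cond (fun j : 'I_(stiefel_N n k) => j : nat) P0.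
exists j => //; rewrite -E; apply: eq_bigl => i; exact: mod2_odd.
Qed.

Lemma stiefel_m_max j : stiefel_m n k < j < stiefel_N n k ->
  ~~ odd 'C(n * k + j - 1, n * k - 1).
Proof.
move=> /andP[mj jN]; apply/negP => oj; move: mj; rewrite ltnNge => /negP; apply.
by apply: (@leq_bigmax_cond _ _ (fun j : 'I_(stiefel_N n k) => j : nat) (Ordinal jN));
  rewrite /= mod2_odd.
Qed.

End Arithmetic.

Section Orthogonal.
Local Open Scope nat_scope.
Variable n : nat.
Hypothesis n_gt1 : 1 < n.

Lemma stiefel_N_1 : stiefel_N n 1 = n.
Proof.
have := stiefel_N_gt (isT : 0 < 1) n_gt1; have : stiefel_N n 1 < n.+1 by exact: ltn_ord.
by move=> ? ?; lia.
Qed.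

Lemma even_central_bin p : 0 < p -> ~~ odd 'C(p + p, p).
Proof.
case: p => // p _; rewrite addSn binS.
have -> : 'C(p + p.+1, p) = 'C(p + p.+1, p.+1) by rewrite -[RHS]bin_sub ?addnK //; lia.
by rewrite addnn odd_double.
Qed.

(** The only other candidate, m = n - 1, is excluded because the central binomial coefficient 'C(2n
    - 2, n - 1) is even. *)
Lemma stiefel_m_1 : (stiefel_m n 1).+1 < n.
Proof.
have [j E oj] := stiefel_mP (isT : 0 < 1) n_gt1; rewrite E ltn_neqAle.
have jn : j < n by apply: leq_trans (ltn_ord j) _; rewrite stiefel_N_1.
rewrite jn andbT; apply/negP => /eqP jE; move: oj; rewrite muln1.
have -> : n + j - 1 = j + j by lia.
have -> : n - 1 = j by lia.
by apply/negP; apply: even_central_bin; lia.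
Qed.

End Orthogonal.

Lemma stiefel_nonempty (R : realType) n k : (k <= n)%N ->
  exists A : 'M[R]_(n, k), A^T *m A = 1%:M.
Proof.
move=> kn; exists (pid_mx k); rewrite tr_pid_mx mul_pid_mx minnn (minn_idPr kn).
exact: pid_mx_1.
Qed.

(** The case q = 0 of [tangent_rank]. It settles the dimension bound at the default value 0 of
    [manifold_dim]. *)
Lemma symdim_le (R : realType) n k : (k <= n)%N -> (symdim k <= n * k)%N.
Proof.
move=> /(stiefel_nonempty R)[A AA].
apply: (@tangent_rank R n k 0 (fun=> 0) A AA).
- by move=> a u v; rewrite scaler0 addr0.
- by move=> v; rewrite /symm_part trmx0 mulmx0 mul0mx addr0.
- by move=> v _; exact: thinmx0.
Qed.

Lemma manifold_dim_le (R : realType) n k : (0 < k < n)%N ->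
  (manifold_dim (projective_stiefel R n k) + symdim k <= n * k)%N.
Proof.
move=> /andP[k0 kn]; rewrite /manifold_dim; case: xgetP => [q _ hq|_]; last first.
  by rewrite add0n (symdim_le R) // ltnW.
have [A AA] := stiefel_nonempty R (ltnW kn).
have [U [phi [psi [Up ch]]]] := hq (prs (mkst AA)).
exact: chart_dim Up ch k0.
Qed.

(** The explicit embedding makes the set of admissible dimensions nonempty, so [skew_dim] is an
    attained minimum and not its default value. *)
Lemma skew_dimP (R : realType) n k : (0 < k)%N ->
  admits_skew_embedding (projective_stiefel R n k) (skew_dim (projective_stiefel R n k)).
Proof.
move=> k0; set M := projective_stiefel R n k.
have ex : exists d, `[< admits_skew_embedding M d >].
  by eexists; apply/asboolP; exact: projective_stiefel_skew_embedding.
have [d /asboolP hd dmin] := ex_minnP ex.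
rewrite /skew_dim; case: xgetP => [d' _ [//]|/(_ d)]; case.
by split=> // d' hd'; apply: dmin; exact/asboolP.
Qed.

Theorem theorem2p2 (R : realType) (n k : nat) (k_gt0 : (1 <= k)%N)
    (k_lt_n : (k < n)%N) :
  (2 * manifold_dim (projective_stiefel R n k) + 2 * stiefel_m n k + 1
     <= skew_dim (projective_stiefel R n k))%N.
Proof.
have [f sf] := skew_dimP R n k_gt0.
have kn : (0 < k < n)%N by rewrite k_gt0.
have [j mE oj] := stiefel_mP k_gt0 k_lt_n.
have hm : hcoef (n * k) (stiefel_m n k) = 1.
  by apply/eqP; rewrite -odd_hcoef // mE.
have bound := skew_dim_bound sf kn hm; have dim_le := manifold_dim_le R kn.
suff : ((n * k + stiefel_m n k).*2 < skew_dim (projective_stiefel R n k) + (symdim k).*2)%N.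
  by move: (skew_dim _) (manifold_dim _) dim_le => d q; lia.
(* For k > 1 the evenness required by the family of frames holds because m < N and N is the least
   index above n - k with an odd binomial coefficient. *)
apply: bound => [k1 i /andP[ni im]|kE].
  apply: (@stiefel_N_min n k) => //; rewrite ni; apply: leq_ltn_trans im _.
  by rewrite mE; exact: ltn_ord.
clear hm j mE oj; rewrite kE in k_lt_n *.
(* For k = 1 one has N = n, so m + 1 is still in the range of the maximum that defines m, and its
   coefficient is even. *)
have m1 := stiefel_m_1 k_lt_n; split=> //; right.
have := @stiefel_m_max n 1 (stiefel_m n 1).+1; rewrite stiefel_N_1 // ltnSn m1 => /(_ isT).
rewrite odd_hcoef // => h.
by case: (F2_eq01 (hcoef (n * 1) (stiefel_m n 1).+1)) h => ->; rewrite ?eqxx.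
Qed.
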